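(* Assume that $u_0\in X$, $E(u_0)<d$ and $D(u_0)<0$. Then the weak solution $u(t)$ of the problem $$\partial_t (u^{p})=\Delta u+u^{p}\ \text{ in }\Omega\times(0,T),\qquad u(x,0)=u_0(x)\ \text{ in }\Omega,\qquad u=0\ \text{ on }\partial\Omega\times(0,T)$$ blows up in infinite time, that is, $$\lim_{t\to+\infty}\int_0^t\|u(\tau)\|_{p+1}^{p+1}\,d\tau=+\infty.$$
   Context: $\Omega\subset\mathbb{R}^N$, $N\ge 3$, is a smooth bounded domain, $p=\frac{N+2}{N-2}$, $\|\cdot\|_q$ is the norm of $L^q(\Omega)$, and $X=H_0^1(\Omega)$ with norm $\|\nabla u\|_2$. For $u\in X$ put $A(u)=\int_\Omega|\nabla u|^2dx$, $B(u)=\int_\Omega|u|^{p+1}dx$, $E(u)=\frac12A(u)-\frac1{p+1}B(u)$, $D(u)=A(u)-B(u)$. Let $\mathcal N=\{u\in X: D(u)=0,\ u\ne0\}$ and $d=\inf_{v\in\mathcal N}E(v)=\min_{v\in X\setminus\{0\}}\max_{t\ge0}E(tv)$. Weak solution on $\Omega\times(0,T)$: $u\in L^\infty(0,T;X)$, $\frac{\partial}{\partial t}\big(u^{\frac{p+1}{2}}\big)\in L^2(0,T;L^2(\Omega))$, and $((u^p)_t,w)+(\nabla u,\nabla w)=(|u|^p,w)$ for all $w\in X$, $t\in(0,T)$ (in the distribution sense), with $u(x,0)=u_0(x)\in X$; $(\cdot,\cdot)$ is the $L^2(\Omega)$ pairing.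
   Formalization: The weak solution is taken to be nonnegative almost everywhere (so that u^p = |u|^p); for sign-changing or negative u the power u^p is undefined for general N, or the claim with source |u|^p fails (e.g. negative solutions on an annulus, N = 3). *)

(* Defs.v *)
From HB Require Import structures.
From mathcomp Require Import all_boot all_order all_algebra.
From mathcomp Require Import all_classical all_reals all_analysis.
Set Implicit Arguments.
Unset Strict Implicit.
Unset Printing Implicit Defensive.
Import Order.TTheory GRing.Theory Num.Theory.
Import numFieldNormedType.Exports.
Local Open Scope classical_set_scope.
Local Open Scope ring_scope.

(* Product sigma-algebra on R^n (its Borel sets), generated by coordinates. *)
Section measurable_rV.
Context (R : realType) (n : nat).

Let coor (i : 'I_n) (x : 'rV[R]_n) : R := x ord0 i.

Let rV_set0 : g_sigma_preimage coor set0.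
Proof. exact: sigma_algebra0. Qed.

Let rV_setC A : g_sigma_preimage coor A -> g_sigma_preimage coor (~` A).
Proof. exact: sigma_algebraC. Qed.

Let rV_bigcup (F : (set 'rV[R]_n)^nat) :
  (forall i, g_sigma_preimage coor (F i)) ->
  g_sigma_preimage coor (\bigcup_i (F i)).
Proof. exact: sigma_algebra_bigcup. Qed.

Fact rV_display : measure_display. Proof. exact. Qed.

HB.instance Definition _ := @isMeasurable.Build rV_display
  'rV[R]_n (g_sigma_preimage coor) rV_set0 rV_setC rV_bigcup.

Lemma measurable_coord (i : 'I_n) :
  measurable_fun [set: 'rV[R]_n] (fun x => x ord0 i).
Proof.
move=> _ Y mY; rewrite setTI; apply: sub_sigma_algebra => /=.
rewrite -bigcup_seq/=; exists i => /=; first by rewrite mem_index_enum.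
by exists Y => //; rewrite setTI.
Qed.

Lemma measurable_fun_rVP d (T : measurableType d) (f : T -> 'rV[R]_n) :
  (forall i, measurable_fun [set: T] (fun t => f t ord0 i)) ->
  measurable_fun [set: T] f.
Proof.
move=> mf.
have H : g_sigma_preimage (fun i => coor i \o f) `<=` measurable.
  apply: smallest_sub; first exact: sigma_algebra_measurable.
  rewrite -bigcup_seq; apply: bigcup_sub => i _.
  by move=> A [B mB <-]; exact: mf.
move=> _ A mA; apply: H; rewrite g_sigma_preimage_comp.
by exists A.
Qed.

End measurable_rV.

Section lebesgue_rV.
Context (R : realType).

Definition rV_cons n (z : R * 'rV[R]_n) : 'rV[R]_n.+1 :=
  \row_i oapp (fun j => z.2 ord0 j) z.1 (unlift ord0 i).

Lemma measurable_rV_cons n :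
  measurable_fun [set: R * 'rV[R]_n] (@rV_cons n).
Proof.
apply: measurable_fun_rVP => i.
under eq_fun do rewrite mxE.
case: unliftP => [j|] _ /=; last exact: measurable_fst.
apply: (@measurableT_comp _ _ _ _ _ _ (fun x : 'rV[R]_n => x ord0 j)).
  exact: measurable_coord.
exact: measurable_snd.
Qed.

Lemma bij_rV_cons n : exists2 g : 'rV[R]_n.+1 -> R * 'rV[R]_n,
  cancel g (@rV_cons n) & cancel (@rV_cons n) g /\ measurable_fun setT g.
Proof.
exists (fun x => (x ord0 ord0, \row_j x ord0 (lift ord0 j))).
  move=> x; apply/rowP => i; rewrite mxE.
  by case: unliftP => [j|] -> //=; rewrite mxE.
split.
  move=> [a v]; congr pair; rewrite ?mxE ?unlift_none//=.
  by apply/rowP => i; rewrite !mxE liftK.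
apply/measurable_fun_pair; first exact: measurable_coord.
apply: measurable_fun_rVP => i; under eq_fun do rewrite mxE.
exact: measurable_coord.
Qed.

Section step.
Variables (n : nat) (mu : {sigma_finite_measure set 'rV[R]_n -> \bar R}).

Definition lebesgue_rV_step : set 'rV[R]_n.+1 -> \bar R :=
  pushforward ((@lebesgue_measure R) \x mu)%E (@rV_cons n).


Let step0 : lebesgue_rV_step set0 = 0%E.
Proof. by rewrite /lebesgue_rV_step /pushforward preimage_set0 measure0. Qed.

Let step_ge0 A : (0 <= lebesgue_rV_step A)%E.
Proof. by rewrite /lebesgue_rV_step /pushforward; apply: measure_ge0. Qed.

Let step_sigma_additive : semi_sigma_additive lebesgue_rV_step.
Proof.
move=> F mF tF mUF; rewrite /lebesgue_rV_step /pushforward preimage_bigcup.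
have mc A : measurable A -> measurable (@rV_cons n @^-1` A).
  by move=> mA; rewrite -[X in measurable X]setTI; exact: measurable_rV_cons.
apply: measure_semi_sigma_additive => [i||]; first exact: mc.
- apply/trivIsetP => /= i j _ _ ij; rewrite -preimage_setI.
  by move/trivIsetP : tF => /(_ _ _ _ _ ij) ->//; rewrite preimage_set0.
- by rewrite -preimage_bigcup; exact: mc.
Qed.

HB.instance Definition _ := isMeasure.Build _ _ _
  lebesgue_rV_step step0 step_ge0 step_sigma_additive.

Let step_sigma_finite : sigma_finite setT lebesgue_rV_step.
Proof.
have /sigma_finiteP[F [FT ndF Foo]] := sigma_finiteT (@lebesgue_measure R).
have /sigma_finiteP[G [GT ndG Goo]] := sigma_finiteT mu.
have [g gK [Kg mg]] := bij_rV_cons n.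
exists (fun k => g @^-1` (F k `*` G k)).
  rewrite -preimage_bigcup -[LHS](preimage_setT g); congr (_ @^-1` _).
  rewrite -setXTT FT GT predeqE => -[x y]; split.
    move=> [/= [i _ Fix] [k _ Gky]]; exists (maxn i k) => //; split.
    - by move: x Fix; exact/subsetPset/ndF/leq_maxl.
    - by move: y Gky; exact/subsetPset/ndG/leq_maxr.
  by move=> [k _ []/= ? ?]; split; exists k.
move=> k; have [mF Fk] := Foo k; have [mG Gk] := Goo k.
have mFG : measurable (F k `*` G k) by exact: measurableX.
split; first by rewrite -[X in measurable X]setTI; exact: mg.
rewrite /lebesgue_rV_step /pushforward -comp_preimage.
rewrite (_ : g \o _ = id); last by apply/funext => z /=; exact: Kg.
by rewrite preimage_id product_measure1E// lte_mul_pinfty// ge0_fin_numE.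
Qed.

HB.instance Definition _ := Measure_isSigmaFinite.Build _ _ _
  lebesgue_rV_step step_sigma_finite.

End step.

(* n-dimensional Lebesgue measure as an iterated product of lebesgue_measure *)
Fixpoint lebesgue_rV n : {sigma_finite_measure set 'rV[R]_n -> \bar R} :=
  if n is n'.+1 then lebesgue_rV_step (lebesgue_rV n')
  else (\d_(0 : 'rV[R]_0)).

Lemma lebesgue_rV_box n (A : 'I_n -> set R) :
  (forall i, measurable (A i)) ->
  lebesgue_rV n [set x : 'rV[R]_n | forall i, A i (x ord0 i)] =
  (\prod_(i < n) lebesgue_measure (A i))%E.
Proof.
elim: n A => [|n IHn] A mA.
  by rewrite big_ord0 /= diracE mem_set// => -[].
rewrite big_ord_recl -IHn// [LHS]/= /lebesgue_rV_step /pushforward.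
pose B := [set x : 'rV[R]_n | forall i, A (lift ord0 i) (x ord0 i)].
rewrite (_ : _ @^-1` _ = A ord0 `*` B); last first.
  apply/seteqP; split=> [[a v] /= H|[a v] /= [Ha Hv] i].
    split=> [|i]; first by have := H ord0; rewrite mxE unlift_none.
    by have := H (lift ord0 i); rewrite mxE liftK.
  by rewrite mxE; case: unliftP => [j|] -> //=.
suff mB : measurable B.
  transitivity (@lebesgue_measure R (A ord0) * lebesgue_rV n B)%E => [|//].
  by have := @product_measure1E _ _ _ _ _ (@lebesgue_measure R) (lebesgue_rV n)
    _ _ (mA ord0) mB.
rewrite (_ : B = \bigcap_(i in [set: 'I_n])
  ((fun x : 'rV[R]_n => x ord0 i) @^-1` A (lift ord0 i))); last first.
  by apply/seteqP; split=> [x H i _|x H i]; exact: H.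
apply: fin_bigcap_measurable => // i _.
by rewrite -[X in measurable X]setTI; exact: measurable_coord.
Qed.

End lebesgue_rV.

Section smooth_functions.
Context (R : realType) (N : nat).
Implicit Types (f : 'rV[R]_N -> R) (U : set 'rV[R]_N).

Definition partial (i : 'I_N) f : 'rV[R]_N -> R :=
  fun x => 'D_(delta_mx ord0 i) f x.

Definition smooth_on U f := forall (s : seq 'I_N) (x : 'rV[R]_N), U x ->
  {for x, continuous (foldr partial f s)} /\
  forall i, derivable (foldr partial f s) x (delta_mx ord0 i).

Definition test_function U f :=
  [/\ smooth_on setT f, compact (closure [set x | f x <> 0]) &
      closure [set x | f x <> 0] `<=` U].

Definition time_test_function (T : R) (eta : R -> R) :=
  [/\ forall k t, derivable (eta^`(k)%classic) t 1,
      compact (closure [set t | eta t <> 0]) &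
      closure [set t | eta t <> 0] `<=` `]0, T[].

(* The boundary is smooth when, near each of its points, the domain is a
   strict sublevel set of a smooth function with nonvanishing gradient. *)
Definition smooth_bounded_domain (Omega : set 'rV[R]_N) :=
  [/\ open Omega, connected Omega, Omega !=set0, bounded_set Omega &
      forall x, (closure Omega `\` Omega) x ->
      exists U rho, [/\ open U, U x, smooth_on U rho,
        exists i, partial i rho x <> 0 &
        Omega `&` U = [set y | rho y < 0] `&` U]].

End smooth_functions.

Section sobolev.
Context (R : realType) (N : nat) (Omega : set 'rV[R]_N).
Implicit Types (v w g : 'rV[R]_N -> R).
Local Notation mu := (lebesgue_rV R N).

Definition in_Lq (q : R) v : Prop := v \_ Omega \in Lfun mu q%:E.

Definition norm_Lq (q : R) v : \bar R := 'N[mu]_q%:E [EFin \o v \_ Omega]%E.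

Definition L2pair v w : R := \int[mu]_(x in Omega) (v x * w x).

Definition is_weak_partial i v g := forall phi, test_function Omega phi ->
  L2pair v (partial i phi) = - L2pair g phi.

(* The weak partial derivative in L^2, a representative being chosen;
   0 when there is none. *)
Definition weak_partial i v : 'rV[R]_N -> R :=
  xget (fun=> 0) [set g | in_Lq 2 g /\ is_weak_partial i v g].

Definition H1 v := in_Lq 2 v /\
  forall i, exists g, in_Lq 2 g /\ is_weak_partial i v g.

(* closure of the test functions in H^1 *)
Definition H10 v := H1 v /\
  exists phi : nat -> 'rV[R]_N -> R,
  [/\ forall n, test_function Omega (phi n),
      norm_Lq 2 (phi n \- v) @[n --> \oo] --> 0%E &
      forall i, norm_Lq 2 (partial i (phi n) \- weak_partial i v)
        @[n --> \oo] --> 0%E].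

Definition grad_pair v w : R :=
  \int[mu]_(x in Omega) \sum_(i < N) weak_partial i v x * weak_partial i w x.

Definition p_crit : R := (N%:R + 2) / (N%:R - 2).

Definition A_fun v : R :=
  \int[mu]_(x in Omega) \sum_(i < N) weak_partial i v x ^+ 2.

Definition B_fun v : R := \int[mu]_(x in Omega) `|v x| `^ (p_crit + 1).

Definition E_fun v : R := 2^-1 * A_fun v - (p_crit + 1)^-1 * B_fun v.

Definition D_fun v : R := A_fun v - B_fun v.

Definition nehari v := [/\ H10 v, D_fun v = 0 &
  ~ (\forall x \ae mu, Omega x -> v x = 0)].

Definition d_level : R := inf [set E_fun v | v in nehari].

Definition norm_X v : R := Num.sqrt (A_fun v).

End sobolev.

Section weak_solutions.
Context (R : realType) (N : nat) (Omega : set 'rV[R]_N).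
Implicit Types (T : R) (u w g : R -> 'rV[R]_N -> R).
Local Notation mu := (lebesgue_rV R N).
Local Notation leb := (@lebesgue_measure R).
Local Notation p := (p_crit R N).

Definition simple_in_X (s : R -> 'rV[R]_N -> R) :=
  exists m (S : 'I_m -> set R) (phi : 'I_m -> 'rV[R]_N -> R),
  [/\ forall j, measurable (S j), forall j, H10 Omega (phi j) &
      forall t x, s t x = \sum_(j < m) \1_(S j) t * phi j x].

(* u is in L^oo(0, T; X), measurability being strong measurability *)
Definition Linfty_X T u :=
  (exists M, \forall t \ae leb, 0 < t < T ->
    H10 Omega (u t) /\ norm_X Omega (u t) <= M) /\
  (exists s : nat -> R -> 'rV[R]_N -> R, (forall n, simple_in_X (s n)) /\
    \forall t \ae leb, 0 < t < T ->
      norm_X Omega (s n t \- u t) @[n --> \oo] --> 0).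

Definition cylinder T : set (R * 'rV[R]_N) := `]0, T[ `*` Omega.

(* L^2(0, T; L^2(Omega)), identified with L^2((0, T) x Omega) *)
Definition L2_L2 T g :=
  measurable_fun (cylinder T) (fun z : R * 'rV[R]_N => g z.1 z.2) /\
  (\int[(leb \x mu)%E]_(z in cylinder T) (g z.1 z.2 ^+ 2)%:E < +oo)%E.

(* g is the derivative of w in the sense of L^2(Omega)-valued distributions
   on (0, T), an identity in L^2(Omega) being tested against every psi there *)
Definition is_time_derivative T w g :=
  forall eta psi, time_test_function T eta -> in_Lq Omega 2 psi ->
  \int[leb]_(t in `]0, T[) (eta^`()%classic t * L2pair Omega (w t) psi) =
  - \int[leb]_(t in `]0, T[) (eta t * L2pair Omega (g t) psi).

(* Real powers u^p and u^((p+1)/2) are those of nonnegative functions, so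
   that u^p = |u|^p.  As u^((p+1)/2) is in H^1(0, T; L^2(Omega)), hence in
   C([0, T]; L^2(Omega)), u has a trace at t = 0 in L^(p+1)(Omega): the initial
   condition prescribes it, as an essential limit since u is only defined up
   to a null set of times. *)
Record weak_solution (u0 : 'rV[R]_N -> R) T u : Prop := WeakSolution {
  weak_measurable :
    measurable_fun (cylinder T) (fun z : R * 'rV[R]_N => u z.1 z.2) ;
  weak_ge0 : \forall t \ae leb, 0 < t < T ->
    \forall x \ae mu, Omega x -> 0 <= u t x ;
  weak_Linfty : Linfty_X T u ;
  weak_time_derivative : exists g, L2_L2 T g /\
    is_time_derivative T (fun (t : R) x => u t x `^ ((p + 1) / 2)) g ;
  weak_equation : forall eta (w : 'rV[R]_N -> R),
    time_test_function T eta -> H10 Omega w ->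
    - (\int[leb]_(t in `]0, T[)
        (eta^`()%classic t * L2pair Omega (fun x => u t x `^ p) w)) +
    (\int[leb]_(t in `]0, T[) (eta t * grad_pair Omega (u t) w)) =
    \int[leb]_(t in `]0, T[)
        (eta t * L2pair Omega (fun x => `|u t x| `^ p) w) ;
  weak_initial : forall e : R, 0 < e -> exists2 delta : R, 0 < delta &
    \forall t \ae leb, 0 < t < delta ->
      (norm_Lq Omega (p + 1)%R (u t \- u0)%R < e%:E)%E
}.

End weak_solutions.

(* Main.v *)
Require Import Defs.
From HB Require Import structures.
From mathcomp Require Import all_boot all_order all_algebra.
From mathcomp Require Import all_classical all_reals all_analysis.
From mathcomp Require Import measurable_realfun.
From mathcomp Require Import ring lra.
Set Implicit Arguments.
Unset Strict Implicit.
Unset Printing Implicit Defensive.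
Import Order.TTheory GRing.Theory Num.Theory.
Import numFieldNormedType.Exports.
Local Open Scope classical_set_scope.
Local Open Scope ring_scope.

(** The proof has two halves: an energy inequality for weak solutions, which carry no
    regularity beyond the definition, and a potential well argument.  Throughout,
    q = N / (N - 2), so that p + 1 = 2 q and (p + 1) / 2 = q.

    Energy.  Write K(s,t) for the gradient pairing of u(s) and u(t).  The weak equation,
    integrated in time, says that (u(t)^p - u(s)^p, w) is the integral over s < tau < t of
    (u(tau)^p, w) - (grad u(tau), grad w), for almost all s < t and every w in X.  Take
    w = u(t) - u(s): the left side is nonnegative because the power is monotone, and
    convexity of the power bounds (u(tau)^p, u(t) - u(s)) by (B(u(t)) - B(u(s))) / (2 q)
    up to squared increments of u^q in L^2 (conj_increment_le).  As u^q has a square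
    integrable time derivative, those squares are at most (t - s) times the increment of a
    nondecreasing function of time.  With s = t - h, integration in t turns the integrals of
    K(tau,t) - K(tau,t - h) over the strip t - h < tau < t into (h^2 / 2) (A(u(b)) - A(u(0)))
    by symmetry of K (Rintegral_cross_increment), while the right side telescopes
    (Rintegral_increment).  Division by h^2 and h -> 0 give E(u(b)) <= E(u(0)) for almost
    every b (energy_decrease).  No difference quotient of u itself is ever formed.

    Potential well.  If D(w) < 0, then the ray through w meets the Nehari manifold at a
    scale below 1, hence B(w) >= N d (d_level_le); if D(w) >= 0, then B(w) <= N E(w)
    (B_fun_le_energy).  So B(u(t)) avoids the gap between N E(u0) and N d at almost every
    time.  It starts above the gap and its square root is uniformly continuous in time, hence
    it stays above (gap_preserved).  When E(u0) < 0 the bound B >= - 2 q E is immediate.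
    Either way B(u(t)) is bounded below by a positive constant for almost every t, and the
    integral grows at least linearly.

    Three tools carry the analysis.  The critical Sobolev inequality (sobolev) makes all the
    power pairings finite; it comes from a Loomis-Whitney inequality for functions
    dominated by their line integrals (loomis_whitney_lines).  The fundamental lemma of the
    calculus of variations (test_orthogonal_eq0) makes weak gradients linear up to null
    sets.  The lemma of du Bois-Reymond (du_bois_reymond) turns the distributional
    identities in time into integrated ones; the null set of times that it leaves depends on
    the test function, and is made uniform by testing u^q against countably many boxes and
    then by continuity in time (continuity_times_equation). *)

(** * Square integrable functions *)

Section square_integrable.
Context d (T : measurableType d) (R : realType)
        (mu : {measure set T -> \bar R}) (D : set T) (mD : measurable D).
Implicit Types (f g h : T -> R) (a : R).

Definition sqint f := measurable_fun D f /\
  (\int[mu]_(x in D) (f x ^+ 2)%:E < +oo)%E.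

Definition ip f g : R := \int[mu]_(x in D) (f x * g x).

Lemma sqint_integrable_sqr f : sqint f -> mu.-integrable D (fun x => (f x ^+ 2)%:E).
Proof.
move=> [mf foo]; apply/integrableP; split.
  by apply/measurable_EFinP; exact: measurable_funX.
by under eq_integral do rewrite gee0_abs ?lee_fin ?sqr_ge0//.
Qed.

Lemma sqint_integrable f g : sqint f -> sqint g ->
  mu.-integrable D (EFin \o (fun x => f x * g x)).
Proof.
move=> sf sg; have [mf _] := sf; have [mg _] := sg.
apply: (@le_integrable _ _ _ _ _ mD _ (fun x => (f x ^+ 2)%:E + (g x ^+ 2)%:E)%E).
- by apply/measurable_EFinP; exact: measurable_funM.
- move=> x _ /=; rewrite lee_fin [leRHS]ger0_norm ?addr_ge0 ?sqr_ge0//.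
  rewrite normrM -(real_normK (num_real (f x))) -(real_normK (num_real (g x))).
  by have := sqr_ge0 (`|f x| - `|g x|); have := normr_ge0 (f x);
    have := normr_ge0 (g x); nra.
- by apply: integrableD => //; exact: sqint_integrable_sqr.
Qed.

Lemma integrable_le_sqint f g : measurable_fun D f -> sqint g ->
  (forall x, D x -> f x ^+ 2 <= g x ^+ 2) -> sqint f.
Proof.
move=> mf [mg goo] fg; split => //; apply: le_lt_trans goo.
apply: ge0_le_integral => //; first by move=> x _; rewrite lee_fin sqr_ge0.
- by apply/measurable_EFinP; exact: measurable_funX.
- by apply/measurable_EFinP; exact: measurable_funX.
Qed.

Lemma sqintZ a f : sqint f -> sqint (fun x => a * f x).
Proof.
move=> sf; have [mf _] := sf; split; first exact: measurable_funM.
under eq_integral do rewrite exprMn EFinM.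
have /integrableP[_] := integrableZl mD (a ^+ 2) (sqint_integrable_sqr sf).
by under eq_integral do rewrite gee0_abs ?mule_ge0 ?lee_fin ?sqr_ge0//.
Qed.

Lemma sqintD f g : sqint f -> sqint g -> sqint (fun x => f x + g x).
Proof.
move=> sf sg; have [mf _] := sf; have [mg _] := sg.
split; first exact: measurable_funD.
have I : mu.-integrable D (fun x => (2 * f x ^+ 2)%:E + (2 * g x ^+ 2)%:E)%E.
  apply: integrableD => //.
    have := integrableZl mD 2 (sqint_integrable_sqr sf).
    by apply: eq_integrable => // x _; rewrite EFinM.
  have := integrableZl mD 2 (sqint_integrable_sqr sg).
  by apply: eq_integrable => // x _; rewrite EFinM.
have /integrableP[_] := I; apply: le_lt_trans.
apply: ge0_le_integral => //; first by move=> x _; rewrite lee_fin sqr_ge0.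
- by apply/measurable_EFinP; exact/measurable_funX/measurable_funD.
- by apply: measurableT_comp => //; case/integrableP : I.
- move=> x _; rewrite -EFinD/= lee_fin ger0_norm.
    by have := sqr_ge0 (f x - g x); nra.
  by rewrite addr_ge0// mulr_ge0// sqr_ge0.
Qed.

Lemma sqintN f : sqint f -> sqint (fun x => - f x).
Proof.
move=> /(sqintZ (-1)); congr sqint; apply/funext => x; by rewrite mulN1r.
Qed.

Lemma sqintB f g : sqint f -> sqint g -> sqint (fun x => f x - g x).
Proof. by move=> sf /sqintN; exact: sqintD. Qed.

Lemma sqint0 : sqint (fun=> 0).
Proof.
split; first exact: measurable_cst.
by under eq_integral do rewrite expr0n/=; rewrite integral0.
Qed.

Lemma sqint_sum (I : Type) (s : seq I) (F : I -> T -> R) :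
  (forall i, sqint (F i)) -> sqint (fun x => \sum_(i <- s) F i x).
Proof.
move=> sF; elim: s => [|i s IH].
  by under eq_fun do rewrite big_nil; exact: sqint0.
by under eq_fun do rewrite big_cons; exact: sqintD.
Qed.

Lemma ipC f g : ip f g = ip g f.
Proof. by apply: eq_Rintegral => x _; rewrite mulrC. Qed.

Lemma ipDl f g h : sqint f -> sqint g -> sqint h ->
  ip (fun x => f x + g x) h = ip f h + ip g h.
Proof.
move=> sf sg sh; rewrite /ip -RintegralD//; try exact: sqint_integrable.
by apply: eq_Rintegral => x _; rewrite mulrDl.
Qed.

Lemma ipZl a f h : sqint f -> sqint h -> ip (fun x => a * f x) h = a * ip f h.
Proof.
move=> sf sh; rewrite /ip -RintegralZl//; last exact: sqint_integrable.
by apply: eq_Rintegral => x _; rewrite mulrA.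
Qed.

Lemma ipDr f g h : sqint f -> sqint g -> sqint h ->
  ip h (fun x => f x + g x) = ip h f + ip h g.
Proof. by move=> ? ? ?; rewrite ipC ipDl// !(ipC h). Qed.

Lemma ipZr a f h : sqint f -> sqint h -> ip h (fun x => a * f x) = a * ip h f.
Proof. by move=> ? ?; rewrite ipC ipZl// (ipC h). Qed.

Lemma ipBl f g h : sqint f -> sqint g -> sqint h ->
  ip (fun x => f x - g x) h = ip f h - ip g h.
Proof.
move=> sf sg sh; rewrite ipDl//; last exact: sqintN.
by rewrite -[- ip g h]mulN1r -ipZl//; under [in RHS]eq_fun do rewrite mulN1r.
Qed.

Lemma ipBr f g h : sqint f -> sqint g -> sqint h ->
  ip h (fun x => f x - g x) = ip h f - ip h g.
Proof. by move=> ? ? ?; rewrite ipC ipBl// !(ipC h). Qed.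

Lemma ip_suml (I : Type) (s : seq I) (F : I -> T -> R) h :
  (forall i, sqint (F i)) -> sqint h ->
  ip (fun x => \sum_(i <- s) F i x) h = \sum_(i <- s) ip (F i) h.
Proof.
move=> sF sh; elim: s => [|i s IH].
  rewrite big_nil /ip; under eq_Rintegral do rewrite big_nil mul0r.
  by rewrite Rintegral_cst// mul0r.
rewrite big_cons -IH -ipDl//; last exact: sqint_sum.
by apply: eq_Rintegral => x _; rewrite big_cons.
Qed.

Lemma ip_ge0 f : 0 <= ip f f.
Proof. by apply: Rintegral_ge0 => x _; rewrite -expr2 sqr_ge0. Qed.

Lemma ipE f : sqint f -> (ip f f)%:E = (\int[mu]_(x in D) (f x ^+ 2)%:E)%E.
Proof.
move=> sf; rewrite /ip /Rintegral fineK.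
  by apply: eq_integral => x _; rewrite expr2.
by apply: integrable_fin_num => //; exact: sqint_integrable.
Qed.

Lemma cauchy_schwarz_sqr f g : sqint f -> sqint g ->
  ip f g ^+ 2 <= ip f f * ip g g.
Proof.
move=> sf sg.
have H t : 0 <= ip f f + 2 * t * ip f g + t ^+ 2 * ip g g.
  have := ip_ge0 (fun x => f x + t * g x).
  rewrite ipDl//; [|exact: sqintZ|by apply: sqintD => //; exact: sqintZ].
  rewrite ipZl//; [|by apply: sqintD => //; exact: sqintZ].
  rewrite !ipDr//; do ?exact: sqintZ.
  by rewrite !ipZr// (ipC g f); lra.
have := ip_ge0 g; rewrite le_eqVlt => /predU1P[c0|c0].
  rewrite -c0 mulr0; have [->|b0] := eqVneq (ip f g) 0; first by rewrite expr0n.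
  have := H (- (ip f f + 1) / (2 * ip f g)).
  rewrite -c0 mulr0 addr0 (_ : 2 * _ * _ = - (ip f f + 1)); last by field.
  by lra.
have := H (- ip f g / ip g g).
rewrite (_ : _ + _ = ip f f - ip f g ^+ 2 / ip g g); last first.
  by field; rewrite gt_eqF.
by rewrite subr_ge0 ler_pdivrMr.
Qed.

Lemma cauchy_schwarz f g : sqint f -> sqint g ->
  `|ip f g| <= Num.sqrt (ip f f) * Num.sqrt (ip g g).
Proof.
move=> sf sg; rewrite -sqrtrM ?ip_ge0// -sqrtr_sqr ler_sqrt.
  exact: cauchy_schwarz_sqr.
by rewrite mulr_ge0// ip_ge0.
Qed.

Lemma ip_sqrD f g : sqint f -> sqint g ->
  ip (fun x => f x + g x) (fun x => f x + g x) <= 2 * ip f f + 2 * ip g g.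
Proof.
move=> sf sg; have := ip_ge0 (fun x => f x - g x).
rewrite ipBl ?ipBr//; last exact: sqintB.
rewrite ipDl ?ipDr//; last exact: sqintD.
by rewrite (ipC g f); lra.
Qed.

Lemma ip_ae f g h : measurable_fun D f -> measurable_fun D g ->
  measurable_fun D h -> (\forall x \ae mu, D x -> f x = g x) ->
  ip f h = ip g h.
Proof.
move=> mf mg mh fg; rewrite /ip /Rintegral; congr fine.
apply: ae_eq_integral => //.
- by apply/measurable_EFinP; exact: measurable_funM.
- by apply/measurable_EFinP; exact: measurable_funM.
- by apply: filterS fg => x fg Dx; rewrite fg.
Qed.

Lemma ip_eq0_ae f : sqint f -> ip f f = 0 -> \forall x \ae mu, D x -> f x = 0.
Proof.
move=> sf f0; have [mf _] := sf.
have /ae_eq_integral_abs : measurable_fun D (EFin \o (fun x => f x ^+ 2)).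
  by apply/measurable_EFinP; exact: measurable_funX.
move=> /(_ mu mD)[+ _].
have -> : (\int[mu]_(x in D) `|(EFin \o (fun x0 : T => f x0 ^+ 2)%R) x| = 0)%E.
  rewrite -[RHS]/((0:R)%:E) -f0 ipE//; apply: eq_integral => x _.
  by rewrite gee0_abs//= lee_fin sqr_ge0.
move=> /(_ erefl); apply: filterS => x /[apply] -[]/eqP.
by rewrite sqrf_eq0 => /eqP.
Qed.

End square_integrable.

Lemma measurable_fun_powR d (T : measurableType d) (R : realType) (D : set T)
  (f : T -> R) a : measurable_fun D f -> measurable_fun D (fun x => f x `^ a).
Proof. by move=> mf; exact: (measurableT_comp (measurable_powR a) mf). Qed.

Lemma Rintegral_dominated_cvg d (T : measurableType d) (R : realType)
  (mu : {measure set T -> \bar R}) (D : set T) (mD : measurable D)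
  (f_ : (T -> R)^nat) (f g : T -> R) :
  (forall n, measurable_fun D (f_ n)) -> measurable_fun D f ->
  mu.-integrable D (EFin \o g) ->
  (forall x, D x -> f_ ^~ x @ \oo --> f x) ->
  (forall n x, D x -> `|f_ n x| <= g x) ->
  \int[mu]_(x in D) f_ n x @[n --> \oo] --> \int[mu]_(x in D) f x.
Proof.
move=> mf_ mf ig ff fg.
have [||||if_ _] := @dominated_convergence _ _ _ mu D mD (fun n => EFin \o f_ n)
  (EFin \o f) (EFin \o g) _ _ _ ig.
- by move=> n; exact/measurable_EFinP.
- exact/measurable_EFinP.
- by apply/aeW => x Dx; apply: cvg_EFin; [exact: nearW|exact: ff].
- by apply/aeW => x n Dx; rewrite lee_fin; exact: fg.
have ffin : (\int[mu]_(x in D) (EFin \o f) x)%E \is a fin_num.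
  exact: integrable_fin_num.
rewrite -(fineK ffin) => /fine_cvgP[_]; exact.
Qed.

(** * Slicing the Lebesgue measure on row vectors *)
Section lebesgue_rV_theory.
Context (R : realType).
Local Notation leb := (@lebesgue_measure R).
Local Notation RM := (measurableTypeR R).

Lemma measurable_rV_consM n :
  @measurable_fun _ _ (RM * 'rV[R]_n)%type 'rV[R]_n.+1 setT (@rV_cons R n).
Proof. exact: measurable_rV_cons. Qed.

Definition upd n (x : 'rV[R]_n) (i : 'I_n) (s : R) : 'rV[R]_n :=
  \row_j (if j == i then s else x ord0 j).

Lemma upd_cons0 n (a s : R) (v : 'rV[R]_n) :
  upd (rV_cons (a, v)) ord0 s = rV_cons (s, v).
Proof.
by apply/rowP => j; rewrite !mxE; case: unliftP => [k|] -> /=; rewrite ?eqxx.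
Qed.

Lemma upd_cons_lift n (a s : R) (v : 'rV[R]_n) i :
  upd (rV_cons (a, v)) (lift ord0 i) s = rV_cons (a, upd v i s).
Proof.
apply/rowP => j; rewrite !mxE; case: unliftP => [k|] -> //=.
by rewrite (inj_eq lift_inj) !mxE.
Qed.

Lemma ge0_integral_rV_cons n (F : 'rV[R]_n.+1 -> \bar R) :
  measurable_fun setT F -> (forall x, (0 <= F x)%E) ->
  (\int[lebesgue_rV R n.+1]_x F x =
   \int[(leb \x lebesgue_rV R n)%E]_z F (rV_cons z))%E.
Proof.
move=> mF F0.
transitivity (\int[pushforward (leb \x lebesgue_rV R n)%E (@rV_cons R n)]_x F x)%E.
  by [].
by rewrite ge0_integral_pushforward//; exact: measurable_rV_cons.
Qed.

Lemma ge0_integral_rV_recl n (F : 'rV[R]_n.+1 -> \bar R) :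
  measurable_fun setT F -> (forall x, (0 <= F x)%E) ->
  (\int[lebesgue_rV R n.+1]_x F x =
   \int[leb]_s \int[lebesgue_rV R n]_v F (rV_cons (s, v)))%E.
Proof.
move=> mF F0; rewrite ge0_integral_rV_cons//.
have := @fubini_tonelli1 _ _ _ _ _ leb (lebesgue_rV R n) (F \o @rV_cons R n).
by apply=> [|z]; [exact: (measurableT_comp mF (@measurable_rV_consM n))|exact: F0].
Qed.

Lemma ge0_integral_rV_recr n (F : 'rV[R]_n.+1 -> \bar R) :
  measurable_fun setT F -> (forall x, (0 <= F x)%E) ->
  (\int[lebesgue_rV R n.+1]_x F x =
   \int[lebesgue_rV R n]_v \int[leb]_s F (rV_cons (s, v)))%E.
Proof.
move=> mF F0; rewrite ge0_integral_rV_cons//.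
have := @fubini_tonelli2 _ _ _ _ _ leb (lebesgue_rV R n) (F \o @rV_cons R n).
by apply=> [|z]; [exact: (measurableT_comp mF (@measurable_rV_consM n))|exact: F0].
Qed.

Lemma measurable_rV_slice n (s : R) :
  measurable_fun setT (fun v : 'rV[R]_n => rV_cons (s, v)).
Proof.
apply: (measurableT_comp (@measurable_rV_consM n)).
exact: measurable_pair1.
Qed.

Lemma measurable_integral_sliceF n (F : 'rV[R]_n.+1 -> \bar R) :
  measurable_fun setT F -> (forall x, (0 <= F x)%E) ->
  measurable_fun (setT : set RM)
    (fun s => \int[lebesgue_rV R n]_v F (rV_cons (s, v)))%E.
Proof.
move=> mF F0.
have := @measurable_fun_fubini_tonelli_F _ _ _ _ _ (lebesgue_rV R n) (F \o @rV_cons R n).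
by apply=> [|z]; [exact: (measurableT_comp mF (@measurable_rV_consM n))|exact: F0].
Qed.

Lemma measurable_integral_sliceG n (F : 'rV[R]_n.+1 -> \bar R) :
  measurable_fun setT F -> (forall x, (0 <= F x)%E) ->
  measurable_fun setT (fun v => \int[leb]_s F (rV_cons (s, v)))%E.
Proof.
move=> mF F0.
have := @measurable_fun_fubini_tonelli_G _ _ _ _ _ leb (F \o @rV_cons R n).
by apply=> [|z]; [exact: (measurableT_comp mF (@measurable_rV_consM n))|exact: F0].
Qed.

End lebesgue_rV_theory.

(** * An inequality of Loomis-Whitney type *)
Section powers_of_integrals.
Context d (T : measurableType d) (R : realType) (mu : {measure set T -> \bar R}).

(** Log-convexity of the integral in the exponent: Hoelder's inequality with conjugate
    exponents 1 / th and 1 / (1 - th). *)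
Lemma integral_powR_interpolation (f : T -> R) (th r : R) :
  measurable_fun setT f -> (forall x, 0 <= f x) -> 0 < th < 1 -> 0 < r ->
  (\int[mu]_x (f x `^ (th + (1 - th) * r))%:E <=
   (\int[mu]_x (f x)%:E) `^ th * (\int[mu]_x (f x `^ r)%:E) `^ (1 - th))%E.
Proof.
move=> mf f0 /andP[th0 th1] r0.
have th1' : 0 < 1 - th by rewrite subr_gt0.
have := @hoelder _ _ _ mu (fun x => f x `^ th) (fun x => f x `^ ((1 - th) * r))
  th^-1 (1 - th)^-1.
rewrite !invr_gt0 !invrK th0 th1' (addrC th) subrK.
have mp a : measurable_fun setT (fun x => f x `^ a).
  exact: measurable_fun_powR.
move=> /(_ (mp _) (mp _) isT isT erefl).
rewrite Lnorm1 unlock /= !invrK => H.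
apply: (le_trans (le_trans _ H)); rewrite le_eqVlt; apply/orP; left; apply/eqP.
  apply: eq_integral => x _ /=; rewrite ger0_norm ?mulr_ge0 ?powR_ge0// powRD//.
  by apply/implyP; rewrite gt_eqF// addr_gt0// mulr_gt0.
have K (a a' b b' : \bar R) : a = a' -> b = b' ->
  (a `^ th * b `^ (1 - th) = a' `^ th * b' `^ (1 - th))%E by move=> -> ->.
apply: K; apply: eq_integral => x _; rewrite ger0_norm ?powR_ge0// -powRrM.
  by rewrite mulfV ?gt_eqF// powRr1.
by rewrite mulrAC mulfV ?gt_eqF// mul1r.
Qed.

End powers_of_integrals.

Section line_majorant_inequality.
Context (R : realType).
Local Notation leb := (@lebesgue_measure R).

(** The bound satisfied by a compactly supported function f along every coordinate line
    when h dominates its gradient. *)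
Definition line_majorant n (f h : 'rV[R]_n -> R) :=
  forall x i, ((f x)%:E <= \int[leb]_s (h (upd x i s))%:E)%E.

Lemma line_majorant_slice n (f h : 'rV[R]_n.+1 -> R) a : line_majorant f h ->
  line_majorant (fun v => f (rV_cons (a, v))) (fun v => h (rV_cons (a, v))).
Proof.
move=> fh x i; have := fh (rV_cons (a, x)) (lift ord0 i).
by under eq_integral do rewrite upd_cons_lift.
Qed.

Section slices.
Context n (f h : 'rV[R]_n.+1 -> R).
Hypotheses (mf : measurable_fun setT f) (mh : measurable_fun setT h).
Hypotheses (h0 : forall x, 0 <= h x) (fh : line_majorant f h).
Hypothesis (f0 : forall x, 0 <= f x).

(** The bound along the first coordinate line does not see the first coordinate, so that it
    can be integrated over the remaining ones: Tonelli gives the full integral of h. *)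
Lemma integral_slice_le_majorant a :
  (\int[lebesgue_rV R n]_v (f (rV_cons (a, v)))%:E <=
   \int[lebesgue_rV R n.+1]_x (h x)%:E)%E.
Proof.
rewrite ge0_integral_rV_recr//; last exact/measurable_EFinP.
apply: ge0_le_integral => //.
- by move=> v _; rewrite lee_fin.
- apply/measurable_EFinP; apply: (measurableT_comp mf).
  exact: measurable_rV_slice.
- by apply: (measurable_integral_sliceG (F := EFin \o h)) => //; exact/measurable_EFinP.
- move=> v _ /=; have := fh (rV_cons (a, v)) ord0.
  by under eq_integral do rewrite upd_cons0.
Qed.

End slices.

Lemma line_majorant1 (f h : 'rV[R]_1 -> R) : measurable_fun setT h ->
  (forall x, 0 <= h x) -> line_majorant f h ->
  forall x, ((f x)%:E <= \int[lebesgue_rV R 1]_v (h v)%:E)%E.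
Proof.
move=> mh h0 fh x; rewrite ge0_integral_rV_recl//; last exact/measurable_EFinP.
apply: le_trans (fh x ord0) _; rewrite le_eqVlt; apply/orP; left; apply/eqP.
apply: eq_integral => s _; rewrite integral_dirac//; last first.
  by apply/measurable_EFinP/(measurableT_comp mh); exact: measurable_rV_slice.
rewrite diracT mul1e; congr (h _)%:E.
by apply/rowP => j; rewrite !mxE ord1; case: unliftP => [[]|].
Qed.

(** Gagliardo's induction on the dimension.  Fix the first coordinate s.  The exponent
    (n + 3) / (n + 2) is interpolated between 1, where the slice of f has integral at most
    I, the full integral of h, and (n + 2) / (n + 1), where the induction hypothesis bounds
    it by the integral of the slice of h.  The interpolation weights are such that this last
    integral enters with power 1, and it integrates to I again over s. *)
Lemma loomis_whitney_lines n (f h : 'rV[R]_n.+2 -> R) :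
  measurable_fun setT f -> measurable_fun setT h ->
  (forall x, 0 <= f x) -> (forall x, 0 <= h x) -> line_majorant f h ->
  (\int[lebesgue_rV R n.+2]_x (f x `^ (n.+2%:R / n.+1%:R))%:E <=
   (\int[lebesgue_rV R n.+2]_x (h x)%:E) `^ (n.+2%:R / n.+1%:R))%E.
Proof.
elim: n => [|n IH] in f h * => mf mh f0 h0 fh.
  set I := (X in (_ <= X `^ _)%E).
  have I0 : (0 <= I)%E by apply: integral_ge0 => x _; rewrite lee_fin.
  have mf2 : measurable_fun setT (EFin \o (fun x => f x `^ (2 / 1))).
    apply/measurable_EFinP; exact: measurable_fun_powR.
  (* In dimension 2 one factor f is bounded along the line of its second coordinate, the
     other is integrated along the line of its first one. *)
  rewrite ge0_integral_rV_recl//; last by move=> x; rewrite lee_fin powR_ge0.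
  have -> : (I `^ (2 / 1) = I * I)%E.
    move: I0; rewrite divr1; case: I => [r||]// r0; last by rewrite poweRyr// mulyy.
    by rewrite poweR_EFin powR_mulrn// expr2.
  rewrite {2}/I ge0_integral_rV_recl//; last exact/measurable_EFinP.
  have mG : measurable_fun setT
      (fun s => \int[lebesgue_rV R 1]_v (h (rV_cons (s, v)))%:E)%E.
    by apply: (measurable_integral_sliceF (F := EFin \o h)) => //; exact/measurable_EFinP.
  have G0 s : (0 <= \int[lebesgue_rV R 1]_v (h (rV_cons (s, v)))%:E)%E.
    by apply: integral_ge0 => v _; rewrite lee_fin.
  rewrite -ge0_integralZl//.
  apply: ge0_le_integral => //.
  - by move=> s _; apply: integral_ge0 => v _; rewrite lee_fin powR_ge0.
  - apply: (measurable_integral_sliceF (F := EFin \o (fun x => f x `^ (2 / 1)))) => //.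
    by move=> x; rewrite lee_fin powR_ge0.
  - by apply: emeasurable_funM => //; exact: measurable_cst.
  - move=> s _; rewrite muleC.
    have ms := @measurable_rV_slice R 1 s.
    apply: (@le_trans _ _ (\int[lebesgue_rV R 1]_v
        ((\int[lebesgue_rV R 1]_w (h (rV_cons (s, w)))%:E) *
        (f (rV_cons (s, v)))%:E))%E); last first.
      rewrite ge0_integralZl//.
      - by apply: lee_wpmul2l => //; exact: integral_slice_le_majorant.
      - by apply/measurable_EFinP; exact: (measurableT_comp mf).
      - by move=> v _; rewrite lee_fin.
    apply: ge0_le_integral => //.
    + by move=> v _; rewrite lee_fin powR_ge0.
    + by apply: (measurableT_comp mf2).
    + apply: emeasurable_funM; first exact: measurable_cst.
      by apply/measurable_EFinP; exact: (measurableT_comp mf).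
    + move=> v _; rewrite divr1 powR_mulrn// expr2 EFinM lee_wpmul2r ?lee_fin//.
      apply: (line_majorant1 _ _ (line_majorant_slice s fh)) => //.
      exact: (measurableT_comp mh).
set I := (X in (_ <= X `^ _)%E).
have I0 : (0 <= I)%E by apply: integral_ge0 => x _; rewrite lee_fin.
pose th : R := n.+2%:R^-1; pose r : R := n.+2%:R / n.+1%:R.
have th01 : 0 < th < 1 by rewrite invr_gt0 ltr0n invf_lt1 ?ltr0n// ltr1n.
have r0 : 0 < r by rewrite divr_gt0.
have re : (1 - th) * r = 1.
  rewrite /th /r -[n.+2]addn1 natrD; field.
  by have := ler0n R n => ?; apply/andP; split; rewrite gt_eqF//; lra.
have -> : n.+3%:R / n.+2%:R = th + (1 - th) * r :> R.
  by rewrite re /th -[n.+3]addn1 natrD mulrDl mul1r addrC divff.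
set e := _ + _.
have mfe : measurable_fun setT (EFin \o (fun x => f x `^ e)).
  apply/measurable_EFinP; exact: measurable_fun_powR.
rewrite ge0_integral_rV_recl//; last by move=> x; rewrite lee_fin powR_ge0.
pose G s := (\int[lebesgue_rV R n.+2]_v (h (rV_cons (s, v)))%:E)%E.
have G0 s : (0 <= G s)%E by apply: integral_ge0 => v _; rewrite lee_fin.
have mG : measurable_fun setT G.
  by apply: (measurable_integral_sliceF (F := EFin \o h)) => //; exact/measurable_EFinP.
have -> : (I `^ e = I `^ th * \int[leb]_s G s)%E.
  have <- : I = (\int[leb]_s G s)%E.
    apply: (ge0_integral_rV_recl (F := EFin \o h)) => //.
    exact/measurable_EFinP.
  rewrite /e re; have [->|In0] := eqVneq I 0%E.
    by rewrite mule0 poweR0r// gt_eqF// addr_gt0//; case/andP: th01.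
  rewrite poweRD ?poweRe1//; apply: nneg_neq0_poweRD_def => //.
  by rewrite ltW//; case/andP: th01.
rewrite -ge0_integralZl// ?poweR_ge0//.
apply: ge0_le_integral => //.
- by move=> s _; apply: integral_ge0 => v _; rewrite lee_fin powR_ge0.
- apply: (measurable_integral_sliceF (F := EFin \o (fun x => f x `^ e))) => //.
  by move=> x; rewrite lee_fin powR_ge0.
- by apply: emeasurable_funM => //; exact: measurable_cst.
- move=> s _.
  have ms := @measurable_rV_slice R n.+2 s.
  apply: le_trans (integral_powR_interpolation _ _ _ th01 r0) _ => //.
    exact: (measurableT_comp mf).
  apply: lee_pmul; rewrite ?poweR_ge0//.
    apply: gt0_ler_poweR; first by rewrite ltW//; case/andP: th01.
    - by rewrite in_itv/= leey andbT; apply: integral_ge0 => v _; rewrite lee_fin.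
    - by rewrite in_itv/= leey andbT.
    - exact: integral_slice_le_majorant.
  have -> : G s = ((G s `^ r) `^ (1 - th))%E by rewrite -poweRrM mulrC re poweRe1.
  apply: gt0_ler_poweR; first by rewrite subr_ge0 ltW//; case/andP: th01.
  - by rewrite in_itv/= leey andbT; apply: integral_ge0 => v _; rewrite lee_fin powR_ge0.
  - by rewrite in_itv/= leey andbT poweR_ge0.
  - apply: IH => //; [exact: (measurableT_comp mf)|exact: (measurableT_comp mh)|].
    exact: line_majorant_slice.
Qed.

End line_majorant_inequality.

(** * Rational boxes generate the Borel sets *)
Section rational_boxes.
Context (R : realType) (n : nat).
Implicit Types (a b : 'rV[rat]_n) (x : 'rV[R]_n).

Definition obox (a b : 'rV[R]_n) : set 'rV[R]_n :=
  [set x | forall i, a ord0 i < x ord0 i < b ord0 i].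

Definition cbox (a b : 'rV[R]_n) : set 'rV[R]_n :=
  [set x | forall i, a ord0 i <= x ord0 i <= b ord0 i].

Lemma obox_empty (a b : 'rV[R]_n) i : b ord0 i <= a ord0 i -> obox a b = set0.
Proof.
move=> ba; rewrite -subset0 => x /(_ i) /andP[h1 h2].
by have := lt_le_trans (lt_trans h1 h2) ba; rewrite ltxx.
Qed.

Lemma sub_obox_cbox (a b : 'rV[R]_n) : obox a b `<=` cbox a b.
Proof. by move=> x xab i; have /andP[h1 h2] := xab i; rewrite !ltW. Qed.

Definition qbox (ab : 'rV[rat]_n * 'rV[rat]_n) : set 'rV[R]_n :=
  obox (map_mx ratr ab.1) (map_mx ratr ab.2).

Definition qboxes : set (set 'rV[R]_n) := range qbox.

Lemma qboxI ab cd : qbox ab `&` qbox cd =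
  qbox (\row_i Num.max (ab.1 ord0 i) (cd.1 ord0 i),
        \row_i Num.min (ab.2 ord0 i) (cd.2 ord0 i)).
Proof.
have maxP p q (t : R) : (ratr (Num.max p q) < t) = (ratr p < t) && (ratr q < t).
  have [pq|qp] := leP p q; apply/idP/andP => [h|[]//]; split => //.
    by apply: le_lt_trans h; rewrite ler_rat.
  by apply: le_lt_trans h; rewrite ler_rat ltW.
have minP p q (t : R) : (t < ratr (Num.min p q)) = (t < ratr p) && (t < ratr q).
  have [pq|qp] := leP p q; apply/idP/andP => [h|[]//]; split => //.
    by apply: (lt_le_trans h); rewrite ler_rat.
  by apply: (lt_le_trans h); rewrite ler_rat ltW.
apply/seteqP; split => [x [/= xab xcd] i|x xabcd].
  have := xab i; have := xcd i; rewrite !mxE /= => /andP[h1 h2] /andP[h3 h4].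
  by rewrite maxP minP h1 h2 h3 h4.
by split => i; have := xabcd i; rewrite !mxE /= maxP minP =>
  /andP[/andP[h1 h2] /andP[h3 h4]]; rewrite ?h1 ?h2 ?h3 ?h4.
Qed.

Lemma setI_closed_qboxes : setI_closed qboxes.
Proof. by move=> _ _ [ab _ <-] [cd _ <-]; rewrite qboxI; eexists. Qed.

(** The closed boxes are required to lie inside U so that a bump supported in one of
    them is a test function on U. *)
Lemma open_bigcup_qbox (U : set 'rV[R]_n) : open U ->
  U = \bigcup_(ab in [set ab | cbox (map_mx ratr ab.1) (map_mx ratr ab.2) `<=` U])
        qbox ab.
Proof.
move=> oU; apply/seteqP; split=> [x Ux|x [ab /= abU /sub_obox_cbox/abU]//].
have [e e0 xeU] : exists2 e : R, 0 < e & ball x e `<=` U.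
  by move/open_nbhs_nbhs: (conj oU Ux) => /nbhs_ballP[e /= e0 ?]; exists e.
have qa i : {q : rat | x ord0 i - e < ratr q < x ord0 i}.
  apply: cid; have [|q] := @rat_in_itvoo R (x ord0 i - e) (x ord0 i).
    by rewrite ltrBlDr ltrDl.
  by rewrite in_itv /= => ?; exists q.
have qb i : {q : rat | x ord0 i < ratr q < x ord0 i + e}.
  apply: cid; have [|q] := @rat_in_itvoo R (x ord0 i) (x ord0 i + e).
    by rewrite ltrDl.
  by rewrite in_itv /= => ?; exists q.
exists (\row_i sval (qa i), \row_i sval (qb i)).
  move=> y yab; apply: xeU; split => //.
  move=> i j; rewrite ord1 -ball_normE /= => {i}.
  have := yab j; rewrite !mxE /=; case: (qa j) => p /= /andP[? ?].
  case: (qb j) => q /= /andP[? ?] /andP[? ?].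
  by rewrite ltr_distlC; apply/andP; split; lra.
move=> i; rewrite !mxE /=; case: (qa i) => p /= /andP[_ ->].
by case: (qb i) => q /= /andP[-> _].
Qed.

Lemma open_g_qboxes (U : set 'rV[R]_n) : open U -> <<s qboxes >> U.
Proof.
move=> oU; rewrite (open_bigcup_qbox oU) bigcup_mkcond.
apply: (@countable_bigcupT_measurable _ (g_sigma_algebraType qboxes)).
  exact: countableP.
move=> ab; case: ifPn => _; last exact: (@measurable0 _ (g_sigma_algebraType qboxes)).
by apply: sub_sigma_algebra; exists ab.
Qed.

Lemma measurable_obox (a b : 'rV[R]_n) : measurable (obox a b).
Proof.
rewrite (_ : obox a b = \bigcap_(i in [set: 'I_n])
    ((fun x : 'rV[R]_n => x ord0 i) @^-1` `]a ord0 i, b ord0 i[)); last first.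
  apply/seteqP; split => [x xab i _|x xab i]; first by rewrite /= in_itv/=; exact: xab.
  by have := xab i; rewrite /= in_itv/=; exact.
apply: fin_bigcap_measurable => // i _.
by rewrite -[X in measurable X]setTI; exact: measurable_coord.
Qed.

Lemma measurable_qbox ab : measurable (qbox ab).
Proof. exact: measurable_obox. Qed.

Lemma g_qboxes_measurable : <<s qboxes >> `<=` measurable.
Proof.
apply: smallest_sub; first exact: sigma_algebra_measurable.
by move=> _ [ab _ <-]; exact: measurable_qbox.
Qed.

Lemma open_measurable_rV (U : set 'rV[R]_n) : open U -> measurable U.
Proof. by move=> /open_g_qboxes; exact: g_qboxes_measurable. Qed.

Lemma measurable_g_qboxes (A : set 'rV[R]_n) : measurable A -> <<s qboxes >> A.
Proof.
apply: smallest_sub; first exact: smallest_sigma_algebra.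
rewrite -bigcup_seq; apply: bigcup_sub => i _ B [C mC <-]; rewrite setTI.
suff : preimage_set_system setT (fun x : 'rV[R]_n => x ord0 i) measurable
   `<=` <<s qboxes >> by apply; exists C => //; rewrite setTI.
move=> _ [D mD <-]; rewrite setTI.
have : <<s @RGenOpens.G R >> D.
  by have := RGenOpens.measurableE R; rewrite /measurable /= => <-.
move: D {mD}; apply: smallest_sub.
  split.
  - by rewrite /= preimage_set0; exact: (@measurable0 _ (g_sigma_algebraType qboxes)).
  - move=> A' /= mA'; rewrite setTD preimage_setC.
    exact: (@measurableC _ (g_sigma_algebraType qboxes)).
  - move=> F /= mF; rewrite preimage_bigcup.
    exact: (@bigcupT_measurable _ (g_sigma_algebraType qboxes)).
move=> _ [p [q ->]] /=; apply: open_g_qboxes.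
apply: open_comp => [x _|]; last exact: interval_open.
exact: coord_continuous.
Qed.

Lemma continuous_measurable_rV (f : 'rV[R]_n -> R) : continuous f ->
  measurable_fun setT f.
Proof.
move=> cf; apply: (measurability _ (RGenOpens.measurableE R)) => //.
move=> _ [_ [p [q ->]] <-]; rewrite setTI; apply: open_measurable_rV.
by apply: open_comp => [x _|]; [exact: cf|exact: interval_open].
Qed.

Lemma bounded_set_obox (A : set 'rV[R]_n) : bounded_set A ->
  exists M : rat, A `<=` qbox (const_mx (- M), const_mx M).
Proof.
move=> [M [Mr AM]].
have [q /andP[Mq _]] : exists q : rat, M + 1 < ratr q < M + 2.
  have [|q] := @rat_in_itvoo R (M + 1) (M + 2); first by rewrite ltrD2l ltr1n.
  by rewrite in_itv /= => ?; exists q.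
exists q => x Ax i; rewrite !mxE /= rmorphN -ltr_norml.
apply: le_lt_trans Mq; apply: le_trans (AM (M + 1) _ _ Ax); last by rewrite ltrDl.
rewrite [leRHS]/Num.norm /= mx_normrE; apply/bigmax_geP; right => /=.
by exists (ord0, i).
Qed.

Lemma obox_lty (a b : 'rV[R]_n) : (lebesgue_rV R n (obox a b) < +oo)%E.
Proof.
have := @lebesgue_rV_box R n (fun i => `]a ord0 i, b ord0 i[%classic) _.
rewrite (_ : [set x | _] = obox a b); last first.
  apply/seteqP; split => x /= xab i; have := xab i; by rewrite /= in_itv.
move=> -> //.
suff : (0 <= \prod_(i < n) lebesgue_measure `]a ord0 i, b ord0 i[%classic < +oo)%E.
  by case/andP.
elim/big_ind : _ => [|x y /andP[x0 xoo] /andP[y0 yoo]|i _].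
- by rewrite lee01 ltry.
- by rewrite mule_ge0//= lte_mul_pinfty// ge0_fin_numE.
- by rewrite measure_ge0 lebesgue_measure_itv/=; case: ifPn => _; rewrite ltry.
Qed.

Lemma bounded_lty (A : set 'rV[R]_n) : measurable A -> bounded_set A ->
  (lebesgue_rV R n A < +oo)%E.
Proof.
move=> mA /bounded_set_obox[M AM]; apply: le_lt_trans (obox_lty _ _).
apply: le_measure AM; rewrite inE//; exact: measurable_qbox.
Qed.

End rational_boxes.

Section vanishing_integrals.
Context d (T : measurableType d) (R : realType) (mu : {measure set T -> \bar R}).

(** The sets over which g has integral zero form a lambda-system; by Dynkin's theorem it
    contains all measurable sets, in particular those on which g has a constant sign. *)
Lemma integral_pi_system_eq0 (G : set (set T)) (D : set T) (g : T -> R) :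
  setI_closed G -> measurable `<=` <<s G >> -> measurable D ->
  mu.-integrable D (EFin \o g) -> \int[mu]_(x in D) g x = 0 ->
  (forall A, measurable A -> G A -> \int[mu]_(x in A `&` D) g x = 0) ->
  G `<=` measurable ->
  \forall x \ae mu, D x -> g x = 0.
Proof.
move=> GI mG mD ig gD0 gG0 Gm.
pose S := [set A : set T | measurable A /\
  (\int[mu]_(x in A `&` D) (g x)%:E = 0)%E].
have iS A : measurable A -> mu.-integrable (A `&` D) (EFin \o g).
  by move=> mA; apply: integrableS ig => //; exact: measurableI.
have R0 A : measurable A -> \int[mu]_(x in A `&` D) g x = 0 ->
    (\int[mu]_(x in A `&` D) (g x)%:E = 0)%E.
  move=> mA; rewrite /Rintegral => h.
  rewrite -[LHS]fineK ?h//; apply: integrable_fin_num; last exact: iS.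
  exact: measurableI.
have dS : dynkin S.
  split.
  - split; first exact: measurableT.
    by apply: R0; [exact: measurableT|rewrite setTI].
  - move=> A [mA A0]; split; first exact: measurableC.
    have : (\int[mu]_(x in A `&` D) (g x)%:E + \int[mu]_(x in ~` A `&` D) (g x)%:E =
        \int[mu]_(x in D) (g x)%:E)%E.
      rewrite -integral_setU ?setIUl -?setIUl ?setUv ?setTI//.
      - exact: measurableI.
      - by apply: measurableI => //; exact: measurableC.
      - by move/integrableP : ig => [].
      - apply/disj_set2P; rewrite setIACA setICr set0I//.
    rewrite A0 add0e => ->; have := R0 setT measurableT.
    by rewrite setTI; apply.
  - move=> F tF FS; have mF k : measurable (F k) by case: (FS k).
    split; first exact: bigcupT_measurable.
    rewrite setI_bigcupl integral_bigcup//=.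
    + by rewrite eseries0// => k _ _; case: (FS k).
    + by apply: trivIset_setIr.
    + by move=> k; exact: measurableI.
    + by rewrite -setI_bigcupl; apply: iS; exact: bigcupT_measurable.
have GS : measurable `<=` S.
  move=> A /mG; rewrite -setI_closed_g_dynkin_g_sigma_algebra//; move: A.
  apply: smallest_sub => // A GA; split; first exact: Gm.
  by apply: R0; [exact: Gm|apply: gG0 => //; exact: Gm].
have E0 E : E `<=` D -> measurable E ->
    (\int[mu]_(x in E) (EFin \o g) x = \int[mu]_(x in E) cst 0 x)%E.
  by move=> ED mE; rewrite integral0; have [_] := GS E mE; rewrite (setIidl ED).
have := @integral_ae_eq _ _ _ mu D mD (cst 0%E) (EFin \o g) ig (measurable_cst _) E0.
by apply: filterS => x /[apply] -[].
Qed.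

End vanishing_integrals.

(** * Smooth bump functions on the line *)
Section bump_functions.
Context (R : realType).
Implicit Types (c a b x y t : R) (P : {poly R}) (k : nat).

(** Used at the two end points of the support of a bump, where the exponential beats every
    negative power. *)
Lemma is_derive_sqr_bound (f : R -> R) x C : f x = 0 ->
  (forall y, `|f y| <= C * (y - x) ^+ 2) -> is_derive x 1 f 0.
Proof.
move=> fx0 fC; apply/is_derive1_caratheodory.
exists (fun z => if z == x then 0 else (f z - f x) / (z - x)); split.
- move=> z; case: eqP => [->|/eqP zx]; first by rewrite !subrr mulr0.
  by rewrite divfK// subr_eq0.
- rewrite /prop_for /continuous_at eqxx.
  apply/cvgrPdist_le => e e0; near=> z.
  rewrite sub0r normrN; case: eqP => [_|/eqP zx]; first by rewrite normr0 ltW.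
  rewrite fx0 subr0 normrM normfV ler_pdivrMr ?normr_gt0 ?subr_eq0//.
  apply: le_trans (fC z) _; rewrite -real_normK ?num_real// expr2 mulrA.
  rewrite ler_wpM2r//; near: z.
  have C0 : 0 < `|C| + 1 by rewrite ltr_wpDl.
  exists (e / (`|C| + 1)) => /=; first by rewrite divr_gt0.
  move=> z /=; rewrite distrC ltr_pdivlMr// => zC.
  apply: le_trans (ltW zC); rewrite mulrC; apply: ler_wpM2l => //.
  by rewrite (le_trans (ler_norm _))// lerDl.
- by rewrite eqxx.
Unshelve. all: by end_near. Qed.

(** The derivatives of exp (- c / (y (1 - y))) are that exponential times P / (y (1 - y)) ^ k
    for some polynomial P: the family with free P and k is closed under differentiation,
    which makes smoothness an induction. *)
Definition bump01 c P k y : R :=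
  if 0 < y < 1 then P.[y] / (y * (1 - y)) ^+ k * expR (- (c / (y * (1 - y)))) else 0.

Let r : {poly R} := 'X * (1 - 'X).

Let rE y : r.[y] = y * (1 - y).
Proof. by rewrite !hornerE. Qed.

Let bump01_deriv c P k : {poly R} :=
  P^`() * r ^+ 2 - k%:R *: (r^`() * r * P) + c *: (r^`() * P).

Lemma bump01_bound c P k : 0 < c -> exists C, forall y,
  `|bump01 c P k y| <= C * y ^+ 2 /\ `|bump01 c P k y| <= C * (y - 1) ^+ 2.
Proof.
move=> c0; pose M := \sum_(i < size P) `|P`_i|.
have PM y : 0 < y < 1 -> `|P.[y]| <= M.
  move=> /andP[y0 y1]; rewrite horner_coef; apply: le_trans (ler_norm_sum _ _ _) _.
  apply: ler_sum => i _; rewrite normrM ler_piMr// normrX gtr0_norm//.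
  by apply: exprn_ile1; rewrite ltW.
pose C := M * (k.+2`!%:R / c ^+ k.+2).
have C0 : 0 <= C.
  by rewrite mulr_ge0 ?sumr_ge0// divr_ge0// exprn_ge0// ltW.
have H y : 0 < y < 1 -> `|bump01 c P k y| <= C * (y * (1 - y)) ^+ 2.
  move=> y01; rewrite /bump01 y01; have /andP[y0 y1] := y01.
  set s := y * (1 - y); have s0 : 0 < s by rewrite mulr_gt0// subr_gt0.
  rewrite !normrM (gtr0_norm (expR_gt0 _)) normfV (gtr0_norm (exprn_gt0 _ s0)).
  rewrite -mulrA -(mulrA M); apply: ler_pM => //.
  - by rewrite mulr_ge0// ?invr_ge0 ?exprn_ge0 ?expR_ge0// ltW.
  - exact: PM.
  rewrite mulrC ler_pdivrMr ?exprn_gt0// -mulrA -exprD add2n.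
  rewrite expRN -[leRHS]invrK lef_pV2 ?posrE ?expR_gt0 ?invr_gt0//; last first.
    by rewrite mulr_gt0 ?divr_gt0 ?exprn_gt0// ltr0n fact_gt0.
  have := @expR_ge1Dxn R (c / s) k.+1 (ltW (divr_gt0 c0 s0)).
  apply: le_trans; rewrite ler_wpDl//.
  rewrite invfM invf_div expr_div_n mulrAC.
  by rewrite mulrC mulrA.
exists C => y; case: (boolP (0 < y < 1)) => y01; last first.
  by rewrite /bump01 (negbTE y01) normr0; split; apply: mulr_ge0 => //; exact: sqr_ge0.
have /andP[y0 y1] := y01; split; apply: le_trans (H _ y01) _; apply: ler_wpM2l => //.
  by rewrite exprMn ler_piMr ?sqr_ge0// exprn_ile1//; lra.
rewrite exprMn -(sqrrN (y - 1)) opprB ler_piMl ?sqr_ge0// exprn_ile1//; lra.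
Qed.

Lemma is_derive_bump01 c P k y : 0 < c ->
  is_derive y 1 (bump01 c P k) (bump01 c (bump01_deriv c P k) k.+2 y).
Proof.
move=> c0; case: (boolP (0 < y < 1)) => y01; last first.
  rewrite [X in is_derive _ _ _ X](_ : _ = 0); last by rewrite /bump01 (negbTE y01).
  have [C HC] := bump01_bound P k c0.
  have [y0|y0|y0] := ltgtP y 0.
  - apply: (near_eq_is_derive (f := cst 0)).
    near=> z; rewrite /bump01/= ifF//; apply/negP => /andP[z0 _].
    suff : z < 0 by rewrite ltNge ltW.
    by near: z; exact: lt_nbhsl.
  - have [y1|y1|y1] := ltgtP y 1.
    + by move: y01; rewrite y0 y1.
    + apply: (near_eq_is_derive (f := cst 0)).
      near=> z; rewrite /bump01/= ifF//; apply/negP => /andP[_ z0].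
      suff : 1 < z by rewrite ltNge ltW.
      by near: z; exact: lt_nbhsr.
    + rewrite y1; apply: (@is_derive_sqr_bound _ _ C) => [|z].
        by rewrite /bump01 ltxx andbF.
      by case: (HC z).
  - rewrite y0; apply: (@is_derive_sqr_bound _ _ C) => [|z].
      by rewrite /bump01 ltxx.
    by rewrite subr0; case: (HC z).
have /andP[y0 y1] := y01.
have s0 : 0 < r.[y] by rewrite rE mulr_gt0// subr_gt0.
have s0' : r.[y] != 0 by rewrite gt_eqF.
pose g := (horner P * (fun z => (r.[z] ^+ k)^-1)) * (expR \o (fun z => - c * (r.[z])^-1)).
apply: (near_eq_is_derive (f := g)).
  near=> z; rewrite /bump01 /g /= ifT; first by rewrite !fctE /= rE mulNr.
  apply/andP; split; near: z; [exact: lt_nbhsr|exact: lt_nbhsl].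
have d1 := is_derive_poly r y.
have dk : is_derive y 1 (fun z => r.[z] ^+ k) (k%:R * r.[y] ^+ k.-1 * (r^`()).[y]).
  rewrite (_ : (fun z => _) = horner r ^+ k); last by apply/funext => z; rewrite exprfctE.
  exact: (is_deriveX k d1).
have sk0 : r.[y] ^+ k != 0 by rewrite expf_neq0.
have dkV := @is_deriveV _ (fun z => r.[z] ^+ k) y _ _ sk0 dk.
have dV := @is_deriveV _ (horner r) y _ _ s0' d1.
have dcV : is_derive y 1 (fun z => - c * (r.[z])^-1) (- c * (- r.[y] ^- 2 * (r^`()).[y])).
  exact: (is_deriveZ (- c) dV).
have de := is_derive1_comp (is_derive_expR _) dcV.
have dP := is_derive_poly P y.
have dPk := is_deriveM dP dkV.
have := is_deriveM dPk de; rewrite -/g => dg; apply: is_derive_eq dg _.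
have evE (q q' : {poly R}) :
    (P^`() * q ^+ 2 - k%:R *: (q' * q * P) + c *: (q' * P)).[y] =
    P^`().[y] * q.[y] ^+ 2 - k%:R * (q'.[y] * q.[y] * P.[y]) + c * (q'.[y] * P.[y]).
  by rewrite !(hornerD, hornerN, hornerM, horner_exp, hornerZ).
rewrite !fctE /= /bump01 y01 /bump01_deriv -!rE evE /GRing.scale /= mulNr.
have -> : k%:R * r.[y] ^+ k.-1 = k%:R * (r.[y] ^+ k / r.[y]).
  by case: (k) => [|m]; rewrite ?mul0r// exprS mulrAC divff// mul1r.
have -> : r.[y] ^+ k.+2 = r.[y] ^+ 2 * r.[y] ^+ k by rewrite -exprD.
by field; rewrite s0' sk0.
Unshelve. all: by end_near. Qed.

Definition bump c a b P k x : R := bump01 c P k ((x - a) / (b - a)).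

Lemma is_derive_bump c a b P k : 0 < c -> exists P' k', forall x,
  is_derive x 1 (bump c a b P k) (bump c a b P' k' x).
Proof.
move=> c0; exists ((b - a)^-1 *: bump01_deriv c P k), k.+2 => x.
have d1 : is_derive x 1 (fun x => (x - a) / (b - a)) ((b - a)^-1).
  rewrite (_ : (fun x => _) = (b - a)^-1 \*: (id - cst a)); last first.
    by apply/funext => z; rewrite !fctE /GRing.scale /= mulrC.
  by apply: is_derive_eq; rewrite subr0 /GRing.scale/= mulr1.
have := is_derive1_comp (is_derive_bump01 P k _ c0) d1.
move=> H; apply: is_derive_eq H _.
rewrite /bump /bump01; case: ifPn => _; last by rewrite mul0r.
by rewrite hornerZ; ring.
Qed.

Definition smooth1 (f : R -> R) := forall k t, derivable (f^`(k)%classic) t 1.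

Lemma smooth1_derive1 (f : R -> R) : smooth1 f -> smooth1 (f^`()%classic).
Proof. by move=> sf k t; rewrite -derive1Sn; exact: sf. Qed.

Lemma smooth1_bump c a b P k : 0 < c -> smooth1 (bump c a b P k).
Proof.
move=> c0 m; elim: m P k => [|m IH] P k t;
  have [P' [k' HP]] := is_derive_bump a b P k c0; first by case: (HP t).
rewrite derive1Sn (_ : _^`()%classic = bump c a b P' k'); first exact: IH.
by apply/funext => x; rewrite derive1E; case: (HP x).
Qed.

Lemma smooth1_lin (f g : R -> R) (al be : R) : smooth1 f -> smooth1 g ->
  smooth1 (fun x => al * f x + be * g x).
Proof.
move=> sf sg k; elim: k f g sf sg => [|k IH] f g sf sg t.
  by apply: derivableD; apply: derivableZ; [exact: (sf 0%N)|exact: (sg 0%N)].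
rewrite derive1Sn.
rewrite (_ : _^`()%classic = (fun x => al * f^`()%classic x + be * g^`()%classic x)).
  by apply: IH; exact: smooth1_derive1.
apply/funext => x; rewrite !derive1E.
have df := derivableP (sf 0%N x); have dg := derivableP (sg 0%N x).
have : is_derive x 1 (al \*: f + be \*: g) (al *: 'D_1 f x + be *: 'D_1 g x).
  exact: (is_deriveD (is_deriveZ al df) (is_deriveZ be dg)).
by case.
Qed.

Lemma smooth1_continuous (f : R -> R) : smooth1 f -> continuous f.
Proof.
by move=> sf x; apply/differentiable_continuous/derivable1_diffP; exact: (sf 0%N).
Qed.

Definition bump_one c a b x := bump c a b 1 0 x.

Lemma bump_oneE c a b x : a < b -> bump_one c a b x =
  if a < x < b then expR (- (c / ((x - a) / (b - a) * (1 - (x - a) / (b - a)))))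
  else 0.
Proof.
move=> ab; rewrite /bump_one /bump /bump01 expr0 divr1 hornerC mul1r.
by rewrite ltr_pdivlMr ?subr_gt0// mul0r subr_gt0 ltr_pdivrMr ?subr_gt0// mul1r ltrD2r.
Qed.

Lemma bump_one_ge0 c a b x : 0 <= bump_one c a b x.
Proof.
rewrite /bump_one /bump /bump01 expr0 divr1 hornerC mul1r.
by case: ifPn => // _; exact: expR_ge0.
Qed.

Lemma bump_one_le1 c a b x : 0 < c -> bump_one c a b x <= 1.
Proof.
move=> c0; rewrite /bump_one /bump /bump01 expr0 divr1 hornerC mul1r.
case: ifPn => // /andP[y0 y1]; rewrite expR_le1 oppr_le0 divr_ge0//.
  exact: ltW.
by rewrite mulr_ge0 ?subr_ge0// ltW.
Qed.

(** As c tends to 0 the exponential tends to 1 inside the interval: the indicator of an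
    interval is a bounded pointwise limit of bumps. *)
Lemma bump_one_cvg a b x : a < b ->
  bump_one k.+1%:R^-1 a b x @[k --> \oo] --> (\1_`]a, b[%classic x : R).
Proof.
move=> ab; have -> : (\1_`]a, b[%classic x : R) = (a < x < b)%R%:R.
  by rewrite indicE mem_setE in_itv.
set y := (x - a) / (b - a) * (1 - (x - a) / (b - a)).
case: (boolP (a < x < b)) => xab; last first.
  rewrite (_ : (fun k => _) = (fun=> 0)); first exact: cvg_cst.
  by apply/funext => k; rewrite bump_oneE// (negbTE xab).
rewrite (_ : (fun k => _) = (fun k => expR (- (k.+1%:R^-1 / y)))); last first.
  by apply/funext => k; rewrite bump_oneE// xab.
rewrite -[X in _ --> X]expR0.
apply: (@continuous_cvg _ _ _ _ _ _ expR); first exact: continuous_expR.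
rewrite -oppr0; apply: cvgN; rewrite -(mul0r y^-1).
by apply: cvgM; [exact: cvg_harmonic|exact: cvg_cst].
Qed.

End bump_functions.

(** * Test functions on boxes *)
Section coordinate_derivatives.
Context (R : realType) (N : nat).
Implicit Types (f : 'rV[R]_N -> R) (x : 'rV[R]_N) (j : 'I_N).

(** Partial derivatives are ordinary derivatives along the lines upd x j. *)
Lemma shift_delta_upd x j (h : R) :
  h *: delta_mx ord0 j + x = upd x j (h + x ord0 j).
Proof.
apply/rowP => k; rewrite !mxE eqxx /=.
by case: eqP => [->|_]; rewrite ?mulr1// mulr0 add0r.
Qed.

Lemma upd_id x j : upd x j (x ord0 j) = x.
Proof. by apply/rowP => k; rewrite !mxE; case: eqP => [->|]. Qed.

Lemma upd_upd x j s t : upd (upd x j s) j t = upd x j t.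
Proof. by apply/rowP => k; rewrite !mxE; case: eqP. Qed.

Lemma upd_same x j s : upd x j s ord0 j = s.
Proof. by rewrite mxE eqxx. Qed.

Let quotientE f x j :
  (fun h : R => h^-1 *: ((f \o shift x) (h *: delta_mx ord0 j) - f x)) =
  (fun h : R => h^-1 *: (((fun s => f (upd x j s)) \o shift (x ord0 j)) (h *: 1)
                - f (upd x j (x ord0 j)))).
Proof.
apply/funext => h; rewrite /= upd_id /shift /= shift_delta_upd.
by rewrite /GRing.scale /= mulr1.
Qed.

Lemma derivable_partialP f x j : derivable f x (delta_mx ord0 j) <->
  derivable (fun s => f (upd x j s)) (x ord0 j) 1.
Proof. by rewrite /derivable quotientE. Qed.

Lemma partialE f x j :
  partial j f x = 'D_1 (fun s => f (upd x j s)) (x ord0 j).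
Proof. by rewrite /partial /derive quotientE. Qed.

Lemma is_derive_upd f x j s : derivable f (upd x j s) (delta_mx ord0 j) ->
  is_derive s 1 (fun s => f (upd x j s)) (partial j f (upd x j s)).
Proof.
move=> /derivable_partialP; rewrite upd_same => d.
rewrite partialE upd_same; under eq_fun do rewrite -(upd_upd x j s).
exact: derivableP.
Qed.

Lemma continuous_upd x j : continuous (upd x j).
Proof.
move=> s; apply/cvg_ballP => e e0; near=> t; split => // i k; rewrite !mxE.
case: eqP => _; last exact: ballxx.
by near: t; exists e.
Unshelve. all: by end_near. Qed.

End coordinate_derivatives.

Section product_bumps.
Context (R : realType) (N : nat).
Implicit Types (a b : 'rV[R]_N) (c : R).

(** Products of smooth functions of one coordinate each are stable under partial
    derivatives, hence smooth. *)
Definition coord_prod (F : 'I_N -> R -> R) (x : 'rV[R]_N) := \prod_i F i (x ord0 i).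

Definition derive_at j (F : 'I_N -> R -> R) i : R -> R :=
  if i == j then (F i)^`()%classic else F i.

Lemma is_derive_coord_prod F x j : (forall i, smooth1 (F i)) ->
  is_derive x (delta_mx ord0 j) (coord_prod F) (coord_prod (derive_at j F) x).
Proof.
move=> sF; pose C := \prod_(i | i != j) F i (x ord0 i).
have FE s : coord_prod F (upd x j s) = C * F j s.
  rewrite /coord_prod (bigD1 j)//= mxE eqxx mulrC; congr (_ * _).
  by apply: eq_bigr => i /negbTE ij; rewrite mxE ij.
have d1 : is_derive (x ord0 j) 1 (fun s => coord_prod F (upd x j s))
    (C *: 'D_1 (F j) (x ord0 j)).
  under eq_fun do rewrite FE.
  exact: (is_deriveZ C (derivableP (sF j 0%N (x ord0 j)))).
split; first by apply/derivable_partialP; case: d1.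
have := @partialE R N (coord_prod F) x j; rewrite /partial => ->.
case: d1 => _ ->; rewrite /coord_prod (bigD1 j)//= /derive_at eqxx mulrC derive1E.
by rewrite /GRing.scale /=; congr (_ * _); apply: eq_bigr => i /negbTE ->.
Qed.

Lemma continuous_coord_prod F : (forall i, smooth1 (F i)) -> continuous (coord_prod F).
Proof.
move=> sF; rewrite /coord_prod; apply: continuous_big.
  by move=> [a b]; apply: cvgM; [exact: cvg_fst|exact: cvg_snd].
move=> i _ x; apply: (@continuous_comp _ _ _ (fun x : 'rV[R]_N => x ord0 i) (F i)).
  exact: coord_continuous.
exact: smooth1_continuous.
Qed.

Lemma smooth_coord_prod F (s : seq 'I_N) : (forall i, smooth1 (F i)) ->
  exists2 G, (forall i, smooth1 (G i)) &
    foldr (@partial R N) (coord_prod F) s = coord_prod G.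
Proof.
move=> sF; elim: s => [|j s [G sG IH]] /=; first by exists F.
exists (derive_at j G); first by move=> i; rewrite /derive_at; case: eqP => // _; exact: smooth1_derive1.
by rewrite IH; apply/funext => x; rewrite /partial; case: (is_derive_coord_prod x j sG).
Qed.

Lemma smooth_on_coord_prod F : (forall i, smooth1 (F i)) ->
  smooth_on setT (coord_prod F).
Proof.
move=> sF s x _; have [G sG ->] := smooth_coord_prod s sF.
split; first exact: continuous_coord_prod.
by move=> i; case: (is_derive_coord_prod x i sG).
Qed.

Lemma compact_cbox a b : compact (cbox a b).
Proof.
have := @rV_compact R N (fun i => `[a ord0 i, b ord0 i]%classic).
rewrite (_ : [set v | _] = cbox a b); last first.
  by apply/seteqP; split => x /= xab i; have := xab i; rewrite /= in_itv.
by apply => i; exact: segment_compact.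
Qed.

Lemma closed_cbox a b : closed (cbox a b).
Proof. by apply: compact_closed; [exact: norm_hausdorff|exact: compact_cbox]. Qed.

Definition box_bump c (a b : 'rV[R]_N) :=
  coord_prod (fun i => bump_one c (a ord0 i) (b ord0 i)).

Lemma test_function_box_bump c a b (Omega : set 'rV[R]_N) : 0 < c ->
  (forall i, a ord0 i < b ord0 i) ->
  cbox a b `<=` Omega -> test_function Omega (box_bump c a b).
Proof.
move=> c0 ab abO.
have supp : closure [set x | box_bump c a b x <> 0] `<=` cbox a b.
  have /closure_id -> := @closed_cbox a b.
  apply: closureS => x /= x0 i; apply/andP.
  apply: contrapT => xi; apply: x0; rewrite /box_bump /coord_prod (bigD1 i)//=.
  rewrite bump_oneE// ifF ?mul0r//; apply/negP => /andP[h1 h2]; apply: xi.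
  by rewrite !ltW.
split; first by apply: smooth_on_coord_prod => i; exact: smooth1_bump.
- apply: subclosed_compact supp; [exact: closed_closure|exact: compact_cbox].
- exact: subset_trans supp abO.
Qed.

Lemma box_bump_ge0 c a b x : 0 <= box_bump c a b x.
Proof. by apply: prodr_ge0 => i _; exact: bump_one_ge0. Qed.

Lemma box_bump_le1 c a b x : 0 < c -> box_bump c a b x <= 1.
Proof.
by move=> c0; apply: prodr_ile1 => i _; rewrite bump_one_ge0 bump_one_le1.
Qed.

Lemma box_bump_cvg a b x : (forall i, a ord0 i < b ord0 i) ->
  box_bump k.+1%:R^-1 a b x @[k --> \oo] --> (\1_(obox a b) x : R).
Proof.
move=> ab.
have -> : (\1_(obox a b) x : R) = \prod_i (\1_`]a ord0 i, b ord0 i[%classic (x ord0 i)).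
  rewrite indicE; case: (boolP (x \in obox a b)) => [|/negP]; rewrite inE => xab.
    rewrite big1// => i _; rewrite indicE mem_set//= in_itv/=; exact: xab.
  have [i xi] : exists i, ~ (a ord0 i < x ord0 i < b ord0 i) by apply/existsNP.
  rewrite (bigD1 i)//= indicE memNset ?mul0r//= in_itv/=; exact/negP.
apply: cvg_big => [|i _]; last exact: bump_one_cvg.
by move=> [u v]; apply: cvgM; [exact: cvg_fst|exact: cvg_snd].
Qed.

End product_bumps.

(** * The fundamental lemma of the calculus of variations *)
Section fundamental_lemma.
Context (R : realType) (N : nat) (Omega : set 'rV[R]_N).
Local Notation mu := (lebesgue_rV R N).

(** Dominated convergence: orthogonality to the box bumps passes to the indicator of the
    box. *)
Lemma integral_obox_eq0 (g : 'rV[R]_N -> R) a b :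
  mu.-integrable Omega (EFin \o g) -> measurable Omega ->
  (forall psi, test_function Omega psi -> L2pair Omega g psi = 0) ->
  cbox a b `<=` Omega -> \int[mu]_(x in obox a b) g x = 0.
Proof.
move=> ig mO g0 abO.
have [ab|] := pselect (forall i, a ord0 i < b ord0 i); last first.
  move=> /existsNP[i /negP]; rewrite -leNgt => ba.
  by rewrite (obox_empty ba) Rintegral_set0.
have ik k : 0 < k.+1%:R^-1 :> R by rewrite invr_gt0.
have mg : measurable_fun Omega g by move/integrableP : ig => [/measurable_EFinP].
have tb k := test_function_box_bump (ik k) ab abO.
have mb k : measurable_fun setT (box_bump k.+1%:R^-1 a b).
  apply: continuous_measurable_rV; apply: continuous_coord_prod => i.
  exact: smooth1_bump.
have m1 : measurable_fun Omega (fun x => g x * \1_(obox a b) x).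
  apply: measurable_funM => //; apply: measurable_funTS.
  by apply: measurable_indic; exact: measurable_obox.
have := @Rintegral_dominated_cvg _ _ _ mu Omega mO
  (fun k x => g x * box_bump k.+1%:R^-1 a b x)
  (fun x => g x * \1_(obox a b) x) (fun x => `|g x|) _ m1.
have -> : \int[mu]_(x in obox a b) g x = \int[mu]_(x in Omega) (g x * \1_(obox a b) x).
  rewrite -{1}(setIidl (subset_trans (@sub_obox_cbox _ _ a b) abO)) setIC.
  rewrite Rintegral_mkcondr; apply: eq_Rintegral => x _.
  by rewrite patchE indicE; case: ifPn => _; rewrite ?mulr1// mulr0.
move=> H; apply/esym/(cvg_unique _ _ (H _ _ _ _)) => //.
- rewrite (_ : (fun n => _) = (fun=> 0)); first exact: cvg_cst.
  by apply/funext => k; exact: g0.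
- by move=> k; apply: measurable_funM => //; exact: measurable_funTS.
- exact: integrable_norm.
- by move=> x _; apply: cvgM; [exact: cvg_cst|exact: box_bump_cvg].
- move=> k x _; rewrite normrM ler_piMr// ger0_norm ?box_bump_ge0//.
  exact: box_bump_le1.
Qed.

(** Inside a box whose closure lies in Omega, the rational boxes form a pi-system on
    which the integrals of g vanish; countably many such boxes cover Omega. *)
Lemma test_orthogonal_eq0 (g : 'rV[R]_N -> R) : open Omega ->
  mu.-integrable Omega (EFin \o g) ->
  (forall psi, test_function Omega psi -> L2pair Omega g psi = 0) ->
  \forall x \ae mu, Omega x -> g x = 0.
Proof.
move=> oO ig g0; have mO : measurable Omega by exact: open_measurable_rV.
have Q0 (ab : 'rV[rat]_N * 'rV[rat]_N) :
    cbox (map_mx ratr ab.1) (map_mx ratr ab.2) `<=` Omega ->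
    \forall x \ae mu, @qbox R N ab x -> g x = 0.
  move=> abO; have abO' := subset_trans (@sub_obox_cbox _ _ _ _) abO.
  apply: (@integral_pi_system_eq0 _ _ _ mu (@qboxes R N)).
  - exact: setI_closed_qboxes.
  - exact: measurable_g_qboxes.
  - exact: measurable_qbox.
  - by apply: integrableS ig => //; exact: measurable_qbox.
  - exact: integral_obox_eq0.
  - move=> _ _ [cd _ <-]; rewrite qboxI; apply: integral_obox_eq0 => // x xabcd.
    apply: abO => i; have /andP[] := xabcd i; rewrite !mxE /=.
    by rewrite maxEle minEle => h1 h2; apply/andP; split;
      [apply: le_trans h1|apply: (le_trans h2)]; case: ifPn => //;
      rewrite ler_rat // -ltNge => /ltW.
  - by move=> _ [cd _ <-]; exact: measurable_qbox.
have {}Q0 (k : nat) : \forall x \ae mu, forall ab, pickle ab = k ->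
    cbox (map_mx ratr ab.1) (map_mx ratr ab.2) `<=` Omega -> @qbox R N ab x -> g x = 0.
  case E : (@unpickle ('rV[rat]_N * 'rV[rat]_N)%type k) => [ab|]; last first.
    by apply/aeW => x ab abk; move: E; rewrite -abk pickleK.
  have [abO|abO] := pselect (cbox (map_mx ratr ab.1) (map_mx ratr ab.2) `<=` Omega).
    apply: filterS (Q0 _ abO) => x gx cd cdk _ xcd; apply: gx.
    by move: E; rewrite -cdk pickleK => -[<-].
  by apply/aeW => x cd cdk; move: E; rewrite -cdk pickleK => -[->].
have := ae_foralln Q0.
apply: filterS => x gx Ox; move: (Ox); rewrite (open_bigcup_qbox oO) => -[ab abO xab].
exact: (gx _ ab erefl).
Qed.

End fundamental_lemma.

(** * Weak gradients and the space X *)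
Lemma sqrtr_sqr_nneg (R : rcfType) (x : R) : 0 <= x -> Num.sqrt (x ^+ 2) = x.
Proof. by move=> x0; rewrite sqrtr_sqr ger0_norm. Qed.

Lemma psd_discriminant (R : realFieldType) (x y z : R) : 0 <= y ->
  (forall a b, 0 <= a ^+ 2 * x + 2 * a * b * z + b ^+ 2 * y) -> z ^+ 2 <= x * y.
Proof.
rewrite le_eqVlt => /predU1P[<-|y0] H.
  rewrite mulr0; have [->|z0] := eqVneq z 0; first by rewrite expr0n.
  have := H 1 (- (x + 1) / (2 * z)).
  by rewrite mulr0 addr0 (_ : 2 * 1 * _ * _ = - (x + 1)); [lra|field].
have h := H y (- z); rewrite -subr_ge0 -(pmulr_rge0 _ y0).
by apply: le_trans h _; rewrite le_eqVlt; apply/orP; left; apply/eqP; ring.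
Qed.

Section sobolev_spaces.
Context (R : realType) (N : nat) (Omega : set 'rV[R]_N).
Hypotheses (oO : open Omega) (fO : (lebesgue_rV R N Omega < +oo)%E).
Local Notation mu := (lebesgue_rV R N).
Local Notation wp := (weak_partial Omega).
Local Notation sq := (sqint mu Omega).
Local Notation ipO := (ip mu Omega).
Implicit Types (v w g phi psi : 'rV[R]_N -> R) (i : 'I_N).

Let mO : measurable Omega. Proof. exact: open_measurable_rV. Qed.

Lemma L2pairE v w : L2pair Omega v w = ipO v w. Proof. by []. Qed.

Lemma norm_LqE q v : q != 0 -> norm_Lq Omega q v =
  ((\int[mu]_(x in Omega) (`|v x| `^ q)%:E) `^ q^-1)%E.
Proof.
move=> q0; rewrite /norm_Lq unlock [in RHS]integral_mkcond; congr (_ `^ _)%E.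
apply: eq_integral => x _ /=; rewrite !patchE; case: ifPn => // _.
by rewrite normr0 powR0.
Qed.

Lemma in_Lq2P v : in_Lq Omega 2 v <-> sq v.
Proof.
rewrite /in_Lq /sqint -[in X in _ <-> X](setTI Omega).
have sqE : (\int[mu]_(x in Omega) (v x ^+ 2)%:E =
   \int[mu]_(x in Omega) (`|v x| `^ 2)%:E)%E.
  by apply: eq_integral => x _; rewrite powR_mulrn// real_normK ?num_real.
rewrite setTI sqE; split.
  move=> /andP[]; rewrite !inE /= => mv.
  rewrite /finite_norm -/(norm_Lq Omega 2 v) norm_LqE// => foo; split.
    exact/(measurable_restrictT _ mO).
  by apply: lty_poweRy foo; rewrite invr_neq0.
move=> [mv foo]; apply/andP; split; rewrite !inE /=.
  exact/(measurable_restrictT _ mO).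
by rewrite /finite_norm -/(norm_Lq Omega 2 v) norm_LqE// poweR_lty.
Qed.

Lemma norm_L2E v : sq v -> norm_Lq Omega 2 v = (Num.sqrt (ipO v v))%:E.
Proof.
move=> sv; rewrite norm_LqE//.
rewrite (eq_integral (fun x => (v x ^+ 2)%:E)); last first.
  by move=> x _; rewrite powR_mulrn// real_normK ?num_real.
by rewrite -ipE// poweR_EFin powR12_sqrt// ip_ge0.
Qed.

Lemma sq_integrable v : sq v -> mu.-integrable Omega (EFin \o v).
Proof.
move=> sv; have [mv _] := sv.
have s1 : sq (fun=> 1).
  split; first exact: measurable_cst.
  by rewrite integral_cst// expr1n mul1e.
have := sqint_integrable mO sv s1.
by apply: eq_integrable => // x _ /=; rewrite mulr1.
Qed.

Lemma test_continuous phi : test_function Omega phi -> continuous phi.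
Proof. by move=> [sphi _ _] x; have [] := sphi [::] x I. Qed.

Lemma test_measurable phi : test_function Omega phi -> measurable_fun setT phi.
Proof. by move=> /test_continuous; exact: continuous_measurable_rV. Qed.

Lemma test_derivable phi x i : test_function Omega phi ->
  derivable phi x (delta_mx ord0 i).
Proof. by move=> [sphi _ _]; have [_] := sphi [::] x I; exact. Qed.

Lemma test_bounded phi : test_function Omega phi ->
  exists M : R, 0 <= M /\ forall x, `|phi x| <= M.
Proof.
move=> tphi; have [_ cphi _] := tphi.
have := @compact_bounded R _ _ (continuous_compact _ cphi).
move=> /(_ _ phi)/(_ (continuous_subspaceT (test_continuous tphi))).
move=> [M [Mr HM]]; exists (`|M| + 1); split; first by rewrite addr_ge0.
move=> x; have [->|x0] := eqVneq (phi x) 0; first by rewrite normr0 addr_ge0.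
apply: HM; first by rewrite ltr_pwDr// ler_norm.
by exists x => //; apply: subset_closure => /=; exact/eqP.
Qed.

Lemma test_partial phi i : test_function Omega phi ->
  test_function Omega (partial i phi).
Proof.
move=> [sphi cphi Ophi].
have supp : closure [set x | partial i phi x <> 0] `<=` closure [set x | phi x <> 0].
  rewrite [X in _ `<=` X](closure_id _).1; last exact: closed_closure.
  apply: closureS => x /= dx; apply: contrapT => nx; apply: dx.
  have ox : open_nbhs x (~` closure [set x | phi x <> 0]).
    by split => //; exact/closed_openC/closed_closure.
  transitivity ('D_(delta_mx ord0 i) (cst (0 : R)) x); last exact: derive_cst.
  apply: near_eq_derive; move/open_nbhs_nbhs : ox; apply: filterS => y ny.
  by apply: contrapT => phiy; apply: ny; exact: subset_closure.
split.
- by move=> s x _; have := sphi (rcons s i) x I; rewrite -cats1 foldr_cat.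
- by apply: subclosed_compact supp; [exact: closed_closure|].
- exact: subset_trans supp Ophi.
Qed.

Lemma test_out phi x : test_function Omega phi -> ~ Omega x -> phi x = 0.
Proof.
by move=> [_ _ Ophi] nx; apply: contrapT => h; apply/nx/Ophi/subset_closure.
Qed.

Lemma sq_test phi : test_function Omega phi -> sq phi.
Proof.
move=> tphi; have [M [M0 HM]] := test_bounded tphi.
apply: (@integrable_le_sqint _ _ _ mu _ _ _ (fun=> M)) => //.
- exact: (measurable_funTS (test_measurable tphi)).
- by split; [exact: measurable_cst|rewrite integral_cst// lte_mul_pinfty// lee_fin sqr_ge0].
- by move=> x _; rewrite -(real_normK (num_real (phi x))) lerXn2r// nnegrE.
Qed.

(** The weak partial derivative is a chosen representative: identities between such
    derivatives only hold almost everywhere. *)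
Lemma weak_partialP i v : H1 Omega v -> sq (wp i v) /\ is_weak_partial Omega i v (wp i v).
Proof.
move=> [_ /(_ i) H]; have := xgetPex (fun=> 0) H.
by rewrite -/(wp i v) => -[/in_Lq2P].
Qed.

Lemma H1_sq v : H1 Omega v -> sq v. Proof. by move=> [/in_Lq2P]. Qed.

Lemma weak_partial_unique i v g g' : sq g -> sq g' ->
  is_weak_partial Omega i v g -> is_weak_partial Omega i v g' ->
  \forall x \ae mu, Omega x -> g x = g' x.
Proof.
move=> sg sg' wg wg'.
have := @test_orthogonal_eq0 R N Omega (fun x => g x - g' x) oO.
move=> /(_ (sq_integrable (sqintB mO sg sg'))) H.
have {}H := H _.
apply: filterS (H _) => [x gx Ox|psi tpsi].
  by apply/eqP; rewrite -subr_eq0; apply/eqP/gx.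
rewrite L2pairE ipBl//; last exact: sq_test.
by have := wg _ tpsi; rewrite wg'// => /oppr_inj; rewrite !L2pairE => ->; rewrite subrr.
Qed.

Lemma H1_lin a b v w : H1 Omega v -> H1 Omega w ->
  H1 Omega (fun x => a * v x + b * w x) /\
  forall i, \forall x \ae mu, Omega x ->
    wp i (fun x => a * v x + b * w x) x = a * wp i v x + b * wp i w x.
Proof.
move=> Hv Hw; have sv := H1_sq Hv; have sw := H1_sq Hw.
have slin f g : sq f -> sq g -> sq (fun x => a * f x + b * g x).
  by move=> sf sg; apply: sqintD => //; exact: sqintZ.
have wlin i : sq (fun x => a * wp i v x + b * wp i w x) /\
    is_weak_partial Omega i (fun x => a * v x + b * w x)
      (fun x => a * wp i v x + b * wp i w x).
  have [sdv dv] := weak_partialP i Hv; have [sdw dw] := weak_partialP i Hw.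
  split; first exact: slin.
  move=> psi tpsi; have tp := sq_test (test_partial i tpsi); have st := sq_test tpsi.
  rewrite !L2pairE !ipDl//; do ?exact: sqintZ.
  rewrite !ipZl//; have := dv _ tpsi; have := dw _ tpsi.
  by rewrite !L2pairE => -> ->; rewrite opprD !mulrN.
have Hvw : H1 Omega (fun x => a * v x + b * w x).
  split; first by apply/in_Lq2P; exact: slin.
  move=> i; exists (fun x => a * wp i v x + b * wp i w x).
  by have [/in_Lq2P] := wlin i.
split => // i; have [s1 w1] := weak_partialP i Hvw; have [s2 w2] := wlin i.
exact: weak_partial_unique s1 s2 w1 w2.
Qed.

Lemma grad_pairE v w : H1 Omega v -> H1 Omega w ->
  grad_pair Omega v w = \sum_i ipO (wp i v) (wp i w).
Proof.
move=> Hv Hw; rewrite /grad_pair.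
have : forall s : seq 'I_N, \int[mu]_(x in Omega) (\sum_(i <- s) wp i v x * wp i w x) =
    \sum_(i <- s) ipO (wp i v) (wp i w) /\
    mu.-integrable Omega (EFin \o (fun x => \sum_(i <- s) wp i v x * wp i w x)).
  elim=> [|i s [IH Is]].
    split; first by under eq_Rintegral do rewrite big_nil; rewrite big_nil Rintegral_cst// mul0r.
    under [X in _.-integrable _ X]eq_fun do rewrite /= big_nil.
    exact: integrable0.
  have [sv _] := weak_partialP i Hv; have [sw _] := weak_partialP i Hw.
  have I1 := sqint_integrable mO sv sw.
  split.
    rewrite big_cons -IH -RintegralD//; apply: eq_Rintegral => x _.
    by rewrite big_cons.
  have := integrableD mO I1 Is; apply: eq_integrable => // x _ /=.
  by rewrite big_cons EFinD.
by move=> /(_ (index_enum _))[].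
Qed.

Lemma A_funE v : A_fun Omega v = grad_pair Omega v v.
Proof. by apply: eq_Rintegral => x _; apply: eq_bigr => i _; rewrite expr2. Qed.

Lemma grad_pairC v w : grad_pair Omega v w = grad_pair Omega w v.
Proof. by apply: eq_Rintegral => x _; apply: eq_bigr => i _; rewrite mulrC. Qed.

Lemma grad_pairDl a b v w z : H1 Omega v -> H1 Omega w -> H1 Omega z ->
  grad_pair Omega (fun x => a * v x + b * w x) z =
  a * grad_pair Omega v z + b * grad_pair Omega w z.
Proof.
move=> Hv Hw Hz; have [Hl wl] := H1_lin a b Hv Hw.
rewrite !grad_pairE// !mulr_sumr -big_split; apply: eq_bigr => i _ /=.
have [sv _] := weak_partialP i Hv; have [sw _] := weak_partialP i Hw.
have [sz _] := weak_partialP i Hz; have [sl _] := weak_partialP i Hl.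
rewrite -!ipZl// -ipDl//; do ?exact: sqintZ.
have [ml _] := sl; have [mz _] := sz; have [mv _] := sv; have [mw _] := sw.
apply: (ip_ae mO ml _ mz (wl i)).
by apply: measurable_funD; exact: measurable_funM.
Qed.

Lemma A_fun_ge0 v : 0 <= A_fun Omega v.
Proof. by apply: Rintegral_ge0 => x _; apply: sumr_ge0 => i _; exact: sqr_ge0. Qed.

Lemma grad_pair_cauchy_schwarz v w : H1 Omega v -> H1 Omega w ->
  grad_pair Omega v w ^+ 2 <= A_fun Omega v * A_fun Omega w.
Proof.
move=> Hv Hw; apply: psd_discriminant => [|a b]; first exact: A_fun_ge0.
have [Hl _] := H1_lin a b Hv Hw; have := A_fun_ge0 (fun x => a * v x + b * w x).
rewrite A_funE (grad_pairDl _ _ Hv Hw Hl) (grad_pairC v) (grad_pairC w).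
rewrite (grad_pairDl _ _ Hv Hw Hv) (grad_pairDl _ _ Hv Hw Hw) (grad_pairC w v).
rewrite -!A_funE; move: (A_fun _ v) (A_fun _ w) (grad_pair _ v w) => x y z h.
by apply: le_trans h _; rewrite le_eqVlt; apply/orP; left; apply/eqP; ring.
Qed.

Lemma grad_pair_le v w : H1 Omega v -> H1 Omega w ->
  `|grad_pair Omega v w| <= norm_X Omega v * norm_X Omega w.
Proof.
move=> Hv Hw; rewrite /norm_X -sqrtrM ?A_fun_ge0// -sqrtr_sqr ler_sqrt.
  exact: grad_pair_cauchy_schwarz.
by rewrite mulr_ge0// A_fun_ge0.
Qed.

(** The squared H^1 distance from a test function to v, as a real number. *)
Definition grad_test_dist phi v :=
  ipO (fun x => phi x - v x) (fun x => phi x - v x) +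
  \sum_i ipO (fun x => partial i phi x - wp i v x) (fun x => partial i phi x - wp i v x).

Lemma norm_L2_cvg0 (f : nat -> 'rV[R]_N -> R) : (forall n, sq (f n)) ->
  norm_Lq Omega 2 (f n) @[n --> \oo] --> 0%E <->
  ipO (f n) (f n) @[n --> \oo] --> 0.
Proof.
move=> sf; have -> : (fun n => norm_Lq Omega 2 (f n)) = (fun n => (Num.sqrt (ipO (f n) (f n)))%:E).
  by apply/funext => n; rewrite norm_L2E.
split=> [/fine_cvgP[_ h]|h].
  have E : (fun n => ipO (f n) (f n)) =
      (fun n => Num.sqrt (ipO (f n) (f n)) * Num.sqrt (ipO (f n) (f n))).
    by apply/funext => n; rewrite -expr2 sqr_sqrtr// ip_ge0.
  by rewrite E -(mulr0 (0 : R)); exact: (cvgM h h).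
apply: cvg_EFin; first exact: nearW.
have := continuous_cvg _ (@sqrt_continuous R 0) h.
by rewrite sqrtr0; exact.
Qed.

Lemma grad_test_dist_ge phi v :
  ipO (fun x => phi x - v x) (fun x => phi x - v x) <= grad_test_dist phi v /\
  forall i, ipO (fun x => partial i phi x - wp i v x)
    (fun x => partial i phi x - wp i v x) <= grad_test_dist phi v.
Proof.
split; first by rewrite lerDl sumr_ge0// => i _; exact: ip_ge0.
move=> i; rewrite /grad_test_dist (bigD1 i)//= addrCA lerDl addr_ge0 ?ip_ge0//.
by apply: sumr_ge0 => j _; exact: ip_ge0.
Qed.

(** Membership in the closure of the test functions with finite squared distances in place
    of extended norms and sequences. *)
Lemma H10P v : H10 Omega v <-> H1 Omega v /\
  forall e : R, 0 < e -> exists2 phi, test_function Omega phi & grad_test_dist phi v < e.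
Proof.
have sd phi : test_function Omega phi -> H1 Omega v -> sq (phi \- v).
  by move=> tphi Hv; apply: sqintB => //; [exact: sq_test|exact: H1_sq].
have sdp phi i : test_function Omega phi -> H1 Omega v -> sq (partial i phi \- wp i v).
  move=> tphi Hv; apply: sqintB => //; first exact/sq_test/test_partial.
  by case: (weak_partialP i Hv).
split.
  move=> [Hv [phi [tphi phiv dphiv]]]; split => // e e0.
  have d0 : grad_test_dist (phi n) v @[n --> \oo] --> 0.
    rewrite -[X in _ --> X](addr0 (0 : R)); apply: cvgD.
      by apply: (norm_L2_cvg0 _).1 phiv => n; exact: sd.
    have S : \sum_(i < N) ipO (partial i (phi n) \- wp i v) (partial i (phi n) \- wp i v)
        @[n --> \oo] --> \sum_(i < N) (0 : R).
      apply: cvg_big => [|i _]; first exact: add_continuous.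
      by apply: (norm_L2_cvg0 _).1 (dphiv i) => n; exact: sdp.
    have E0 : \sum_(i < N) (0 : R) = 0 by rewrite big1.
    by rewrite E0 in S; exact: S.
  have [n _ /(_ n (leqnn n)) /=] := cvgr_lt 0 d0 e e0.
  by exists (phi n).
move=> [Hv H]; split => //.
have H' (n : nat) : {phi | test_function Omega phi /\ grad_test_dist phi v < n.+1%:R^-1}.
  by apply: cid; have [|phi ? ?] := H n.+1%:R^-1; [rewrite invr_gt0|exists phi].
exists (fun n => sval (H' n)).
have tH n : test_function Omega (sval (H' n)) by case: (svalP (H' n)).
have sq0 (f : nat -> R) : (forall n, 0 <= f n) ->
    (forall n, f n <= grad_test_dist (sval (H' n)) v) -> f n @[n --> \oo] --> 0.
  move=> f0 fd; apply: (squeeze_cvgr _ (cvg_cst 0) cvg_harmonic).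
  apply: nearW => n; rewrite f0/=; apply: (le_trans (fd n)).
  by apply: ltW; case: (svalP (H' n)).
split => // [|i].
  apply/norm_L2_cvg0 => [n|]; first exact: sd.
  by apply: sq0 => n; [exact: ip_ge0|case: (grad_test_dist_ge (sval (H' n)) v)].
apply/norm_L2_cvg0 => [n|]; first exact: sdp.
apply: sq0 => n; first exact: ip_ge0.
by have [_] := grad_test_dist_ge (sval (H' n)) v; exact.
Qed.

Lemma H10_H1 v : H10 Omega v -> H1 Omega v. Proof. by case. Qed.

Lemma H1_0 : H1 Omega (fun=> 0).
Proof.
split; first exact/in_Lq2P/sqint0.
move=> i; exists (fun=> 0); split; first exact/in_Lq2P/sqint0.
move=> psi _; rewrite /L2pair.
by under eq_Rintegral do rewrite mul0r; under [in RHS]eq_Rintegral do rewrite mul0r; rewrite Rintegral_cst// mul0r oppr0.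
Qed.

Lemma H1_scale c v : H1 Omega v -> H1 Omega (fun x => c * v x) /\
  forall i, \forall x \ae mu, Omega x -> wp i (fun x => c * v x) x = c * wp i v x.
Proof.
move=> Hv; have := H1_lin c 0 Hv H1_0.
have -> : (fun x => c * v x + 0 * 0) = (fun x => c * v x).
  by apply/funext => x; rewrite mul0r addr0.
move=> [? h]; split => // i; apply: filterS (h i) => x hx /hx ->.
by rewrite mul0r addr0.
Qed.

Lemma ip_ae2 f g : sq f -> measurable_fun Omega g ->
  (\forall x \ae mu, Omega x -> f x = g x) -> ipO f f = ipO g g.
Proof.
move=> sf mg fg; have [mf _] := sf.
by rewrite (ip_ae mO mf mg mf fg) ipC (ip_ae mO mf mg mg fg).
Qed.

Lemma A_fun_scale c v : H1 Omega v ->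
  A_fun Omega (fun x => c * v x) = c ^+ 2 * A_fun Omega v.
Proof.
move=> Hv; have [Hcv wcv] := H1_scale c Hv.
rewrite !A_funE !grad_pairE// mulr_sumr; apply: eq_bigr => i _.
have [sv _] := weak_partialP i Hv; have [sc _] := weak_partialP i Hcv.
rewrite (ip_ae2 sc _ (wcv i)); last by case: (sqintZ mO c sv).
by rewrite ipZl ?ipZr//; [rewrite mulrA expr2|exact: sqintZ].
Qed.

Lemma partial_scale c phi i x : derivable phi x (delta_mx ord0 i) ->
  partial i (fun x => c * phi x) x = c * partial i phi x.
Proof. by move=> d; exact: (deriveZ c d). Qed.

Lemma test_scale c phi : test_function Omega phi ->
  test_function Omega (fun x => c * phi x).
Proof.
move=> [sphi cphi Ophi].
have E s : foldr (@partial R N) (fun x => c * phi x) s =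
    fun x => c * foldr (@partial R N) phi s x.
  elim: s => //= j s ->; apply/funext => x.
  by apply: partial_scale; have [_] := sphi s x I; exact.
have supp : closure [set x | c * phi x <> 0] `<=` closure [set x | phi x <> 0].
  by apply: closureS => x /= h phi0; apply: h; rewrite phi0 mulr0.
split.
- move=> s x _; rewrite E; have [h1 h2] := sphi s x I.
  split; first by apply: (continuousM (s := cst c)) => //; exact: cst_continuous.
  by move=> i; apply: derivableZ; exact: h2.
- by apply: subclosed_compact supp; [exact: closed_closure|].
- exact: subset_trans supp Ophi.
Qed.

Lemma H10_scale c v : H10 Omega v -> H10 Omega (fun x => c * v x).
Proof.
move=> /H10P[Hv H]; apply/H10P; have [Hcv wcv] := H1_scale c Hv.
split; first exact: Hcv.
move=> e e0.
have c1 : 0 < c ^+ 2 + 1 by rewrite ltr_wpDl ?sqr_ge0.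
have [|phi tphi phiv] := H (e / (c ^+ 2 + 1)); first by rewrite divr_gt0.
exists (fun x => c * phi x); first exact: test_scale.
have sv := H1_sq Hv; have sphi := sq_test tphi.
have -> : grad_test_dist (fun x => c * phi x) (fun x => c * v x) =
    c ^+ 2 * grad_test_dist phi v.
  have K f g : sq f -> sq g -> ipO (fun x => c * f x - c * g x) (fun x => c * f x - c * g x)
     = c ^+ 2 * ipO (fun x => f x - g x) (fun x => f x - g x).
    move=> sf sg; have sfg := sqintB mO sf sg.
    under eq_fun do rewrite -mulrBr.
    by rewrite ipZl ?ipZr//; [rewrite mulrA expr2|exact: sqintZ].
  rewrite /grad_test_dist K// mulrDr mulr_sumr; congr (_ + _).
  apply: eq_bigr => i _; have [sw _] := weak_partialP i Hv.
  have sp := sq_test (test_partial i tphi).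
  rewrite -K//.
  have -> : partial i (fun x => c * phi x) = (fun x => c * partial i phi x).
    by apply/funext => x; apply: partial_scale; exact: test_derivable.
  have [swc _] := weak_partialP i Hcv.
  have [m1 _] : sq (fun x => c * partial i phi x - c * wp i v x).
    by apply: sqintB => //; exact: sqintZ.
  apply: ip_ae2 => //; first by apply: sqintB => //; exact: sqintZ.
  by apply: filterS (wcv i) => x h /h ->.
rewrite ltr_pdivlMr// in phiv; apply: le_lt_trans phiv.
rewrite mulrC ler_wpM2l ?lerDl// addr_ge0 ?ip_ge0//.
by apply: sumr_ge0 => i _; exact: ip_ge0.
Qed.

(** On a bounded set of X, closeness in L^2 implies closeness of the gradient pairings with
    a fixed w.  Replace w by a nearby test function phi: the pairing with phi is minus the
    L^2 pairing with the second derivatives of phi, which is continuous in L^2. *)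
Lemma weak_continuity w (M e : R) : H10 Omega w -> 0 < e -> exists2 dl : R, 0 < dl &
  forall u u', H1 Omega u -> H1 Omega u' -> A_fun Omega u <= M -> A_fun Omega u' <= M ->
    ipO (fun x => u x - u' x) (fun x => u x - u' x) <= dl ->
    `|grad_pair Omega u w - grad_pair Omega u' w| <= e.
Proof.
move=> /H10P[Hw Hphi] e0.
pose c1 := N%:R * Num.sqrt (4 * `|M|) + 1.
have c10 : 0 < c1 by rewrite ltr_wpDl// mulr_ge0// sqrtr_ge0.
have [|phi tphi phiw] := Hphi ((e / 2 / c1) ^+ 2).
  by rewrite exprn_gt0// !divr_gt0.
pose ddphi i := partial i (partial i phi).
have tdd i : test_function Omega (ddphi i) by do 2 apply: test_partial.
pose c2 := \sum_i Num.sqrt (ipO (ddphi i) (ddphi i)) + 1.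
have c20 : 0 < c2 by rewrite ltr_wpDl// sumr_ge0// => i _; exact: sqrtr_ge0.
exists ((e / 2 / c2) ^+ 2); first by rewrite exprn_gt0// !divr_gt0.
move=> u u' Hu Hu' Au Au' uu'.
have su := H1_sq Hu; have su' := H1_sq Hu'.
pose D i := fun x => wp i u x - wp i u' x.
have sD i : sq (D i).
  by apply: sqintB => //; [case: (weak_partialP i Hu)|case: (weak_partialP i Hu')].
have sdphi i := sq_test (test_partial i tphi).
have sw i : sq (wp i w) by case: (weak_partialP i Hw).
have s1 i : sq (fun x => wp i w x - partial i phi x) by exact: sqintB.
have -> : grad_pair Omega u w - grad_pair Omega u' w =
    \sum_i (ipO (D i) (fun x => wp i w x - partial i phi x) -
      ipO (fun x => u x - u' x) (ddphi i)).
  rewrite !grad_pairE// -sumrB; apply: eq_bigr => i _.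
  have [su1 du] := weak_partialP i Hu; have [su1' du'] := weak_partialP i Hu'.
  rewrite -(ipBl mO su1 su1' (sw i)) (ipBr mO (sw i) (sdphi i) (sD i)).
  have sdd := sq_test (tdd i).
  rewrite (ipBl mO su1 su1' (sdphi i)) (ipBl mO su su' sdd).
  have := du _ (test_partial i tphi); have := du' _ (test_partial i tphi).
  rewrite !L2pairE => -> ->; rewrite -/(D i).
  by move: (ipO (D i) (wp i w)) (ipO (wp i u) _) (ipO (wp i u') _) => x y z; ring.
apply: le_trans (ler_norm_sum _ _ _) _.
have B i : `|ipO (D i) (fun x => wp i w x - partial i phi x) -
      ipO (fun x => u x - u' x) (ddphi i)| <=
    Num.sqrt (4 * `|M|) * (e / 2 / c1) +
    (e / 2 / c2) * Num.sqrt (ipO (ddphi i) (ddphi i)).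
  apply: le_trans (ler_normB _ _) _; apply: lerD.
    apply: le_trans (cauchy_schwarz mO (sD i) (s1 i)) _.
    apply: ler_pM; rewrite ?sqrtr_ge0//.
      rewrite ler_sqrt; last by rewrite mulr_ge0.
      have [su1 _] := weak_partialP i Hu; have [su1' _] := weak_partialP i Hu'.
      have leA v : H1 Omega v -> ipO (wp i v) (wp i v) <= A_fun Omega v.
        move=> Hv; rewrite A_funE grad_pairE// (bigD1 i)//= lerDl.
        by apply: sumr_ge0 => j _; exact: ip_ge0.
      have := ip_sqrD mO su1 (sqintN mO su1').
      have -> : ipO (fun x => - wp i u' x) (fun x => - wp i u' x) = ipO (wp i u') (wp i u').
        by apply: eq_Rintegral => x _; rewrite mulrNN.
      move=> h; apply: le_trans h _.
      move: Au Au' (leA _ Hu) (leA _ Hu') (ler_norm M).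
      move: (ipO (wp i u) _) (ipO (wp i u') _) (A_fun _ u) (A_fun _ u') `|M|.
      by move=> x y z t m; lra.
    rewrite -[leRHS](sqrtr_sqr_nneg _); last first.
      by rewrite !divr_ge0 ?ltW.
    rewrite ler_sqrt ?sqr_ge0//; apply: le_trans (ltW phiw).
    have [_ /(_ i)] := grad_test_dist_ge phi w; apply: le_trans.
    rewrite le_eqVlt; apply/orP; left; apply/eqP; apply: eq_Rintegral => x _.
    by rewrite -mulrNN !opprB.
  apply: le_trans (cauchy_schwarz mO (sqintB mO su su') (sq_test (tdd i))) _.
  rewrite ler_wpM2r ?sqrtr_ge0//.
  rewrite -[leRHS](sqrtr_sqr_nneg _) ?ler_sqrt ?sqr_ge0//.
  by rewrite !divr_ge0 ?ltW.
apply: le_trans (ler_sum _ (fun i _ => B i)) _.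
rewrite big_split /= sumr_const card_ord -mulr_sumr.
have K (E s c : R) : 0 <= E -> 0 < c -> s <= c -> s * (E / c) <= E.
  move=> E0 c0 sc; rewrite mulrCA; apply: ler_piMr => //.
  by rewrite ler_pdivrMr// mul1r.
have e20 : 0 <= e / 2 by rewrite divr_ge0 ?ltW.
have h1 : Num.sqrt (4 * `|M|) * (e / 2 / c1) *+ N <= e / 2.
  by rewrite -mulr_natl mulrA; apply: K => //; rewrite lerDl.
have h2 : (e / 2 / c2) * \sum_i Num.sqrt (ipO (ddphi i) (ddphi i)) <= e / 2.
  by rewrite mulrC; apply: K => //; rewrite lerDl.
by rewrite [leRHS]splitr lerD.
Qed.

End sobolev_spaces.

(** * Pointwise inequalities between powers *)
Section power_inequalities.
Context (R : realType).
Implicit Types a b c m t x r q : R.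

Lemma powR_ge0_le r a b : 0 <= r -> 0 <= a -> a <= b -> a `^ r <= b `^ r.
Proof.
move=> r0 a0 ab; apply: ge0_ler_powR; rewrite ?nnegrE//.
exact: le_trans ab.
Qed.

Lemma powRS r a : 0 <= a -> 0 < r -> a `^ r = a `^ (r - 1) * a.
Proof. by move=> a0 r0; rewrite mulrC mulr_powRB1. Qed.

(** Convexity: the graph of the power lies above its tangent at t. *)
Lemma powR_tangent r a t : 1 < r -> 0 <= a -> 0 <= t ->
  r * t `^ (r - 1) * (a - t) <= a `^ r - t `^ r.
Proof.
move=> r1 a0 t0; have r0 : 0 < r by lra.
have r10 : 0 < r - 1 by lra.
have := @conjugate_powR R a (t `^ (r - 1)) r (r / (r - 1)) a0 (powR_ge0 _ _) r0.
rewrite divr_gt0// => /(_ isT) H.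
have rn : r != 0 by rewrite gt_eqF.
have r1n : r - 1 != 0 by rewrite gt_eqF.
have E : (t `^ (r - 1)) `^ (r / (r - 1)) = t `^ r.
  by rewrite -powRrM; congr (_ `^ _); field.
have {}H : a * t `^ (r - 1) <= a `^ r / r + t `^ r / (r / (r - 1)).
  by rewrite -[X in _ + X / _]E; apply: H; field; rewrite rn r1n.
move: H; rewrite -(ler_pM2l r0) mulrDr.
have -> : r * (a `^ r / r) = a `^ r by field.
have -> : r * (t `^ r / (r / (r - 1))) = (r - 1) * t `^ r.
  by field; rewrite rn r1n.
have := powRS t0 r0; move: (t `^ r) (a `^ r) (t `^ (r - 1)) => x y z -> H.
lra.
Qed.

Section exponent.
Variables (q : R) (q1 : 1 < q).
Let q0 : 0 < q. Proof. exact: lt_trans q1. Qed.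
Let q10 : 0 <= q - 1. Proof. by rewrite subr_ge0 ltW. Qed.
Let q21 : 1 < 2 * q. Proof. by move: (q1); lra. Qed.

(** Split c ^ q as c ^ (q - 1) c and use that a ^ (q - 1) is at most c ^ (q - 1). *)
Lemma powR_lip a c : 0 <= a -> a <= c -> c `^ (q - 1) * (c - a) <= c `^ q - a `^ q.
Proof.
move=> a0 ac; have c0 : 0 <= c by lra.
rewrite (powRS c0 q0) (powRS a0 q0).
have := powR_ge0_le q10 a0 ac; move: (a `^ _) (c `^ _) => x y; nra.
Qed.

Lemma norm_powR_le_sub a c : 0 <= a -> 0 <= c -> `|c - a| `^ q <= `|c `^ q - a `^ q|.
Proof.
wlog ac : a c / a <= c.
  move=> H a0 c0; have [ac|/ltW ca] := leP a c; first exact: H.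
  by rewrite distrC (distrC (c `^ q)); exact: H.
move=> a0 c0; rewrite ger0_norm ?subr_ge0// ger0_norm; last first.
  by rewrite subr_ge0 powR_ge0_le// ltW.
apply: le_trans (powR_lip a0 ac); rewrite powRS ?subr_ge0//.
rewrite ler_wpM2r ?subr_ge0//; apply: powR_ge0_le => //; first by rewrite subr_ge0.
lra.
Qed.

Lemma powR_sub_le_conj a m : 0 <= a -> 0 <= m ->
  `|m `^ (2 * q - 1) - a `^ (2 * q - 1)| <=
    2 * Num.max a m `^ (q - 1) * `|m `^ q - a `^ q|.
Proof.
wlog am : a m / a <= m.
  move=> H a0 m0; have /orP[am|ma] := le_total a m; first exact: H.
  by rewrite distrC (distrC (m `^ q)) maxC; exact: H.
move=> a0 m0; rewrite (max_idPr am).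
have E x : 0 <= x -> x `^ (2 * q - 1) = x `^ (q - 1) * x `^ q.
  move=> x0; rewrite -powRD; first by congr (_ `^ _); ring.
  by apply/implyP => /eqP h; exfalso; move: (q1) h; lra.
have h1 := powR_ge0_le q10 a0 am; have h2 := powR_ge0_le (ltW q0) a0 am.
rewrite !E// !ger0_norm ?subr_ge0//; last by apply: ler_pM; rewrite ?powR_ge0.
have := powRS a0 q0; have := powRS m0 q0.
move: h1 h2 (powR_ge0 a (q - 1)); move: (a `^ q) (m `^ q) (a `^ (q - 1)) (m `^ (q - 1)).
move=> aq mq a1 m1 h1 h2 a10 -> ->.
have h3 : a1 * (m1 - a1) * (m - a) >= 0 by rewrite !mulr_ge0 ?subr_ge0.
have h4 : (m1 - a1) ^+ 2 * m >= 0 by rewrite mulr_ge0 ?sqr_ge0.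
have h5 : a1 * m1 * (m - a) >= 0.
  by rewrite !mulr_ge0 ?subr_ge0// (le_trans a10).
nra.
Qed.

Lemma max_powR_lip a c m : 0 <= a -> 0 <= c -> 0 <= m ->
  Num.max a m `^ (q - 1) * `|c - a| <= `|m `^ q - a `^ q| + `|c `^ q - a `^ q|.
Proof.
move=> a0 c0 m0.
have L x y : 0 <= x -> 0 <= y -> Num.max x y `^ (q - 1) * `|y - x| <= `|y `^ q - x `^ q|.
  wlog xy : x y / x <= y.
    move=> H x0 y0; have /orP[xy|yx] := le_total x y; first exact: H.
    by rewrite distrC (distrC (y `^ q)) maxC; exact: H.
  move=> x0 y0; rewrite (max_idPr xy) !ger0_norm ?subr_ge0//; last first.
    exact: powR_ge0_le (ltW q0) x0 xy.
  exact: powR_lip.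
have /orP[am|ma] := le_total a m; last first.
  apply: le_trans (_ : _ <= `|c `^ q - a `^ q|) _; last by rewrite lerDr.
  apply: le_trans (L a c a0 c0); rewrite ler_wpM2r//.
  by rewrite (max_idPl ma); apply: powR_ge0_le => //; rewrite le_max lexx.
have [cm|/ltW mc] := leP m c.
  apply: le_trans (_ : _ <= `|c `^ q - a `^ q|) _; last by rewrite lerDr.
  apply: le_trans (L a c a0 c0); rewrite ler_wpM2r//.
  by rewrite (max_idPr am); apply: powR_ge0_le => //; rewrite le_max cm orbT.
have [ac|/ltW ca] := leP a c.
  apply: le_trans (_ : _ <= `|m `^ q - a `^ q|) _; last by rewrite lerDl.
  apply: le_trans (L a m a0 m0); rewrite (max_idPr am) ler_wpM2l ?powR_ge0//.
  by rewrite !ger0_norm ?subr_ge0// lerB.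
apply: (@le_trans _ _ `|m `^ q - c `^ q|).
  apply: le_trans (L c m c0 m0); rewrite (max_idPr mc) (max_idPr am) ler_wpM2l ?powR_ge0//.
  by rewrite distrC !ger0_norm ?subr_ge0// lerB.
by rewrite (distrC (c `^ q)); exact: ler_distD.
Qed.

(** For m = a this is the tangent inequality of the power 2 q.  The correction
    (m ^ p - a ^ p) (c - a), with p = 2 q - 1, is quadratic in the increments of the q-th
    power: the factor m ^ p - a ^ p costs max (a, m) ^ (q - 1) (powR_sub_le_conj), which is
    exactly what c - a needs to become an increment of q-th powers (max_powR_lip). *)
Lemma conj_increment_le a c m : 0 <= a -> 0 <= c -> 0 <= m ->
  m `^ (2 * q - 1) * (c - a) <= (c `^ (2 * q) - a `^ (2 * q)) / (2 * q) +
   (3 * (m `^ q - a `^ q) ^+ 2 + (c `^ q - a `^ q) ^+ 2).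
Proof.
move=> a0 c0 m0.
have T := @powR_tangent (2 * q) c a _ c0 a0.
have {}T : a `^ (2 * q - 1) * (c - a) <= (c `^ (2 * q) - a `^ (2 * q)) / (2 * q).
  rewrite ler_pdivlMr ?mulr_gt0//; apply: le_trans (T q21).
  by rewrite mulrC mulrA.
have P := powR_sub_le_conj a0 m0; have X := max_powR_lip a0 c0 m0.
have N := ler_norm ((m `^ (2 * q - 1) - a `^ (2 * q - 1)) * (c - a)).
rewrite normrM in N.
rewrite -(real_normK (num_real (m `^ q - _))) -(real_normK (num_real (c `^ q - _))).
move: T P X N (powR_ge0 (Num.max a m) (q - 1)) (normr_ge0 (m `^ q - a `^ q))
  (normr_ge0 (c `^ q - a `^ q)) (normr_ge0 (c - a)).
move: (c `^ (2 * q) - _) (a `^ (2 * q - 1)) (m `^ (2 * q - 1)) (Num.max a m `^ (q - 1)) => Z ap mp M.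
move: (`|m `^ q - a `^ q|) (`|c `^ q - a `^ q|) (Z / (2 * q)) => al ga z T P X N M0 al0 ga0 n0.
have h1 : `|mp - ap| * `|c - a| <= 2 * M * al * `|c - a| by rewrite ler_wpM2r.
have h2 : 2 * al * (M * `|c - a|) <= 2 * al * (al + ga) by rewrite ler_wpM2l// mulr_ge0.
have h3 := sqr_ge0 (al - ga).
nra.
Qed.

(** Young's inequality by cases: if t ^ 2 <= n x ^ 2 the first term is enough, otherwise
    the second one is. *)
Lemma powR_young x t n : 0 <= x -> 0 <= t -> 0 < n ->
  x `^ (2 * (q - 1)) * t ^+ 2 <= n * x `^ (2 * q) + n `^ (1 - q) * t `^ (2 * q).
Proof.
move=> x0 t0 n0.
have E z : 0 <= z -> z `^ (2 * q) = z `^ (2 * (q - 1)) * z ^+ 2.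
  move=> z0; rewrite -powR_mulrn// -powRD; first by congr (_ `^ _); ring.
  by apply/implyP => /eqP h; exfalso; move: (q1) h; lra.
have [tx|/ltW xt] := leP (t ^+ 2) (n * x ^+ 2).
  apply: le_trans (_ : _ <= n * x `^ (2 * q)) _; last by rewrite lerDl mulr_ge0 ?powR_ge0.
  by rewrite E// [leRHS]mulrCA ler_wpM2l ?powR_ge0.
apply: le_trans (_ : _ <= n `^ (1 - q) * t `^ (2 * q)) _; last first.
  by rewrite lerDr mulr_ge0 ?powR_ge0// ltW.
rewrite E// [leRHS]mulrA ler_wpM2r ?sqr_ge0//.
have -> : n `^ (1 - q) = (n `^ (q - 1))^-1 by rewrite -powRN opprB.
rewrite [leRHS]mulrC ler_pdivlMr ?powR_gt0//.
rewrite !powRrM !powR_mulrn// -powRM ?sqr_ge0 ?(ltW n0)//.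
by apply: powR_ge0_le => //; [rewrite mulr_ge0 ?sqr_ge0// ltW|rewrite mulrC].
Qed.

(** The map v -> v ^ q is continuous from L^(2 q) to L^2: choose n small first, then the
    distance of a and b. *)
Lemma sqr_powR_sub_le a b n : 0 <= a -> 0 <= b -> 0 < n ->
  (a `^ q - b `^ q) ^+ 2 <= q ^+ 2 * (n * 4 `^ q * b `^ (2 * q) +
    (n * 4 `^ q + n `^ (1 - q)) * `|a - b| `^ (2 * q)).
Proof.
move=> a0 b0 n0; set t := `|a - b|; have t0 : 0 <= t by exact: normr_ge0.
have bt0 : 0 <= b + t by rewrite addr_ge0.
have H : `|a `^ q - b `^ q| <= q * (b + t) `^ (q - 1) * t.
  have L x y : 0 <= x -> x <= y -> y <= b + t -> y - x = t ->
      y `^ q - x `^ q <= q * (b + t) `^ (q - 1) * t.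
    move=> x0 xy ybt yxt; have y0 : 0 <= y by lra.
    have T := @powR_tangent q x y q1 x0 y0.
    have YZ : y `^ (q - 1) <= (b + t) `^ (q - 1) by exact: powR_ge0_le.
    have K : q * (y `^ (q - 1) * t) <= q * ((b + t) `^ (q - 1) * t).
      by rewrite ler_wpM2l ?(ltW q0)// ler_wpM2r.
    have E : x - y = - t by rewrite -yxt opprB.
    by rewrite E in T; lra.
  have [ab|/ltW ba] := leP a b.
    have tb : t = b - a by rewrite /t distrC ger0_norm// subr_ge0.
    rewrite distrC ger0_norm ?subr_ge0 ?powR_ge0_le ?(ltW q0)//; apply: L => //.
    by rewrite lerDl.
  have ta : t = a - b by rewrite /t ger0_norm// subr_ge0.
  by rewrite ger0_norm ?subr_ge0 ?powR_ge0_le ?(ltW q0)//; apply: L => //; lra.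
rewrite -(real_normK (num_real (_ - _))).
apply: (@le_trans _ _ (q ^+ 2 * ((b + t) `^ (2 * (q - 1)) * t ^+ 2))).
  have -> : q ^+ 2 * ((b + t) `^ (2 * (q - 1)) * t ^+ 2) = (q * (b + t) `^ (q - 1) * t) ^+ 2.
    by rewrite !exprMn mulrA [2 * _]mulrC powRrM powR_mulrn ?powR_ge0.
  by rewrite lerXn2r// ?nnegrE// !mulr_ge0 ?powR_ge0// (ltW q0).
rewrite ler_wpM2l ?sqr_ge0//; apply: le_trans (powR_young bt0 t0 n0) _.
have S : (b + t) `^ (2 * q) <= 4 `^ q * (b `^ (2 * q) + t `^ (2 * q)).
  have E z : 0 <= z -> (2 * z) `^ (2 * q) = 4 `^ q * z `^ (2 * q).
    move=> z0; rewrite !powRrM !powR_mulrn ?mulr_ge0// -powRM ?sqr_ge0//.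
    by congr (_ `^ _); ring.
  have q20 : 0 <= 2 * q by rewrite mulr_ge0 ?(ltW q0).
  have [bt|/ltW tb] := leP b t.
    apply: (@le_trans _ _ ((2 * t) `^ (2 * q))); first by apply: powR_ge0_le => //; lra.
    by rewrite E// ler_wpM2l ?powR_ge0// lerDr powR_ge0.
  apply: (@le_trans _ _ ((2 * b) `^ (2 * q))); first by apply: powR_ge0_le => //; lra.
  by rewrite E// ler_wpM2l ?powR_ge0// lerDl powR_ge0.
move: S; move: (_ `^ (2 * q)) (b `^ _) (t `^ _) (4 `^ q) (n `^ _) => S B T F G S1.
have : n * S <= n * (F * (B + T)) by rewrite ler_wpM2l// (ltW n0).
by lra.
Qed.

End exponent.
End power_inequalities.

(** * The critical Sobolev inequality *)
Section norm_power.
Context (R : realType).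
Implicit Types c x q : R.

Lemma continuous_norm_powR c : 0 < c -> continuous (fun x : R => `|x| `^ c).
Proof.
move=> c0 x; have [->|x0] := eqVneq x 0.
  apply/cvgrPdist_lt => e e0; rewrite normr0 powR0 ?gt_eqF//; near=> z.
  rewrite sub0r normrN ger0_norm ?powR_ge0//.
  have -> : e = (e `^ c^-1) `^ c by rewrite -powRrM mulVf ?gt_eqF// powRr1// ltW.
  apply: gt0_ltr_powR => //; rewrite ?nnegrE ?powR_ge0//.
  near: z; exists (e `^ c^-1) => /=; first exact: powR_gt0.
  by move=> z; rewrite /= sub0r normrN.
apply: (@continuous_comp _ _ _ (fun x : R => `|x|) (fun z => z `^ c)).
  exact: norm_continuous.
apply/differentiable_continuous/derivable1_diffP/derivable_powR.
by rewrite in_itv/= andbT normr_gt0.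
Unshelve. all: by end_near. Qed.

Lemma is_derive_norm_powR q x : 1 < q ->
  is_derive x 1 (fun x : R => `|x| `^ (q + 1)) ((q + 1) * (x * `|x| `^ (q - 1))).
Proof.
move=> q1; have q10 : 0 < q - 1 by lra.
have P (z : R) : 0 < z -> is_derive z 1 (fun x : R => x `^ (q + 1)) ((q + 1) * (z * z `^ (q - 1))).
  move=> z0; have zi : z \in `]0, +oo[ by rewrite in_itv/= andbT.
  split; first exact: derivable_powR.
  rewrite -derive1E powR_derive1//; congr (_ * _).
  by rewrite addrK mulr_powRB1 ?ltW//; lra.
have [x0|x0|->] := ltgtP x 0.
- have d1 := is_deriveN (is_derive_id x (1 : R)).
  have xN : 0 < - x by rewrite oppr_gt0.
  have d2 := @is_derive1_comp _ (fun x : R => x `^ (q + 1)) -%R x _ _ (P _ xN) d1.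
  apply: (near_eq_is_derive (f := (fun x : R => x `^ (q + 1)) \o -%R)).
    by near=> z; rewrite /= ltr0_norm//; near: z; exact: lt_nbhsl.
  apply: is_derive_eq d2 _; rewrite ltr0_norm//; ring.
- apply: (near_eq_is_derive (f := fun x : R => x `^ (q + 1))).
    by near=> z; rewrite gtr0_norm//; near: z; exact: lt_nbhsr.
  rewrite gtr0_norm//; exact: P.
- apply/is_derive1_caratheodory; exists (fun z => z * `|z| `^ (q - 1)); split.
  + move=> z; rewrite normr0 powR0 ?gt_eqF//; last by lra.
    rewrite !subr0 mulrAC -expr2 -(real_normK (num_real z)) -powR_mulrn// mulrC -powRD.
      by congr (_ `^ _); ring.
    by apply/implyP => /eqP h; exfalso; lra.
  + apply: continuousM; first exact: cvg_id.
    exact: continuous_norm_powR.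
  + by rewrite mul0r mulr0.
Unshelve. all: by end_near. Qed.

End norm_power.

(** Monotone convergence as a bound that passes to the limit. *)
Lemma ge0_integral_le_cvg d (T : measurableType d) (R : realType)
  (mu : {measure set T -> \bar R}) (D : set T) (mD : measurable D)
  (g : nat -> T -> R) (f : T -> R) (c : R) :
  (forall k, measurable_fun D (g k)) -> (forall k x, 0 <= g k x) ->
  (forall x, {homo g ^~ x : j k / (j <= k)%N >-> j <= k}) ->
  (forall x, g k x @[k --> \oo] --> f x) ->
  (forall k, \int[mu]_(x in D) (g k x)%:E <= c%:E)%E ->
  (\int[mu]_(x in D) (f x)%:E <= c%:E)%E.
Proof.
move=> mg g0 ndg gf gc.
have -> : (\int[mu]_(x in D) (f x)%:E =
    \int[mu]_(x in D) limn (fun k => (g k x)%:E))%E.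
  apply: eq_integral => x _; apply/esym/cvg_lim => //.
  by apply: cvg_EFin; [exact: nearW|exact: gf].
have H := @cvg_monotone_convergence _ _ _ mu D mD (fun k x => (g k x)%:E).
apply: (cvge_to_le (H _ _ _)) => //.
- by move=> k; apply/measurable_EFinP.
- by move=> k x _; rewrite lee_fin.
- by move=> x _ j k jk; rewrite lee_fin ndg.
- exact: nearW.
Qed.

Section sobolev_inequality.
Context (R : realType).
Local Notation leb := (@lebesgue_measure R).

(** Integrate the derivative from a point at which g vanishes. *)
Lemma compact_support_le_integral (g dg : R -> R) (M x : R) :
  (forall s : R, is_derive s 1 g (dg s)) -> continuous dg ->
  (forall s, s <= M -> g s = 0) ->
  ((g x)%:E <= \int[leb]_s `|dg s|%:E)%E.
Proof.
move=> gd cdg gM.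
have mdg : measurable_fun (setT : set (measurableTypeR R)) dg.
  exact: continuous_measurable_fun.
have [xM|Mx] := leP x M.
  by rewrite gM//; apply: integral_ge0 => s _; rewrite lee_fin.
have cg : continuous g.
  by move=> s; apply/differentiable_continuous/derivable1_diffP; case: (gd s).
have := @continuous_FTC2 R dg g M x Mx (continuous_subspaceT cdg).
rewrite (gM M)// sube0 => <-; last 2 first.
- split.
  + by move=> s _; case: (gd s).
  + by apply: cvg_at_right_filter; exact: cg.
  + by apply: cvg_at_left_filter; exact: cg.
- by move=> s _; rewrite derive1E; case: (gd s).
have mdgi : measurable_fun `[M, x]%classic (EFin \o dg).
  by apply/measurable_EFinP; exact: measurable_funTS.
apply: (@le_trans _ _ (\int[leb]_(s in `[M, x]) `|dg s|%:E)%E).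
  apply: le_trans (lee_abs _) _.
  exact: (le_abse_integral leb _ mdgi).
apply: ge0_subset_integral => //.
by apply/measurable_EFinP; exact: measurableT_comp.
Qed.

Section test_functions.
Context (n : nat) (Omega : set 'rV[R]_n.+3).
Hypotheses (oO : open Omega) (bO : bounded_set Omega).
Local Notation N := n.+3.
Local Notation mu := (lebesgue_rV R N).
Let q : R := N%:R / (N%:R - 2).

Let mO : measurable Omega. Proof. exact: open_measurable_rV. Qed.
Let fO : (mu Omega < +oo)%E. Proof. exact: bounded_lty. Qed.

Let N2 : 0 < N%:R - 2 :> R.
Proof. by rewrite subr_gt0 ltr_nat. Qed.

Let q1 : 1 < q.
Proof. by rewrite ltr_pdivlMr// mul1r; lra. Qed.

Definition abspow (v : 'rV[R]_N -> R) (r : R) x := `|v x| `^ r.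

(** The derivative of |phi| ^ (q + 1) along a coordinate line is
    (q + 1) phi |phi| ^ (q - 1) times the partial derivative of phi. *)
Lemma test_line_majorant phi : test_function Omega phi ->
  line_majorant (abspow phi (q + 1))
    (fun x => \sum_i `|(q + 1) * (phi x * `|phi x| `^ (q - 1)) * partial i phi x|).
Proof.
move=> tphi x i.
have [M OM] := bounded_set_obox bO.
have q10 : 0 < q - 1 by rewrite subr_gt0.
pose g s := `|phi (upd x i s)| `^ (q + 1).
pose psi s := phi (upd x i s).
pose dg s := (q + 1) * (psi s * `|psi s| `^ (q - 1)) * partial i phi (upd x i s).
have cu := @continuous_upd R N x i.
have cpsi : continuous psi.
  by move=> s; apply: continuous_comp; [exact: cu|exact: (test_continuous tphi)].
have cdpsi : continuous (fun s => partial i phi (upd x i s)).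
  by move=> s; apply: continuous_comp; [exact: cu|exact: (test_continuous (test_partial _ tphi))].
have gd (s : R) : is_derive s 1 g (dg s).
  have d1 := @is_derive_upd _ _ phi x i s (test_derivable tphi).
  exact: (is_derive1_comp (is_derive_norm_powR (psi s) q1) d1).
have cM (f1 f2 : R -> R) : continuous f1 -> continuous f2 ->
    continuous (fun s => f1 s * f2 s) by move=> c1 c2 s; exact: (cvgM (c1 s) (c2 s)).
have cpp : continuous (fun s => (q + 1) * (psi s * `|psi s| `^ (q - 1))).
  apply: (cM _ _); first exact: cst_continuous.
  apply: (cM _ _) => // s.
  by apply: (@continuous_comp _ _ _ psi (fun z : R => `|z| `^ (q - 1))); [exact: cpsi|exact: continuous_norm_powR].
have cdg : continuous dg by exact: cM.
have g0 s : s <= - ratr M -> g s = 0.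
  move=> sM; rewrite /g (test_out tphi) ?normr0 ?powR0//.
    by rewrite gt_eqF// ltr_wpDl//; lra.
  move=> /OM/(_ i); rewrite !mxE eqxx /= rmorphN => /andP[+ _].
  by rewrite ltNge sM.
have := compact_support_le_integral (x ord0 i) gd cdg g0.
rewrite {1}/g upd_id => h; apply: (le_trans h).
apply: ge0_le_integral => //.
- apply/measurable_EFinP/measurableT_comp => //.
  exact: continuous_measurable_fun.
- apply/measurable_EFinP.
  have : measurable_fun setT (fun s : R =>
     \sum_j `|(q + 1) * (psi s * `|psi s| `^ (q - 1)) * partial j phi (upd x i s)|).
    apply: continuous_measurable_fun; apply: continuous_big => [|j _]; first exact: add_continuous.
    have cj : continuous (fun s => (q + 1) * (psi s * `|psi s| `^ (q - 1)) *
        partial j phi (upd x i s)).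
      apply: (cM _ _); first exact: cpp.
      move=> t; apply: continuous_comp; first exact: cu.
      exact: (test_continuous (test_partial _ tphi)).
    by move=> s; apply: cvg_norm; exact: cj.
  exact.
- move=> s _; rewrite lee_fin (bigD1 i)//= lerDl.
  exact: sumr_ge0.
Qed.

Lemma sq_test_abspow phi : test_function Omega phi -> sqint mu Omega (abspow phi q).
Proof.
move=> tphi; have [M [M0 HM]] := test_bounded tphi.
have q0 : 0 < q by exact: lt_trans q1.
apply: (@integrable_le_sqint _ _ _ mu _ mO _ (fun=> M `^ q)).
- apply: measurable_fun_powR; apply: measurableT_comp => //.
  exact: (measurable_funTS (test_measurable tphi)).
- split; first exact: measurable_cst.
  by rewrite integral_cst// lte_mul_pinfty// lee_fin sqr_ge0.
- move=> x _; rewrite lerXn2r// ?nnegrE ?powR_ge0//.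
  by apply: powR_ge0_le => //; exact: ltW.
Qed.

Let e : R := N%:R / n.+2%:R.

Let n2E : n.+2%:R = N%:R - 1 :> R.
Proof. by rewrite -[N%:R]natr1 addrK. Qed.

Let N3 : 3 <= N%:R :> R. Proof. by rewrite ler_nat. Qed.

Let qe : (q + 1) * e = 2 * q.
Proof.
rewrite /q /e n2E; move: N3; move: (N%:R : R) => t t3; field.
by apply/andP; split; rewrite gt_eqF//; lra.
Qed.

Let e2 : 0 < 2 - e.
Proof. by rewrite subr_gt0 /e n2E ltr_pdivrMr; move: N3; lra. Qed.

Let e0 : 0 < e. Proof. by rewrite divr_gt0// ltr0n. Qed.

Let ee : e / (2 - e) = q.
Proof.
have e2n : 2 - e != 0 by rewrite gt_eqF.
apply: (mulIf e2n); rewrite divfK//.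
rewrite /q /e n2E; move: N3; move: (N%:R : R) => t t3; field.
by apply/andP; split; rewrite gt_eqF//; lra.
Qed.

(** Let B be the integral of |phi| ^ (2 q).  The Loomis-Whitney inequality for
    |phi| ^ (q + 1), followed by Cauchy-Schwarz, gives B <= (K sqrt B) ^ e with
    e = N / (N - 1); as e / (2 - e) = q, this is B <= K ^ (2 q). *)
Lemma test_sobolev phi : test_function Omega phi ->
  ip mu Omega (abspow phi q) (abspow phi q) <=
  ((q + 1) * \sum_i Num.sqrt (ip mu Omega (partial i phi) (partial i phi))) `^ (2 * q).
Proof.
move=> tphi; set B := ip _ _ _ _; set K := _ * _.
have q0 : 0 < q by exact: lt_trans q1.
have sphi := sq_test_abspow tphi.
have B0 : 0 <= B by exact: ip_ge0.
have K0 : 0 <= K.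
  by rewrite mulr_ge0 ?addr_ge0 ?(ltW q0)// sumr_ge0// => i _; exact: sqrtr_ge0.
have mphi := test_measurable tphi.
have mdphi i : measurable_fun setT (partial i phi).
  exact: (test_measurable (test_partial i tphi)).
pose f := abspow phi (q + 1).
pose h x := \sum_i `|(q + 1) * (phi x * `|phi x| `^ (q - 1)) * partial i phi x|.
have mf : measurable_fun setT f.
  by apply: measurable_fun_powR; exact: measurableT_comp.
have mpp : measurable_fun setT (fun x => (q + 1) * (phi x * `|phi x| `^ (q - 1))).
  apply: measurable_funM => //; apply: measurable_funM => //.
  by apply: measurable_fun_powR; exact: measurableT_comp.
have mh : measurable_fun setT h.
  apply: measurable_sum => i; apply: measurableT_comp => //.
  exact: measurable_funM.
have LW := @loomis_whitney_lines R n.+1 f h mf mh (fun x => powR_ge0 _ _)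
  (fun x => sumr_ge0 _ (fun i _ => normr_ge0 _)) (test_line_majorant tphi).
have LHSE : (\int[mu]_x (f x `^ (N%:R / n.+2%:R))%:E = B%:E)%E.
  rewrite /B ipE// [RHS]integral_mkcond; apply: eq_integral => x _.
  rewrite patchE /f /abspow; case: ifPn => xO.
    by rewrite -powRrM qe -powR_mulrn ?powR_ge0// -powRrM mulrC.
  rewrite (test_out tphi) ?normr0; last by move=> /mem_set; exact/negP.
  by rewrite -powRrM qe powR0// gt_eqF// mulr_gt0.
have RHSE : (\int[mu]_x (h x)%:E <= (K * Num.sqrt B)%:E)%E.
  have sn i : sqint mu Omega (fun x => `|partial i phi x|).
    apply: (@integrable_le_sqint _ _ _ mu _ mO _ (partial i phi)).
    - by apply: measurableT_comp => //; exact: measurable_funTS.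
    - exact: (sq_test oO fO (test_partial i tphi)).
    - by move=> x _; rewrite real_normK ?num_real.
  pose F x := \sum_i `|partial i phi x|.
  have sF : sqint mu Omega F by exact: sqint_sum.
  have hF x : h x = (q + 1) * (abspow phi q x * F x).
    rewrite /F !mulr_sumr; apply: eq_bigr => i _; rewrite !normrM.
    rewrite (ger0_norm (powR_ge0 _ _)) gtr0_norm ?addr_gt0// /abspow (@powRS _ q)//.
    by rewrite (mulrC `|phi x|) !mulrA.
  have -> : (\int[mu]_x (h x)%:E = ((q + 1) * ip mu Omega (abspow phi q) F)%:E)%E.
    transitivity (\int[mu]_(x in Omega) (h x)%:E)%E.
      rewrite [RHS]integral_mkcond; apply: eq_integral => x _.
      rewrite patchE; case: ifPn => // xO; rewrite hF /abspow (test_out tphi).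
        by rewrite normr0 powR0 ?gt_eqF// mul0r mulr0.
      by move=> /mem_set; exact/negP.
    rewrite /ip -RintegralZl//; last exact: sqint_integrable.
    rewrite /Rintegral fineK; last first.
      apply: integrable_fin_num => //.
      by have := integrableZl mO (q + 1) (sqint_integrable mO sphi sF).
    by apply: eq_integral => x _; rewrite hF.
  rewrite lee_fin /K -mulrA ler_wpM2l ?addr_ge0 ?(ltW q0)//.
  rewrite ipC ip_suml// mulr_suml; apply: ler_sum => i _; rewrite ipC.
  apply: le_trans (ler_norm _) _; apply: le_trans (cauchy_schwarz mO sphi (sn i)) _.
  rewrite mulrC ler_wpM2r ?sqrtr_ge0//.
  rewrite le_eqVlt; apply/orP; left; apply/eqP; congr Num.sqrt.
  by apply: eq_Rintegral => x _; rewrite -!expr2 real_normK ?num_real.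
have BK : B <= (K * Num.sqrt B) `^ e.
  have := LW; rewrite LHSE -lee_fin => /le_trans; apply.
  rewrite -poweR_EFin; apply: gt0_ler_poweR; rewrite ?(ltW e0)//.
  - by rewrite in_itv/= leey andbT; apply: integral_ge0 => x _; rewrite lee_fin sumr_ge0.
  - by rewrite in_itv/= leey andbT lee_fin mulr_ge0// sqrtr_ge0.
move: B0; rewrite le_eqVlt => /predU1P[<-|B0]; first exact: powR_ge0.
have b0 : 0 < Num.sqrt B by rewrite sqrtr_gt0.
have BE : B = Num.sqrt B ^+ 2 by rewrite sqr_sqrtr// ltW.
rewrite {1}BE in BK; rewrite BE; move: (Num.sqrt B) b0 BK => b b0.
rewrite powRM ?(ltW b0)// => bK.
have {}bK : b `^ (2 - e) <= K `^ e.
  rewrite powRB; last by rewrite (gt_eqF b0) implybT.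
  by rewrite ler_pdivrMr ?powR_gt0// powR_mulrn// ltW.
have -> : b ^+ 2 = (b `^ (2 - e)) `^ (2 / (2 - e)).
  rewrite -powRrM mulrCA divff ?gt_eqF// mulr1.
  by rewrite powR_mulrn// ltW.
have -> : 2 * q = e * (2 / (2 - e)) by rewrite -ee; ring.
rewrite powRrM; apply: powR_ge0_le => //; last exact: powR_ge0.
by rewrite divr_ge0// ltW.
Qed.

Lemma test_sobolev_sqr phi : test_function Omega phi ->
  ip mu Omega (abspow phi q) (abspow phi q) <=
  (((q + 1) * N%:R) ^+ 2 * \sum_i ip mu Omega (partial i phi) (partial i phi)) `^ q.
Proof.
move=> tphi; apply: le_trans (test_sobolev tphi) _.
have q0 : 0 < q by exact: lt_trans q1.
set S := \sum_i ip _ _ _ _; have S0 : 0 <= S by apply: sumr_ge0 => i _; exact: ip_ge0.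
have H : \sum_i Num.sqrt (ip mu Omega (partial i phi) (partial i phi)) <=
    N%:R * Num.sqrt S.
  have -> : N%:R * Num.sqrt S = \sum_(i < N) Num.sqrt S.
    by rewrite sumr_const card_ord mulr_natl.
  apply: ler_sum => i _; rewrite ler_sqrt// /S (bigD1 i)//= lerDl.
  by apply: sumr_ge0 => j _; exact: ip_ge0.
rewrite powRrM powR_mulrn; last first.
  by rewrite mulr_ge0 ?addr_ge0 ?(ltW q0)// sumr_ge0// => i _; exact: sqrtr_ge0.
apply: powR_ge0_le; rewrite ?(ltW q0) ?sqr_ge0//.
rewrite -[X in _ <= _ * X](sqr_sqrtr S0) -exprMn -mulrA lerXn2r//.
- by rewrite nnegrE mulr_ge0 ?addr_ge0 ?(ltW q0)// sumr_ge0// => i _; exact: sqrtr_ge0.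
- by apply: mulr_ge0; [move: q1; lra|apply: mulr_ge0; rewrite ?sqrtr_ge0].
- by rewrite ler_wpM2l// addr_ge0// ltW.
Qed.

Let C : R := 2 * ((q + 1) * N%:R) ^+ 2.

(** Approximation of v by test functions is in H^1 and gives no direct control of the
    critical norm.  Once v is truncated at height k, the power 2 q is Lipschitz, and its
    integral is controlled by the L^2 distance. *)
Lemma truncated_sobolev v (k : nat) (eta : R) : H10 Omega v -> 0 < eta ->
  (\int[mu]_(x in Omega) (Num.min `|v x| k%:R `^ (2 * q))%:E <=
   ((C * (A_fun Omega v + eta)) `^ q + eta)%:E)%E.
Proof.
move=> Hv eta0; have /(H10P oO fO)[Hv1 app] := Hv.
have q0 : 0 < q by exact: lt_trans q1.
have q21 : 0 < 2 * q - 1 by move: q1; lra.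
have q22 : 1 < 2 * q by move: q1; lra.
pose c := 2 * q * k%:R `^ (2 * q - 1) * Num.sqrt (fine (mu Omega)) + 1.
have c0 : 0 < c by rewrite ltr_wpDl// !mulr_ge0 ?powR_ge0 ?sqrtr_ge0// ltW.
have [|phi tphi dphi] := app (Num.min eta ((eta / c) ^+ 2)).
  by rewrite lt_min eta0 exprn_gt0// divr_gt0.
have [dist0 disti] := grad_test_dist_ge Omega phi v.
have sv := H1_sq oO Hv1; have sphi := sq_test oO fO tphi.
have sd : sqint mu Omega (fun x => phi x - v x) by exact: sqintB.
have mv : measurable_fun Omega v by case: sv.
have mth : measurable_fun Omega (fun x => Num.min `|v x| k%:R `^ (2 * q)).
  by apply: measurable_fun_powR; apply: measurable_minr => //; exact: measurableT_comp.
have sap := sq_test_abspow tphi.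
pose g x := `|phi x - v x|.
have sg : sqint mu Omega g.
  apply: (@integrable_le_sqint _ _ _ mu _ mO _ (fun x => phi x - v x)) => //.
    by apply: measurableT_comp => //; case: sd.
  by move=> x _; rewrite real_normK ?num_real.
have ig := sq_integrable oO fO sg.
pose r := 2 * q * k%:R `^ (2 * q - 1).
have r0 : 0 <= r by rewrite mulr_ge0 ?powR_ge0// ltW// mulr_gt0.
have pw x : Num.min `|v x| k%:R `^ (2 * q) <= abspow phi q x ^+ 2 + r * g x.
  rewrite /abspow -powR_mulrn ?powR_ge0// -powRrM [q * 2]mulrC.
  set t := Num.min _ _; have t0 : 0 <= t by rewrite le_min normr_ge0 ler0n.
  have [tp|pt] := leP t `|phi x|.
    apply: (@le_trans _ _ (`|phi x| `^ (2 * q))).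
      by apply: powR_ge0_le => //; rewrite ltW// mulr_gt0.
    by rewrite lerDl; exact: (mulr_ge0 r0 (normr_ge0 _)).
  have T := powR_tangent q22 (normr_ge0 (phi x)) t0.
  have tv : t - `|phi x| <= g x.
    rewrite /g distrC; apply: le_trans (lerB_dist _ _).
    by rewrite lerB// ge_min lexx.
  have tk : t `^ (2 * q - 1) <= k%:R `^ (2 * q - 1).
    by apply: powR_ge0_le => //; rewrite ?(ltW q21)// ge_min lexx orbT.
  have H : t `^ (2 * q - 1) * (t - `|phi x|) <= k%:R `^ (2 * q - 1) * g x.
    by apply: ler_pM; rewrite ?powR_ge0// subr_ge0 ltW.
  have : 2 * q * (t `^ (2 * q - 1) * (t - `|phi x|)) <= r * g x.
    by rewrite /r -[leRHS]mulrA ler_wpM2l// ltW// mulr_gt0.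
  move: T; move: (t `^ (2 * q)) (`|phi x| `^ _) (t `^ (2 * q - 1)) => X Y Z; lra.
have I1 := sqint_integrable_sqr sap.
have I2 : mu.-integrable Omega (fun x => (r * g x)%:E).
  by have := integrableZl mO r ig; apply: eq_integrable => // x _; rewrite EFinM.
apply: (@le_trans _ _ (\int[mu]_(x in Omega) ((abspow phi q x ^+ 2)%:E + (r * g x)%:E))%E).
  apply: ge0_le_integral => //.
  - exact/measurable_EFinP.
  - by apply: emeasurable_funD; [case/integrableP : I1|case/integrableP : I2].
  - by move=> x _; rewrite -EFinD lee_fin.
rewrite integralD// -ipE//.
have -> : (\int[mu]_(x in Omega) (r * g x)%:E = (r * \int[mu]_(x in Omega) g x)%:E)%E.
  rewrite -RintegralZl// /Rintegral fineK//.
  by apply: integrable_fin_num.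
rewrite -EFinD lee_fin; apply: lerD.
  apply: le_trans (test_sobolev_sqr tphi) _.
  apply: powR_ge0_le; first exact: ltW.
    by rewrite mulr_ge0 ?sqr_ge0// sumr_ge0// => i _; exact: ip_ge0.
  rewrite /C (mulrC 2) -[leRHS]mulrA; apply: (ler_wpM2l (sqr_ge0 _)).
  rewrite mulrDr.
  have : grad_test_dist Omega phi v <= eta.
    by apply: (le_trans (ltW dphi)); rewrite ge_min lexx.
  have H i : ip mu Omega (partial i phi) (partial i phi) <=
      2 * ip mu Omega (weak_partial Omega i v) (weak_partial Omega i v) +
      2 * ip mu Omega (fun x => partial i phi x - weak_partial Omega i v x)
        (fun x => partial i phi x - weak_partial Omega i v x).
    have [sw _] := weak_partialP oO i Hv1.
    have sdi := sq_test oO fO (test_partial i tphi).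
    apply: le_trans (ip_sqrD mO sw (sqintB mO sdi sw)).
    rewrite le_eqVlt; apply/orP; left; apply/eqP; apply: eq_Rintegral => x _.
    by rewrite addrC subrK.
  move=> dle; apply: le_trans (ler_sum _ (fun i _ => H i)) _.
  rewrite big_split /= -!mulr_sumr A_funE (grad_pairE oO)//.
  rewrite lerD2l ler_wpM2l//; apply: le_trans dle.
  by rewrite /grad_test_dist lerDr ip_ge0.
have s1 : sqint mu Omega (fun=> 1 : R).
  split; first exact: measurable_cst.
  by rewrite integral_cst// expr1n mul1e.
have gE : \int[mu]_(x in Omega) g x <= Num.sqrt (fine (mu Omega)) * (eta / c).
  have -> : \int[mu]_(x in Omega) g x = ip mu Omega (fun=> 1) g.
    by apply: eq_Rintegral => x _; rewrite mul1r.
  apply: le_trans (ler_norm _) _; apply: le_trans (cauchy_schwarz mO s1 sg) _.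
  apply: ler_pM; rewrite ?sqrtr_ge0//.
    by rewrite /ip Rintegral_cst// !mul1r.
  rewrite -[leRHS](sqrtr_sqr_nneg _) ?divr_ge0 ?(ltW eta0) ?(ltW c0)//.
  rewrite ler_sqrt ?sqr_ge0//.
  have -> : ip mu Omega g g = ip mu Omega (fun x => phi x - v x) (fun x => phi x - v x).
    by apply: eq_Rintegral => x _; rewrite -!expr2 real_normK ?num_real.
  apply: (le_trans dist0); apply: (le_trans (ltW dphi)).
  by rewrite ge_min lexx orbT.
apply: le_trans (ler_wpM2l r0 gE) _; rewrite mulrA mulrCA ler_piMr ?(ltW eta0)//.
by rewrite ler_pdivrMr// mul1r /c lerDl.
Qed.

(** Let eta tend to 0, then the truncation height to infinity. *)
Lemma sobolev v : H10 Omega v -> sqint mu Omega (abspow v q) /\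
  ip mu Omega (abspow v q) (abspow v q) <= (C * A_fun Omega v) `^ q.
Proof.
move=> Hv; have q0 : 0 < q by exact: lt_trans q1.
have C0 : 0 <= C by rewrite mulr_ge0// sqr_ge0.
have mv : measurable_fun Omega v by have [] := H1_sq oO (H10_H1 Hv).
have mav : measurable_fun Omega (abspow v q).
  by apply: measurable_fun_powR; exact: measurableT_comp.
have H eta : 0 < eta -> (\int[mu]_(x in Omega) (abspow v q x ^+ 2)%:E <=
    ((C * (A_fun Omega v + eta)) `^ q + eta)%:E)%E.
  move=> eta0; apply: (@ge0_integral_le_cvg _ _ _ mu _ mO
    (fun k x => Num.min `|v x| k%:R `^ (2 * q))).
  - move=> k; apply: measurable_fun_powR; apply: measurable_minr => //.
    exact: measurableT_comp.
  - by move=> k x; exact: powR_ge0.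
  - move=> x j k jk; apply: powR_ge0_le.
    + by rewrite ltW// mulr_gt0.
    + by rewrite le_min normr_ge0 ler0n.
    + by rewrite le_min !ge_min lexx/= ler_nat jk orbT.
  - move=> x; apply: cvg_near_cst; exists (Num.truncn `|v x|).+1 => // k /= vk.
    rewrite min_l; last first.
      by apply: (le_trans (ltW (truncnS_gt _))); rewrite ler_nat.
    by rewrite /abspow -powR_mulrn ?powR_ge0// -powRrM [q * 2]mulrC.
  - by move=> k; exact: truncated_sobolev.
have sv : sqint mu Omega (abspow v q).
  by split => //; apply: le_lt_trans (H 1 ltr01) _; rewrite ltry.
split => //; have {}H eta : 0 < eta -> ip mu Omega (abspow v q) (abspow v q) <=
    (C * (A_fun Omega v + eta)) `^ q + eta.
  by move=> /H; rewrite -ipE// lee_fin.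
have A0 := A_fun_ge0 Omega v; move: (A_fun Omega v) A0 H => A A0 H.
move: (ip _ _ _ _) H => B H.
pose K := q * (C * (A + 1)) `^ (q - 1) * C + 1.
have K1 : 0 < K.
  apply: ltr_wpDl => //; apply: mulr_ge0 => //.
  by apply: mulr_ge0; [exact: ltW|exact: powR_ge0].
apply/ler_addgt0Pr => e1 e10.
pose eta := Num.min 1 (e1 / K).
have eta0 : 0 < eta by rewrite lt_min ltr01 divr_gt0.
have eta1 : eta <= 1 by rewrite ge_min lexx.
have etaK : K * eta <= e1 by rewrite mulrC -ler_pdivlMr// ge_min lexx orbT.
have a0 : 0 <= C * A by rewrite mulr_ge0.
have c0 : 0 <= C * (A + eta) by rewrite mulr_ge0 ?addr_ge0 ?(ltW eta0).
have T := powR_tangent q1 a0 c0.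
have cm : (C * (A + eta)) `^ (q - 1) <= (C * (A + 1)) `^ (q - 1).
  apply: powR_ge0_le => //; first by move: q1; lra.
  by rewrite ler_wpM2l// lerD2l.
have E1 : q * (C * (A + eta)) `^ (q - 1) * (C * eta) <=
    q * (C * (A + 1)) `^ (q - 1) * (C * eta).
  apply: ler_wpM2r; first by apply: mulr_ge0 => //; exact: ltW.
  by apply: ler_wpM2l => //; exact: ltW.
have := H _ eta0; move: T E1 etaK; rewrite /K.
move: ((C * A) `^ q) ((C * (A + eta)) `^ q) (q * (C * (A + eta)) `^ (q - 1))
  (q * (C * (A + 1)) `^ (q - 1)) => X Y Z W; lra.
Qed.

End test_functions.
End sobolev_inequality.

(** * Fubini and translations for real integrals *)
Section fubini_real.
Context d1 d2 (T1 : measurableType d1) (T2 : measurableType d2) (R : realType).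
Variables (m1 : {sigma_finite_measure set T1 -> \bar R})
  (m2 : {sigma_finite_measure set T2 -> \bar R}).

Lemma integrable_prod (D1 : set T1) (D2 : set T2) (f : T1 * T2 -> R) :
  measurable D1 -> measurable D2 -> measurable_fun (D1 `*` D2) f ->
  (\int[m1]_(x in D1) \int[m2]_(y in D2) `|f (x, y)|%:E < +oo)%E ->
  (m1 \x m2)%E.-integrable (D1 `*` D2) (EFin \o f).
Proof.
move=> mD1 mD2 mf foo.
have mD : measurable (D1 `*` D2) by exact: measurableX.
apply/(integrable_mkcond _ mD).
have mF : measurable_fun setT (EFin \o f \_ (D1 `*` D2)).
  by apply/measurable_EFinP; apply/(measurable_restrictT _ mD).
rewrite restrict_EFin; apply: (integrable12ltyP m1 m2 mF).2.
move: foo; rewrite integral_mkcond; congr (_ < _)%E; apply: eq_integral => x _.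
rewrite patchE; case: ifPn => xD.
  rewrite integral_mkcond; apply: eq_integral => y _.
  by rewrite !patchE/= patchE in_setX xD/=; case: ifPn => //= _; rewrite normr0.
rewrite integral0_eq// => y _.
by rewrite /= patchE in_setX (negPf xD)/= normr0.
Qed.

Lemma fubini_real (D1 : set T1) (D2 : set T2) (f : T1 * T2 -> R) :
  measurable D1 -> measurable D2 ->
  (m1 \x m2)%E.-integrable (D1 `*` D2) (EFin \o f) ->
  [/\ m1.-integrable D1 (fun x => (\int[m2]_(y in D2) f (x, y))%:E),
      m2.-integrable D2 (fun y => (\int[m1]_(x in D1) f (x, y))%:E),
      \forall x \ae m1, D1 x -> m2.-integrable D2 (fun y => (f (x, y))%:E) &
      \int[m1]_(x in D1) (\int[m2]_(y in D2) f (x, y)) =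
      \int[m2]_(y in D2) (\int[m1]_(x in D1) f (x, y))].
Proof.
move=> mD1 mD2 intf.
have mD : measurable (D1 `*` D2) by exact: measurableX.
pose F z := (f \_ (D1 `*` D2) z)%:E.
have FE x y : F (x, y) = if (x \in D1) && (y \in D2) then (f (x, y))%:E else 0%E.
  by rewrite /F patchE in_setX; case: ifPn.
have F1 (g : \bar R -> \bar R) x : g 0%E = 0%E -> (\int[m2]_y g (F (x, y)) =
    if x \in D1 then \int[m2]_(y in D2) g (f (x, y))%:E else 0)%E.
  move=> g0; case: ifPn => xD.
    rewrite [RHS]integral_mkcond; apply: eq_integral => y _.
    by rewrite FE xD patchE/=; case: ifPn.
  by rewrite integral0_eq// => y _; rewrite FE (negPf xD).
have F2 (g : \bar R -> \bar R) y : g 0%E = 0%E -> (\int[m1]_x g (F (x, y)) =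
    if y \in D2 then \int[m1]_(x in D1) g (f (x, y))%:E else 0)%E.
  move=> g0; case: ifPn => yD.
    rewrite [RHS]integral_mkcond; apply: eq_integral => x _.
    by rewrite FE yD andbT patchE/=; case: ifPn.
  by rewrite integral0_eq// => x _; rewrite FE (negPf yD) andbF.
have iF : (m1 \x m2)%E.-integrable setT F.
  move/(integrable_mkcond _ mD) : intf; congr (_.-integrable _ _).
  by apply/funext => z; rewrite /F !patchE; case: ifP.
have mF : measurable_fun setT F by case/integrableP : iF.
have iF1 := integrable_fubini_F iF.
have iF2 : m2.-integrable setT (fubini_G m1 F).
  have mG : measurable_fun setT (fubini_G m1 F) by exact: (measurable_fubini_G iF).
  apply/integrableP; split => //.
  apply: le_lt_trans ((integrable21ltyP m1 m2 mF).1 iF).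
  apply: ge0_le_integral => //.
  - exact: measurableT_comp.
  - by apply: (@measurable_fun_fubini_tonelli_G _ _ _ _ _ m1 (abse \o F)); first [exact: measurableT_comp|move=> z; exact: abse_ge0].
  - by move=> y _; apply: le_abse_integral => //; exact: measurableT_comp.
have E := Fubini iF.
have i1 : m1.-integrable D1 (fun x => \int[m2]_(y in D2) (f (x, y))%:E)%E.
  apply/(integrable_mkcond _ mD1); move: iF1; congr (_.-integrable _ _).
  by apply/funext => x; rewrite /fubini_F (F1 id)// patchE.
have i2 : m2.-integrable D2 (fun y => \int[m1]_(x in D1) (f (x, y))%:E)%E.
  apply/(integrable_mkcond _ mD2); move: iF2; congr (_.-integrable _ _).
  by apply/funext => y; rewrite /fubini_G (F2 id)// patchE.
have fineP d (T : measurableType d) (m : {measure set T -> \bar R}) D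
    (G : T -> \bar R) : measurable D -> m.-integrable D G ->
    m.-integrable D (EFin \o (fine \o G)) /\
    (\int[m]_(x in D) G x = \int[m]_(x in D) (fine (G x))%:E)%E.
  move=> mDD iG; have mG : measurable_fun D G by case/integrableP : iG.
  have mfG : measurable_fun D (EFin \o (fine \o G)).
    by apply/measurable_EFinP; apply: (measurableT_comp (fine_measurable measurableT) mG).
  split.
    apply: (le_integrable mDD mfG _ iG) => x Dx /=.
    by case: (G x) => [r| |] //=; rewrite ?normr0 ?lee_fin ?leey.
  apply: ae_eq_integral => //; apply: filterS (integrable_ae mDD iG) => x /= h Dx.
  by rewrite fineK// h.
have [j1 e1] := fineP _ _ _ _ _ mD1 i1; have [j2 e2] := fineP _ _ _ _ _ mD2 i2.
split => //.
  apply: filterS (ae_integrable1 iF) => x h D1x.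
  apply/(integrable_mkcond _ mD2); move: h; congr (_.-integrable _ _).
  by apply/funext => y; rewrite FE mem_set// patchE.
rewrite /Rintegral -[in LHS]e1 -[in RHS]e2; congr fine.
rewrite [LHS]integral_mkcond [RHS]integral_mkcond; move: E.
congr (_ = _); apply: eq_integral => x _; rewrite patchE.
  by rewrite (F1 id).
by rewrite (F2 id).
Qed.

Lemma fubini_bounded (D1 : set T1) (D2 : set T2) (f : T1 * T2 -> R) (M : R) :
  measurable D1 -> measurable D2 -> (m1 D1 < +oo)%E -> (m2 D2 < +oo)%E ->
  measurable_fun (D1 `*` D2) f ->
  (forall x y, D1 x -> D2 y -> `|f (x, y)| <= M) ->
  (m1 \x m2)%E.-integrable (D1 `*` D2) (EFin \o f).
Proof.
move=> mD1 mD2 f1 f2 mf fM; apply: measurable_bounded_integrable => //.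
- exact: measurableX.
- suff h : ((m1 \x m2)%E (D1 `*` D2) < +oo)%E by exact: h.
  by rewrite product_measure1E// lte_mul_pinfty// ge0_fin_numE.
- exists M; split; first exact: num_real.
  by move=> r Mr [x y] [D1x D2y]; apply: le_trans (fM _ _ D1x D2y) (ltW Mr).
Qed.

End fubini_real.

Section translation.
Context (R : realType).
Local Notation leb := (@lebesgue_measure R).

Let sh (h : R) : measurableTypeR R -> measurableTypeR R := fun x => x + h.

Let msh h : measurable_fun setT (sh h).
Proof. by apply: measurable_funD. Qed.

Lemma lebesgue_measure_shift (h : R) (A : set (measurableTypeR R)) : measurable A ->
  leb ((fun x : R => x + h) @^-1` A) = leb A.
Proof.
move=> mA; apply/esym.
apply: (@lebesgue_measure_unique R (pushforward leb (sh h))) => // X [[a b] _ <-].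
have E : sh h @^-1` `]a, b]%classic = `](a - h), (b - h)]%classic.
  by apply/seteqP; split => x /=; rewrite /sh !in_itv/= ltrBlDr lerBrDr.
transitivity (leb `](a - h), (b - h)]%classic); last by rewrite -E.
rewrite !lebesgue_measure_itv/= !lte_fin ltrD2r; case: ifPn => // _.
by rewrite -!EFinB; congr (_%:E); ring.
Qed.

Lemma Rintegral_shift (a b h : R) (f : R -> R) :
  leb.-integrable `]a, b[ (EFin \o f) ->
  leb.-integrable `](a + h), (b + h)[ (fun t => (f (t - h))%:E) /\
  \int[leb]_(t in `](a + h), (b + h)[) f (t - h) = \int[leb]_(t in `]a, b[) f t.
Proof.
move=> fi; have E : `](a + h), (b + h)[%classic = sh (- h) @^-1` `]a, b[%classic.
  by apply/seteqP; split => x /=; rewrite !in_itv/= /sh ltrBrDr ltrBlDr.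
have mab : measurable (`]a, b[%classic : set (measurableTypeR R)) by [].
have mab' : measurable (`](a + h), (b + h)[%classic : set (measurableTypeR R)) by [].
pose F : measurableTypeR R -> \bar R := ((EFin \o f) \_ `]a, b[)%E.
have iF : leb.-integrable setT F by apply/(integrable_mkcond _ mab).
have mF : measurable_fun setT F by case/integrableP : iF.
have pE (G : measurableTypeR R -> \bar R) : measurable_fun setT G -> (forall x, 0 <= G x)%E ->
    (\int[leb]_x G (sh (- h) x) = \int[leb]_x G x)%E.
  move=> mG G0.
  have := @ge0_integral_pushforward _ _ _ _ R (sh (- h)) (msh _) leb setT G.
  rewrite preimage_setT => <- //.
  by apply: eq_measure_integral => A mA _; exact: (lebesgue_measure_shift (- h) mA).
have iFs : leb.-integrable setT (F \o sh (- h)).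
  apply/integrableP; split; first by apply: measurableT_comp mF (msh _).
  rewrite (pE (abse \o F)); first by case/integrableP : iF.
  - by apply: measurableT_comp mF.
  - by move=> z; exact: abse_ge0.
have FE x : F (sh (- h) x) = ((fun t => (f (t - h))%:E) \_ `](a + h), (b + h)[) x.
  rewrite /F !patchE (_ : (_ \in `]a, b[%classic) = (x \in `](a + h), (b + h)[%classic)).
    by case: ifP.
  by rewrite E; apply/idP/idP; rewrite !inE.
split.
  apply/(integrable_mkcond _ mab'); move: iFs; congr (_.-integrable _ _).
  by apply/funext => x /=; rewrite FE.
rewrite /Rintegral; congr fine.
rewrite [LHS]integral_mkcond [RHS]integral_mkcond.
rewrite (eq_integral (F \o sh (- h))); last by move=> x _ /=; rewrite FE.
have := @integral_pushforward _ _ _ _ R (sh (- h)) (msh _) leb setT F mF.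
rewrite preimage_setT => /(_ iFs measurableT) <-.
by apply: eq_measure_integral => A mA _; exact: (lebesgue_measure_shift (- h) mA).
Qed.

Lemma ae_shift (h : R) (P : R -> Prop) :
  (\forall t \ae leb, P t) -> \forall t \ae leb, P (t - h).
Proof.
move=> [A [mA A0 PA]]; exists (sh (- h) @^-1` A); split.
- by rewrite -[X in measurable X]setTI; exact: msh.
- by rewrite -A0; exact: (lebesgue_measure_shift (- h) mA).
- by move=> t /= nP; apply: PA.
Qed.

End translation.

Lemma itv_oo_lty (R : realType) (a b : R) :
  (@lebesgue_measure R `]a, b[%classic < +oo)%E.
Proof. by rewrite lebesgue_measure_itv/=; case: ifP => // _; rewrite -EFinB ltry. Qed.

Lemma lebesgue_itv_oo (R : realType) (a b : R) : a <= b ->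
  @lebesgue_measure R `]a, b[%classic = (b - a)%:E.
Proof.
move=> ab; rewrite lebesgue_measure_itv/= lte_fin.
by move: ab; rewrite le_eqVlt => /predU1P[->|->]; rewrite ?ltxx ?subrr// -EFinB.
Qed.

Lemma Rintegral_cst_itv (R : realType) (a b c : R) : a <= b ->
  \int[@lebesgue_measure R]_(t in `]a, b[) c = c * (b - a).
Proof.
move=> ab; have mab : measurable (`]a, b[%classic : set (measurableTypeR R)) by [].
rewrite (Rintegral_cst _ mab); congr (_ * _).
by have := lebesgue_itv_oo ab => /= ->.
Qed.

(** * The lemma of du Bois-Reymond *)
Section du_bois_reymond.
Context (R : realType) (T : R) (T0 : 0 < T).
Local Notation leb := (@lebesgue_measure R).
Local Notation W := (`]0, T[%classic : set (measurableTypeR R)).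

Let mW : measurable W. Proof. by []. Qed.

Let fW : (leb W < +oo)%E.
Proof. exact: itv_oo_lty. Qed.

Lemma integrable_bounded_itv (g : R -> R) (C : R) : measurable_fun W g ->
  (forall x, `|g x| <= C) -> leb.-integrable W (EFin \o g).
Proof.
move=> mg gC; apply: (measurable_bounded_integrable mW fW mg).
by exists C; split; [exact: num_real|move=> r Cr x _; exact: le_trans (gC x) (ltW Cr)].
Qed.

Lemma integrable_cst_itv (c : R) : leb.-integrable W (EFin \o (fun=> c)).
Proof. by apply: (@integrable_bounded_itv _ `|c|) => //; exact: measurable_cst. Qed.

Lemma integrable_bounded_support (th : R -> R) (a b C : R) :
  measurable_fun (setT : set (measurableTypeR R)) th ->
  (forall x, `|th x| <= C) -> (forall x, ~~ (a < x < b) -> th x = 0) ->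
  leb.-integrable setT (EFin \o th).
Proof.
move=> mth thC th0.
have -> : (EFin \o th) = ((EFin \o th) \_ `]a, b[)%E.
  apply/funext => x; rewrite patchE; case: ifPn => //= xab.
  by rewrite th0//; move: xab; rewrite mem_setE in_itv.
apply/(integrable_mkcond _ _).1 => //.
apply: measurable_bounded_integrable => //.
- exact: itv_oo_lty.
- exact: measurable_funTS.
- by exists C; split; [exact: num_real|move=> r Cr x _; exact: le_trans (thC x) (ltW Cr)].
Qed.

(** A primitive of th vanishes after the support of th because th has mean zero.  It is
    written as an integral over a fixed set, to which Fubini applies. *)
Lemma time_test_primitive (th : R -> R) (a b C : R) : smooth1 th ->
  0 < a -> b < T -> (forall x, `|th x| <= C) ->
  (forall x, ~~ (a < x < b) -> th x = 0) -> \int[leb]_(x in W) th x = 0 ->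
  exists eta : R -> R, [/\ time_test_function T eta, eta^`()%classic = th &
    forall t, W t -> eta t = \int[leb]_(s in W) (if s <= t then th s else 0)].
Proof.
move=> sth a0 bT thC th0 ith; have cth := smooth1_continuous sth.
have mth : measurable_fun (setT : set (measurableTypeR R)) th.
  exact: continuous_measurable_fun.
have iT := integrable_bounded_support mth thC th0.
pose eta (t : R) : R := \int[leb]_(s in `]-oo, t]) th s.
have etaE t : eta t = \int[leb]_(s in W) (if s <= t then th s else 0).
  rewrite /eta Rintegral_mkcond [RHS]Rintegral_mkcond.
  apply: eq_Rintegral => s _; rewrite !patchE !mem_setE !in_itv/=.
  case: ifPn => // st; case: ifPn => // sW; rewrite th0//.
  by apply: contra sW => /andP[as_ sb]; rewrite (lt_trans a0)//= (lt_trans sb).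
have D t : derivable eta t 1 /\ eta^`()%classic t = th t.
  apply: (@continuous_FTC1 _ th -oo%O t (t + 1)) => //.
  - by rewrite ltrDl.
  - by apply: integrableS iT.
  - by rewrite ltNyr.
  - exact: cth.
have E : eta^`()%classic = th by apply/funext => t; case: (D t).
have eta0 t : ~~ (a < t < b) -> eta t = 0.
  move=> tab; rewrite etaE; have [ta|ta] := leP t a.
    transitivity (\int[leb]_(s in W) (fun=> 0 : R) s); last by rewrite Rintegral_cst// mul0r.
    apply: eq_Rintegral => s _; case: ifPn => // st; apply: th0.
    by rewrite negb_and -!leNgt (le_trans st ta).
  have bt : b <= t by move: tab; rewrite ta/= -leNgt.
  transitivity (\int[leb]_(x in W) th x) => //; apply: eq_Rintegral => s _; case: ifPn => // st.
  by rewrite th0// negb_and -!leNgt (le_trans bt) ?orbT// ltW// ltNge.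
have supp : closure [set t | eta t <> 0] `<=` `[a, b]%classic.
  rewrite [X in _ `<=` X](closure_id _).1; last exact: itv_closed.
  apply: closureS => t /= et; rewrite in_itv/=; apply: contrapT => tab; apply: et.
  apply: eta0; apply/negP => /andP[at_ tb]; apply: tab.
  by rewrite !ltW.
exists eta; split; [split|exact: E|by move=> t _; exact: etaE].
- case=> [|k] t; first by case: (D t).
  by rewrite derive1Sn E; exact: sth.
- apply: (subclosed_compact _ (@segment_compact _ a b)) => //.
  exact: closed_closure.
- move=> t /supp; rewrite /= !in_itv/= => /andP[at_ tb].
  by rewrite (lt_le_trans a0 at_) (le_lt_trans tb bT).
Qed.

(** Integration by parts against the primitive of a function k that is merely
    integrable. *)
Lemma primitive_fubini (th k : R -> R) (C : R) :
  measurable_fun (setT : set (measurableTypeR R)) th -> (forall x, `|th x| <= C) ->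
  leb.-integrable W (EFin \o k) ->
  leb.-integrable W (fun s => (\int[leb]_(t in W) (if s <= t then th s * k t else 0))%:E) /\
  \int[leb]_(t in W) ((\int[leb]_(s in W) (if s <= t then th s else 0)) * k t) =
  \int[leb]_(s in W) (\int[leb]_(t in W) (if s <= t then th s * k t else 0)).
Proof.
move=> mth thC ik; pose k' : measurableTypeR R -> R := k \_ W.
have ik' : leb.-integrable setT (EFin \o k').
  move/(integrable_mkcond _ mW) : ik; congr (_.-integrable _ _).
  by apply/funext => x; rewrite /k' /= !patchE; case: ifP.
have mk' : measurable_fun setT k' by apply/measurable_EFinP; case/integrableP : ik'.
have k'E t : W t -> k' t = k t by move=> Wt; rewrite /k' patchE mem_set.
clearbody k'.
pose f (z : measurableTypeR R * measurableTypeR R) : R :=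
  if z.2 <= z.1 then th z.2 * k' z.1 else 0.
have mWW : measurable (W `*` W) by exact: measurableX.
have C0 : 0 <= C by apply: le_trans (thC 0).
have mf : measurable_fun setT f.
  apply: measurable_fun_ifT => //.
  - by apply: measurable_fun_ler.
  - by apply: measurable_funM; exact: measurableT_comp.
have iM : (leb \x leb)%E.-integrable (W `*` W)
    (EFin \o (fun z : measurableTypeR R * measurableTypeR R => C * `|k' z.1|)).
  apply: integrable_prod => //.
    apply: measurable_funTS; apply: measurable_funM => //; apply: measurableT_comp => //.
    exact: measurableT_comp.
  rewrite (eq_integral (fun x => (`|C * `|k' x| |)%:E * leb W)%E); last first.
    move=> x _; have H := @integral_cst _ _ R leb W mW (`|C * `|k' x| |)%:E.
    by rewrite -H.

  have iCk : leb.-integrable W (fun x => (`|C * `|k' x| |)%:E).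
    have := integrableZl mW C (integrable_abse (integrableS measurableT mW (@subsetT _ _) ik')).
    apply: eq_integrable => // x _.
    by rewrite [in RHS](ger0_norm (mulr_ge0 C0 (normr_ge0 _))).
  have := integrableZr mW (fine (leb W)) iCk; case/integrableP => _.
  congr (_ < _)%E; apply: eq_integral => x _ /=.
  rewrite ger0_norm ?mulr_ge0 ?fine_ge0// EFinM fineK//.
  by rewrite ge0_fin_numE.
have iff : (leb \x leb)%E.-integrable (W `*` W) (EFin \o f).
  apply: le_integrable iM => //.
    by apply/measurable_EFinP; exact: measurable_funTS.
  move=> [t s] _ /=; rewrite lee_fin /f/=; case: ifP => _; last by rewrite normr0.
  by rewrite normrM [leRHS]ger0_norm ?mulr_ge0// ler_wpM2r.
have [_ i2 _ E] := @fubini_real _ _ _ _ R leb leb W W f mW mW iff.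
clear iff iM mf mWW ik' mk'.
split.
  clear E; move: i2; apply: eq_integrable => // s _; congr (_%:E).
  by apply: eq_Rintegral => t; rewrite inE => Wt; rewrite /f/= k'E.
transitivity (\int[leb]_(t in W) (\int[leb]_(s in W) f (t, s))); last first.
  rewrite E; clear E i2.
  apply: eq_Rintegral => s _; apply: eq_Rintegral => t; rewrite inE => Wt.
  by rewrite /f/= k'E.
clear E i2.
apply: eq_Rintegral => t; rewrite inE => Wt; rewrite mulrC -RintegralZl//.
  apply: eq_Rintegral => s _; rewrite /f/= k'E//; case: ifP => _; last by rewrite mulr0.
  by rewrite mulrC.
apply: (@integrable_bounded_itv _ C).
  apply: measurable_funTS; apply: measurable_fun_ifT => //.
  by apply: measurable_fun_ler.
by move=> s /=; case: ifP => _; rewrite ?normr0.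
Qed.

Lemma primitive_compl (k : R -> R) (s : R) : leb.-integrable W (EFin \o k) -> W s ->
  \int[leb]_(t in W) (if s <= t then k t else 0) =
  \int[leb]_(t in W) k t - \int[leb]_(t in `]0, s[) k t.
Proof.
move=> ik; rewrite /= in_itv/= => /andP[s0 sT].
have -> : \int[leb]_(t in `]0, s[) k t = \int[leb]_(t in W) (if t < s then k t else 0).
  rewrite [LHS]Rintegral_mkcond [RHS]Rintegral_mkcond; apply: eq_Rintegral => t _.
  rewrite !patchE !mem_setE !in_itv/=; have [t0/=|//] := boolP (0 < t).
  by have [ts|st] := ltP t s; [rewrite (lt_trans ts)|case: ifP].
rewrite -RintegralB//.
  by apply: eq_Rintegral => t _; case: leP => _; rewrite ?subrr ?subr0.
have mk : measurable_fun W k by apply/measurable_EFinP; case/integrableP : ik.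
apply: le_integrable ik => //.
  apply/measurable_EFinP; rewrite (_ : (fun x => _) = (fun x => k x * \1_`]-oo, s[ x)).
    by apply: measurable_funM => //; exact: measurable_indic.
  apply/funext => x; rewrite indicE mem_setE in_itv/=.
  by case: ifP => _; rewrite ?mulr1 ?mulr0.
by move=> t _ /=; case: ifP => _; rewrite ?normr0 lee_fin.
Qed.

Lemma integrable_primitive (k : R -> R) : leb.-integrable W (EFin \o k) ->
  leb.-integrable W (fun s => (\int[leb]_(t in `]0, s[) k t)%:E).
Proof.
move=> ik; have [||i1 _] := @primitive_fubini (fun=> 1) k 1 _ _ ik.
- exact: measurable_cst.
- by move=> x; rewrite normr1.
have ic := integrable_cst_itv (\int[leb]_(t in W) k t).
have := integrableB mW ic i1; apply: eq_integrable => // s; rewrite inE => Ws.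
rewrite /= -EFinB; congr (_%:E).
have -> : \int[leb]_(t in W) (if s <= t then 1 * k t else 0) =
    \int[leb]_(t in W) (if s <= t then k t else 0).
  by apply: eq_Rintegral => t _; rewrite mul1r.
by rewrite (primitive_compl ik Ws) opprB addrC subrK.
Qed.

Lemma integrable_bounded_mul (r g : R -> R) (C : R) : measurable_fun W r ->
  (forall x, `|r x| <= C) -> leb.-integrable W (EFin \o g) ->
  leb.-integrable W (EFin \o (fun x => r x * g x)).
Proof.
move=> mr rC ig; have mg : measurable_fun W g by apply/measurable_EFinP; case/integrableP : ig.
have C0 : 0 <= C by apply: le_trans (rC 0).
apply: (le_integrable mW _ _ (integrableZl mW C (integrable_abse ig))).
  by apply/measurable_EFinP; exact: measurable_funM.
move=> x _ /=; rewrite lee_fin normrM [leRHS]ger0_norm ?mulr_ge0//.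
by rewrite ler_wpM2r.
Qed.

Section orthogonality.
Variables (f k : R -> R).
Hypotheses (intf : leb.-integrable W (EFin \o f)) (ik : leb.-integrable W (EFin \o k)).
Hypothesis H : forall eta, time_test_function T eta ->
  \int[leb]_(t in W) (eta^`()%classic t * f t) = - \int[leb]_(t in W) (eta t * k t).

(** The defect F of f from being a primitive of k; it has to be constant. *)
Let F t := f t - \int[leb]_(s in `]0, t[) k s.

Lemma primitive_defect_integrable : leb.-integrable W (EFin \o F).
Proof.
have := integrableB mW intf (integrable_primitive ik).
by apply: eq_integrable => // t _; rewrite /= EFinB.
Qed.

Lemma primitive_defect_orth (th : R -> R) (a b C : R) : smooth1 th ->
  0 < a -> b < T -> (forall x, `|th x| <= C) ->
  (forall x, ~~ (a < x < b) -> th x = 0) -> \int[leb]_(x in W) th x = 0 ->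
  \int[leb]_(t in W) (th t * F t) = 0.
Proof.
move=> sth a0 bT thC th0 ith.
have [eta [teta etaE etaI]] := time_test_primitive sth a0 bT thC th0 ith.
have mth : measurable_fun (setT : set (measurableTypeR R)) th.
  by apply: continuous_measurable_fun; exact: smooth1_continuous.
have mthW : measurable_fun W th by exact: measurable_funTS.
have HE := H teta; rewrite etaE in HE.
have [i1 E1] := primitive_fubini mth thC ik; clear i1.
have iP := integrable_primitive ik.
have -> : \int[leb]_(t in W) (th t * F t) =
    \int[leb]_(t in W) (th t * f t) - \int[leb]_(t in W) (th t * \int[leb]_(s in `]0, t[) k s).
  rewrite -(RintegralB mW (integrable_bounded_mul mthW thC intf)
    (integrable_bounded_mul mthW thC iP)).
  by apply: eq_Rintegral => t _; rewrite /F mulrBr.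
rewrite HE.
have -> : \int[leb]_(t in W) (eta t * k t) = \int[leb]_(s in W)
    (th s * \int[leb]_(t in W) k t - th s * \int[leb]_(t in `]0, s[) k t).
  transitivity (\int[leb]_(s in W) \int[leb]_(t in W) (if s <= t then th s * k t else 0)).
    by rewrite -E1; apply: eq_Rintegral => t; rewrite inE => Wt; rewrite etaI.
  clear E1 HE; apply: eq_Rintegral => s; rewrite inE => Ws.
  rewrite -mulrBr -(primitive_compl ik Ws).
  have mk : measurable_fun W k by apply/measurable_EFinP; case/integrableP : ik.
  have iks : leb.-integrable W (EFin \o (fun t => if s <= t then k t else 0)).
    apply: (le_integrable mW _ _ ik).
      apply/measurable_EFinP; rewrite (_ : (fun x => _) = (fun x => k x * \1_`[s, +oo[ x)).
        by apply: measurable_funM => //; exact: measurable_indic.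
      apply/funext => x; rewrite indicE mem_setE in_itv/= andbT.
      by case: ifP => _; rewrite ?mulr1 ?mulr0.
    by move=> t _ /=; case: ifP => _; rewrite ?normr0 lee_fin.
  rewrite -(RintegralZl _ mW iks).
  by apply: eq_Rintegral => t _; case: ifP; rewrite ?mulr0.
clear E1 HE.
have ic := integrable_cst_itv (\int[leb]_(t in W) k t).
rewrite (RintegralB mW (integrable_bounded_mul mthW thC ic)
  (integrable_bounded_mul mthW thC iP)).
rewrite (RintegralZr _ mW); last exact: (integrable_bounded_itv mthW thC).
by rewrite ith mul0r sub0r opprK subrr.
Qed.

(** The combination (int r') r - (int r) r' has mean zero, hence is orthogonal to F. *)
Lemma primitive_defect_exchange (r r' : R -> R) (a b : R) : smooth1 r -> smooth1 r' ->
  0 < a -> b < T -> (forall x, `|r x| <= 1) -> (forall x, `|r' x| <= 1) ->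
  (forall x, ~~ (a < x < b) -> r x = 0) -> (forall x, ~~ (a < x < b) -> r' x = 0) ->
  (\int[leb]_(t in W) r' t) * (\int[leb]_(t in W) (r t * F t)) =
  (\int[leb]_(t in W) r t) * (\int[leb]_(t in W) (r' t * F t)).
Proof.
move=> sr sr' a0 bT r1 r1' r0 r0'.
have mb g : smooth1 g -> measurable_fun W g.
  move=> /smooth1_continuous cr; apply: measurable_funTS.
  exact: continuous_measurable_fun.
have ir := integrable_bounded_itv (mb _ sr) r1.
have ir' := integrable_bounded_itv (mb _ sr') r1'.
have irF := integrable_bounded_mul (mb _ sr) r1 primitive_defect_integrable.
have irF' := integrable_bounded_mul (mb _ sr') r1' primitive_defect_integrable.
have lin (p p' : R -> R) (al be : R) : leb.-integrable W (EFin \o p) ->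
    leb.-integrable W (EFin \o p') ->
    \int[leb]_(t in W) (al * p t + be * p' t) =
    al * (\int[leb]_(t in W) p t) + be * (\int[leb]_(t in W) p' t).
  move=> ip ip'; rewrite -(RintegralZl _ mW ip) -(RintegralZl _ mW ip').
  rewrite (RintegralD mW)//.
    by have := integrableZl mW al ip.
  by have := integrableZl mW be ip'.
have [m mE] : exists m, m = \int[leb]_(t in W) r t by eexists.
have [m' mE'] : exists m, m = \int[leb]_(t in W) r' t by eexists.
rewrite -mE -mE'.
have := @primitive_defect_orth (fun x => m' * r x + (- m) * r' x) a b (`|m'| + `|m|).
have -> : \int[leb]_(x in W) (m' * r x + - m * r' x) = 0.
  by rewrite (lin _ _ _ _ ir ir') -mE -mE'; ring.
have -> : \int[leb]_(t in W) ((m' * r t + - m * r' t) * F t) =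
    m' * (\int[leb]_(t in W) (r t * F t)) + (- m) * (\int[leb]_(t in W) (r' t * F t)).
  by rewrite -(lin _ _ _ _ irF irF'); apply: eq_Rintegral => t _; ring.
move=> h; apply/eqP; rewrite -subr_eq0 -mulNr; apply/eqP.
clear ir ir' irF irF' lin mE mE'; apply: h => [|||x|x xab|//].
- exact: smooth1_lin.
- exact: a0.
- exact: bT.
- apply: le_trans (ler_normD _ _) _; rewrite !normrM normrN.
  by apply: lerD; rewrite ler_piMr ?normr_ge0 ?r1 ?r1'.
- by rewrite r0// r0'// !mulr0 addr0.
Qed.

(** Let the bumps r and r' of primitive_defect_exchange tend to indicators: F has the same
    mean over all intervals. *)
Lemma primitive_defect_itv (a b a' b' : R) : 0 < a -> a < b -> b < T ->
  0 < a' -> a' < b' -> b' < T ->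
  (b' - a') * (\int[leb]_(t in `]a, b[) F t) = (b - a) * (\int[leb]_(t in `]a', b'[) F t).
Proof.
move=> a0 ab bT a'0 ab' bT'.
have iF := primitive_defect_integrable.
have mF : measurable_fun W F by apply/measurable_EFinP; case/integrableP : iF.
pose c n : R := n.+1%:R^-1.
have c0 n : 0 < c n by rewrite invr_gt0.
have b1 n y z x : `|bump_one (c n) y z x| <= 1.
  by rewrite ger0_norm ?bump_one_ge0 ?bump_one_le1.
have mb n y z : measurable_fun W (bump_one (c n) y z).
  apply: measurable_funTS; apply: continuous_measurable_fun.
  by apply: smooth1_continuous; exact: smooth1_bump.
have sub y z : 0 < y -> z < T -> `]y, z[%classic `<=` W.
  by move=> y0 zT x; rewrite /= !in_itv/= => /andP[yx xz]; rewrite (lt_trans y0) ?(lt_trans xz).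
have sub1 y z g : 0 < y -> z < T ->
    \int[leb]_(t in W) (\1_`]y, z[ t * g t) = \int[leb]_(t in `]y, z[) g t.
  move=> y0 zT; rewrite [LHS]Rintegral_mkcond [RHS]Rintegral_mkcond.
  apply: eq_Rintegral => t _; rewrite !patchE indicE.
  case: (boolP (t \in `]y, z[%classic)) => tyz; last by rewrite mul0r if_same.
  by rewrite ifT ?mul1r//; apply/mem_set/(sub y z) => //; exact: set_mem.
have lim1 y z : 0 < y -> y < z -> z < T ->
    \int[leb]_(t in W) bump_one (c n) y z t @[n --> \oo] --> (z - y : R).
  move=> y0 yz zT.
  have -> : z - y = \int[leb]_(t in W) (\1_`]y, z[ t : R).
    transitivity (\int[leb]_(t in W) (\1_`]y, z[ t * 1 : R)); last first.
      by apply: eq_Rintegral => t _; rewrite mulr1.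
    by rewrite sub1// Rintegral_cst_itv ?mul1r// ltW.
  apply: (Rintegral_dominated_cvg mW (g := fun=> 1)) => //.
  - exact: integrable_cst_itv.
  - by move=> x _; exact: bump_one_cvg.
have limF y z : 0 < y -> y < z -> z < T ->
    \int[leb]_(t in W) (bump_one (c n) y z t * F t) @[n --> \oo] -->
    \int[leb]_(t in `]y, z[) F t.
  move=> y0 yz zT; rewrite -sub1//.
  apply: (Rintegral_dominated_cvg mW (g := fun x => `|F x|)) => //.
  - by move=> n; apply: measurable_funM.
  - by apply: measurable_funM => //; exact: measurable_indic.
  - exact: (integrable_abse iF).
  - by move=> x _; apply: cvgM; [exact: bump_one_cvg|exact: cvg_cst].
  - by move=> n x _; rewrite normrM ler_piMl.
have L := cvgM (lim1 _ _ a'0 ab' bT') (limF _ _ a0 ab bT).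
have L' := cvgM (lim1 _ _ a0 ab bT) (limF _ _ a'0 ab' bT').
have {L'} := cvg_lim (@Rhausdorff R) (L' _); have {L} := cvg_lim (@Rhausdorff R) (L _).
move=> <- <-; congr (limn _); apply/funext => n /=.
have out y z x : y < z -> Num.min a a' <= y -> z <= Num.max b b' ->
    ~~ (Num.min a a' < x < Num.max b b') -> bump_one (c n) y z x = 0.
  move=> yz ay zb xab; rewrite bump_oneE// ifF//; apply: contraNF xab => /andP[yx xz].
  by rewrite (le_lt_trans ay yx) (lt_le_trans xz zb).
apply: (@primitive_defect_exchange _ _ (Num.min a a') (Num.max b b')).
- exact: smooth1_bump.
- exact: smooth1_bump.
- by rewrite lt_min a0.
- by rewrite gt_max bT.
- exact: b1.
- exact: b1.
- by move=> x; apply: out; rewrite ?ge_min ?le_max ?lexx.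
- by move=> x; apply: out; rewrite ?ge_min ?le_max ?lexx ?orbT.
Qed.

(** With c the common mean of F over intervals, F - c has integral zero over every interval,
    and the intervals form a pi-system. *)
Lemma du_bois_reymond : exists c : R, \forall t \ae leb, 0 < t < T ->
  f t = c + \int[leb]_(s in `]0, t[) k s.
Proof.
pose a' := T / 3; pose b' := 2 * T / 3.
have a'0 : 0 < a' by rewrite divr_gt0.
have ab' : a' < b' by rewrite /a' /b'; move: T0; lra.
have bT' : b' < T by rewrite /b'; move: T0; lra.
have [J JE] : exists J, J = \int[leb]_(t in `]a', b'[) F t by eexists.
pose c := J / (b' - a').
have iF := primitive_defect_integrable.
have iFc : leb.-integrable W (EFin \o (fun t => F t - c)).
  by have := integrableB mW iF (integrable_cst_itv c); apply: eq_integrable.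
have sub y z : 0 < y -> z < T -> `]y, z[%classic `<=` W.
  by move=> y0 zT x; rewrite /= !in_itv/= => /andP[yx xz]; rewrite (lt_trans y0) ?(lt_trans xz).
have itv0 y z : 0 < y -> z < T -> \int[leb]_(t in `]y, z[) (F t - c) = 0.
  move=> y0 zT; have [yz|zy] := ltP y z; last first.
    by rewrite set_itv_ge ?Rintegral_set0// bnd_simp -leNgt.
  have myz : measurable (`]y, z[%classic : set (measurableTypeR R)) by [].
  rewrite (RintegralB myz); last 2 first.
  - by apply: integrableS iF => //; exact: sub.
  - by apply: integrableS (integrable_cst_itv c) => //; exact: sub.
  rewrite (Rintegral_cst_itv _ (ltW yz)).
  have := primitive_defect_itv y0 yz zT a'0 ab' bT'; rewrite -JE => E.
  have d0 : b' - a' != 0 by rewrite subr_eq0 gt_eqF.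
  apply: (mulfI d0); rewrite mulr0 mulrBr E /c; field.
  exact: d0.
pose d n : R := T / n.+3%:R.
have d0 n : 0 < d n by rewrite divr_gt0.
have ae n : \forall t \ae leb, `]d n, (T - d n)[%classic t -> F t - c = 0.
  have mD : measurable (`]d n, (T - d n)[%classic : set (measurableTypeR R)) by [].
  have DT : T - d n < T by rewrite ltrBlDr ltrDl.
  apply: (@integral_pi_system_eq0 _ (measurableTypeR R) R leb (@RGenOInfty.G R)
    (`]d n, (T - d n)[%classic : set R) (fun t => F t - c)).
  - move=> A B [x ->] [y ->]; exists (Num.max x y); apply/seteqP; split => t /=;
      by rewrite !in_itv/= !andbT gt_max => /andP.
  - by move=> A; have -> := RGenOInfty.measurableE R.
  - exact: mD.
  - by apply: integrableS iFc => //; exact: sub.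
  - exact: itv0.
  - move=> A mA [x ->].
    rewrite (_ : _ `&` _ = `](Num.max x (d n)), (T - d n)[%classic).
      by apply: itv0 => //; rewrite lt_max d0 orbT.
    apply/seteqP; split => t /=; rewrite !in_itv/= andbT gt_max.
      by move=> [-> /andP[-> ->]].
    by move=> /andP[/andP[-> ->] ->].
  - by move=> A [x ->].
exists c; apply: filterS (ae_foralln ae) => t h /andP[t0 tT].
suff [n dn] : exists n, `]d n, (T - d n)[%classic t.
  have := h _ dn; rewrite /F; lra.
pose m := Num.min t (T - t).
have m0 : 0 < m by rewrite lt_min t0 subr_gt0.
exists (Num.truncn (T / m)).
have dm : d (Num.truncn (T / m)) < m.
  rewrite ltr_pdivrMr// mulrC -ltr_pdivrMr//.
  by apply: (lt_trans (truncnS_gt _)); rewrite ltr_nat.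
rewrite /= in_itv/=; move: dm; rewrite lt_min => /andP[-> ?] /=; lra.
Qed.

End orthogonality.
End du_bois_reymond.

(** * Strongly measurable curves in X *)
(** The bound on a pairing <v', w'> - <v, w> when v' tends to v and w' to w; a and b are the
    distances, p and q the norms of the limits. *)
Lemma cvg_bilinear_bound (R : realType) (a b c : nat -> R) (p q l : R) :
  a n @[n --> \oo] --> 0 -> b n @[n --> \oo] --> 0 ->
  (forall n, `|c n - l| <= a n * (b n + p) + q * b n) -> c n @[n --> \oo] --> l.
Proof.
move=> a0 b0 bnd; apply/cvgrPdist_le => e e0.
have L : a n * (b n + p) + q * b n @[n --> \oo] --> 0 * (0 + p) + q * 0.
  apply: cvgD; first exact: (cvgM a0 (cvgD b0 (cvg_cst _))).
  exact: (cvgM (cvg_cst _) b0).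
rewrite mul0r mulr0 addr0 in L.
move/cvgrPdist_le : L => /(_ e e0); apply: filterS => n.
by rewrite sub0r normrN distrC => h; exact: le_trans (bnd n) (le_trans (ler_norm _) h).
Qed.

Section strong_measurability.
Context (R : realType) (N : nat) (Omega : set 'rV[R]_N).
Hypotheses (oO : open Omega) (fO : (lebesgue_rV R N Omega < +oo)%E).
Local Notation mu := (lebesgue_rV R N).
Implicit Types (v : R -> 'rV[R]_N -> R).

Lemma grad_pair_suml (I : Type) (r : seq I) (c : I -> R) (phi : I -> 'rV[R]_N -> R) (w : 'rV[R]_N -> R) :
  (forall i, H1 Omega (phi i)) -> H1 Omega w ->
  H1 Omega (fun x => \sum_(i <- r) c i * phi i x) /\
  grad_pair Omega (fun x => \sum_(i <- r) c i * phi i x) w =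
  \sum_(i <- r) c i * grad_pair Omega (phi i) w.
Proof.
move=> Hphi Hw; elim: r => [|i r [IH1 IH2]].
  under [in X in _ /\ X]eq_fun do rewrite big_nil.
  under eq_fun do rewrite big_nil.
  split; first exact: H1_0.
  have -> : (fun=> 0 : R) = (fun x : 'rV[R]_N => 0 * w x + 0 * w x).
    by apply/funext => x; rewrite mul0r addr0.
  by rewrite (grad_pairDl oO fO)// !mul0r addr0 big_nil.
have E : (fun x => \sum_(j <- i :: r) c j * phi j x) =
    (fun x => c i * phi i x + 1 * \sum_(j <- r) c j * phi j x).
  by apply/funext => x; rewrite big_cons mul1r.
rewrite E; have [Hs _] := H1_lin oO fO (c i) 1 (Hphi i) IH1; split; first exact: Hs.
by rewrite (grad_pairDl oO fO)// IH2 mul1r big_cons.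
Qed.

(** The approximation is required at every time, so that pairings with the curve are
    measurable functions of time and not only up to null sets. *)
Definition strongly_measurable v := exists s : nat -> R -> 'rV[R]_N -> R,
  (forall n, simple_in_X Omega (s n)) /\
  forall t, norm_X Omega (s n t \- v t) @[n --> \oo] --> 0.

Lemma simple_in_X_H1 s t : simple_in_X Omega s -> H1 Omega (s t).
Proof.
move=> [m [S [phi [_ Hphi sE]]]].
have -> : s t = fun x => \sum_(j < m) \1_(S j) t * phi j x by apply/funext => x; rewrite sE.
have Hp j : H1 Omega (phi j) by exact: H10_H1 (Hphi j).
by have [] := @grad_pair_suml _ (index_enum 'I_m) (fun j => \1_(S j) t) phi _ Hp (H1_0 oO).
Qed.

Lemma strongly_measurable_cst (w : 'rV[R]_N -> R) : H10 Omega w -> strongly_measurable (fun=> w).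
Proof.
move=> Hw; exists (fun _ _ => w); split.
  move=> _; exists 1%N, (fun=> setT), (fun=> w); split => // t x.
  by rewrite big_ord1 indicT mul1r.
move=> t; have -> : (fun n : nat => norm_X Omega (w \- w)) = fun=> 0.
  apply/funext => _; rewrite /norm_X.
  have -> : w \- w = fun x => 0 * w x by apply/funext => x /=; rewrite subrr mul0r.
  by rewrite (A_fun_scale oO fO _ (H10_H1 Hw)) expr0n mul0r sqrtr0.
exact: cvg_cst.
Qed.

Lemma strongly_measurable_if (A : set R) v (w : R -> 'rV[R]_N -> R) (s r : nat -> R -> 'rV[R]_N -> R) :
  measurable A -> (forall n, simple_in_X Omega (s n)) -> (forall n, simple_in_X Omega (r n)) ->
  (forall t, A t -> norm_X Omega (s n t \- v t) @[n --> \oo] --> 0) ->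
  (forall t, ~ A t -> norm_X Omega (r n t \- w t) @[n --> \oo] --> 0) ->
  strongly_measurable (fun t => if t \in A then v t else w t).
Proof.
move=> mA ss sr sv rw.
exists (fun n t => if t \in A then s n t else r n t); split => [n|t].
  have [m [S [phi [mS Hphi sE]]]] := ss n; have [m' [S' [phi' [mS' Hphi' rE]]]] := sr n.
  exists (m + m')%N, (fun j => match fintype.split j with inl i => S i `&` A | inr i => S' i `\` A end),
    (fun j => match fintype.split j with inl i => phi i | inr i => phi' i end).
  split => [j|j|t x].
  - by case: splitP => i _; [exact: measurableI|exact: measurableD].
  - by case: splitP.
  - rewrite big_split_ord/=.
    under eq_bigr => j _ do rewrite (unsplitK (inl j)) indicI.
    under [X in _ = _ + X]eq_bigr => j _ do rewrite (unsplitK (inr j)) setDE indicI.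
    case: (boolP (t \in A)) => tA.
      rewrite sE [X in _ = _ + X]big1 ?addr0 => [|j _].
        by apply: eq_bigr => j _; rewrite /= [\1_A t]indicE tA mulr1.
      by rewrite /= [\1_(~` A) t]indicE in_setC tA mulr0 mul0r.
    rewrite rE [X in _ = X + _]big1 ?add0r => [|j _].
      by apply: eq_bigr => j _; rewrite /= [\1_(~` A) t]indicE in_setC tA mulr1.
    by rewrite /= [\1_A t]indicE (negPf tA) mulr0 mul0r.
case: (boolP (t \in A)) => tA; first by apply: sv; exact: set_mem.
by apply: rw; rewrite notin_setE in tA.
Qed.

(** Joint measurability in two times, needed for Fubini on a strip: for simple curves the
    pairing takes finitely many values on rectangles. *)
Lemma grad_pair_measurable v (w : R -> 'rV[R]_N -> R) : strongly_measurable v -> strongly_measurable w ->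
  (forall t, H1 Omega (v t)) -> (forall t, H1 Omega (w t)) ->
  measurable_fun (setT : set (measurableTypeR R * measurableTypeR R))
    (fun z => grad_pair Omega (v z.1) (w z.2)).
Proof.
move=> [s [ss sv]] [r [sr rw]] Hv Hw.
apply: (@measurable_fun_cvg _ _ _ setT
  (fun n (z : measurableTypeR R * measurableTypeR R) => grad_pair Omega (s n z.1) (r n z.2))).
- move=> n; have [m [S [phi [mS Hphi sE]]]] := ss n; have [m' [S' [phi' [mS' Hphi' rE]]]] := sr n.
  have Hp j : H1 Omega (phi j) by exact: H10_H1 (Hphi j).
  have Hp' j : H1 Omega (phi' j) by exact: H10_H1 (Hphi' j).
  rewrite (_ : (fun z => _) = fun z => \sum_(i < m) \sum_(j < m')
      \1_(S i) z.1 * (\1_(S' j) z.2 * grad_pair Omega (phi' j) (phi i))).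
    apply: measurable_sum => i; apply: measurable_sum => j.
    apply: measurable_funM.
      by apply: measurableT_comp => //; exact: measurable_indic.
    apply: measurable_funM => //.
    by apply: measurableT_comp => //; exact: measurable_indic.
  apply/funext => z.
  have -> : s n z.1 = fun x => \sum_(j < m) \1_(S j) z.1 * phi j x.
    by apply/funext => x; rewrite sE.
  have -> : r n z.2 = fun x => \sum_(j < m') \1_(S' j) z.2 * phi' j x.
    by apply/funext => x; rewrite rE.
  have [Hr _] := @grad_pair_suml _ (index_enum 'I_m') (fun j => \1_(S' j) z.2) phi' _ Hp' (H1_0 oO).
  have [_ ->] := @grad_pair_suml _ (index_enum 'I_m) (fun j => \1_(S j) z.1) phi _ Hp Hr.
  apply: eq_bigr => i _; rewrite -mulr_sumr; congr (_ * _).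
  rewrite grad_pairC.
  by have [_ ->] := @grad_pair_suml _ (index_enum 'I_m') (fun j => \1_(S' j) z.2) phi' _ Hp' (Hp i).
- move=> [t t'] _ /=; have {}sv := sv t; have {}rw := rw t'.
  have Hs n : H1 Omega (s n t) by exact: simple_in_X_H1.
  have Hr n : H1 Omega (r n t') by exact: simple_in_X_H1.
  have HB (f g : 'rV[R]_N -> R) : H1 Omega f -> H1 Omega g -> H1 Omega (f \- g) /\
      forall z, H1 Omega z -> grad_pair Omega (f \- g) z = grad_pair Omega f z - grad_pair Omega g z.
    move=> Hf Hg; have E : f \- g = fun x => 1 * f x + (- 1) * g x.
      by apply/funext => x /=; rewrite mul1r mulN1r.
    rewrite E; have [Hfg _] := H1_lin oO fO 1 (- 1) Hf Hg; split; first exact: Hfg.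
    by move=> z Hz; rewrite (grad_pairDl oO fO)// mul1r mulN1r.
  set gp := grad_pair Omega (v t) (w t').
  have bnd n : `|grad_pair Omega (s n t) (r n t') - gp| <=
      norm_X Omega (s n t \- v t) * (norm_X Omega (r n t' \- w t') + norm_X Omega (w t')) +
      norm_X Omega (v t) * norm_X Omega (r n t' \- w t').
    have [H1d Ed] := HB _ _ (Hs n) (Hv t); have [H2d E2d] := HB _ _ (Hr n) (Hw t').
    have -> : grad_pair Omega (s n t) (r n t') - gp =
        grad_pair Omega (s n t \- v t) (r n t' \- w t') +
        grad_pair Omega (s n t \- v t) (w t') + grad_pair Omega (v t) (r n t' \- w t').
      have E2 z : H1 Omega z -> grad_pair Omega z (r n t' \- w t') =
          grad_pair Omega z (r n t') - grad_pair Omega z (w t').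
        move=> Hz; rewrite (grad_pairC _ z (r n t' \- w t')) (E2d _ Hz).
        by rewrite (grad_pairC _ (r n t') z) (grad_pairC _ (w t') z).
      rewrite (Ed _ H2d) (Ed _ (Hw t')) (E2 _ (Hs n)) (E2 _ (Hv t)) /gp.
      move: (grad_pair _ (s n t) (r n t')) (grad_pair _ (s n t) (w t')).
      move: (grad_pair _ (v t) (r n t')) (grad_pair _ (v t) (w t')) => x1 x2 x3 x4.
      ring.
    have h1 := grad_pair_le oO fO H1d H2d; have h2 := grad_pair_le oO fO H1d (Hw t').
    have h3 := grad_pair_le oO fO (Hv t) H2d.
    move: h1 h2 h3; move: (norm_X _ (s n t \- v t)) (norm_X _ (r n t' \- w t')).
    move: (norm_X _ (v t)) (norm_X _ (w t')) (grad_pair _ (s n t \- v t) (r n t' \- w t')).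
    move: (grad_pair _ (s n t \- v t) (w t')) (grad_pair _ (v t) (r n t' \- w t')).
    move=> x2 x3 a b x1 c d h1 h2 h3.
    rewrite mulrDr; apply: le_trans (ler_normD _ _) _.
    by apply: lerD => //; apply: le_trans (ler_normD _ _) _; exact: lerD.
  exact: (cvg_bilinear_bound sv rw bnd).
Qed.

End strong_measurability.

(** * Integrals over intervals and over a diagonal strip *)
Section interval_integrals.
Context (R : realType).
Local Notation leb := (@lebesgue_measure R).
Implicit Types (f : R -> R) (a b : R).

Lemma ae_le_Rintegral d (T : measurableType d) (mu : {measure set T -> \bar R})
  (D : set T) (f1 f2 : T -> R) : measurable D ->
  mu.-integrable D (EFin \o f1) -> mu.-integrable D (EFin \o f2) ->
  (\forall x \ae mu, D x -> f1 x <= f2 x) ->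
  \int[mu]_(x in D) f1 x <= \int[mu]_(x in D) f2 x.
Proof.
move=> mD i1 i2 h.
have m1 : measurable_fun D f1 by apply/measurable_EFinP; case/integrableP : i1.
have m2 : measurable_fun D f2 by apply/measurable_EFinP; case/integrableP : i2.
pose g (x : T) := Num.max (f1 x) (f2 x).
have mg : measurable_fun D g by exact: measurable_maxr.
have E : (\int[mu]_(x in D) (g x)%:E = \int[mu]_(x in D) (f2 x)%:E)%E.
  apply: ae_eq_integral => //; first exact/measurable_EFinP.
    exact/measurable_EFinP.
  by apply: filterS h => x h Dx; rewrite /g max_r// h.
have ig : mu.-integrable D (EFin \o g).
  apply: (le_integrable mD _ _ (integrableD mD (integrable_abse i1) (integrable_abse i2))).
    exact/measurable_EFinP.
  move=> x _ /=; rewrite lee_fin [leRHS]ger0_norm ?addr_ge0// /g.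
  by case: (leP (f1 x) (f2 x)) => _; rewrite ?lerDl ?lerDr.
have -> : \int[mu]_(x in D) f2 x = \int[mu]_(x in D) g x by rewrite /Rintegral E.
by apply: le_Rintegral => // x _; rewrite /g le_max lexx.
Qed.

Lemma Rintegral_itv_empty f a b : b <= a -> \int[leb]_(t in `]a, b[) f t = 0.
Proof. by move=> ba; rewrite set_itv_ge ?Rintegral_set0// bnd_simp -leNgt. Qed.

Lemma Rintegral_split f a (x : R) b : a <= x -> x <= b -> leb.-integrable `]a, b[ (EFin \o f) ->
  \int[leb]_(t in `]a, b[) f t = \int[leb]_(t in `]a, x[) f t + \int[leb]_(t in `]x, b[) f t.
Proof.
rewrite le_eqVlt => /predU1P[->|ax].
  by move=> _ _; rewrite (@Rintegral_itv_empty f x x)// add0r.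
rewrite le_eqVlt => /predU1P[->|xb] fi.
  by rewrite (@Rintegral_itv_empty f b b)// addr0.
have H := @Rintegral_itvB _ f (BRight a) (BLeft b) x fi.
rewrite -H ?bnd_simp//; last exact: ltW.
rewrite (@Rintegral_itv_bndo_bndc _ (BRight a) x f); first by rewrite addrC subrK.
apply: integrableS fi => // t; rewrite /= !in_itv/= => /andP[-> /=].
by move=> /lt_trans; exact.
Qed.

Lemma integrable_sub_itv f a b a' b' : a <= a' -> b' <= b ->
  leb.-integrable `]a, b[ (EFin \o f) -> leb.-integrable `]a', b'[ (EFin \o f).
Proof.
move=> aa bb; apply: integrableS => // t; rewrite /= !in_itv/= => /andP[at_ tb].
by rewrite (le_lt_trans aa at_) (lt_le_trans tb bb).
Qed.

Lemma Rintegral_eq_cst f a b c : a <= b -> (forall t, a < t < b -> f t = c) ->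
  \int[leb]_(t in `]a, b[) f t = c * (b - a).
Proof.
move=> ab fc; rewrite -Rintegral_cst_itv//; apply: eq_Rintegral => t.
by rewrite inE/= in_itv/=; exact: fc.
Qed.

Lemma integrable_bounded_oo f a b C :
  measurable_fun (`]a, b[%classic : set (measurableTypeR R)) f ->
  (forall t, a < t < b -> `|f t| <= C) -> leb.-integrable `]a, b[ (EFin \o f).
Proof.
move=> mf fC; apply: measurable_bounded_integrable => //; first exact: itv_oo_lty.
exists C; split; [exact: num_real|move=> r Cr t; rewrite /= in_itv/= => h].
exact: le_trans (fC _ h) (ltW Cr).
Qed.

Lemma Rintegral_linear_left a b : a <= b ->
  \int[leb]_(t in `]a, b[) (t - a) = (b - a) ^+ 2 / 2.
Proof.
rewrite le_eqVlt => /predU1P[->|ab].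
  by rewrite Rintegral_itv_empty// subrr expr0n mul0r.
have D (t : R) : is_derive t 1 (fun t => (t - a) ^+ 2 / 2) (t - a).
  have d1 : is_derive t 1 ((id : R -> R) - cst a) (1 - 0).
    exact: (is_deriveB (is_derive_id t 1) (is_derive_cst a t 1)).
  have := is_deriveZ 2^-1 (is_deriveM d1 d1).
  rewrite (_ : _ \*: _ = fun t => (t - a) ^+ 2 / 2); last first.
    by apply/funext => s; rewrite [RHS]mulrC expr2.
  rewrite (_ : _ *: _ = t - a)//.
  have E : 2^-1 * ((t - a) * (1 - 0) + (t - a) * (1 - 0)) = t - a by field.
  exact: E.
have cl : continuous (fun t : R => t - a).
  by move=> t; apply: cvgB; [exact: cvg_id|exact: cvg_cst].
have dF (t : R) : {for t, continuous (fun t : R => (t - a) ^+ 2 / 2)}.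
  by apply/differentiable_continuous/derivable1_diffP; have [] := D t.
have := @continuous_FTC2 R (fun t => t - a) (fun t => (t - a) ^+ 2 / 2) a b ab.
move=> /(_ (continuous_subspaceT cl)).
have dd : derivable_oo_LRcontinuous (fun t : R => (t - a) ^+ 2 / 2) a b.
  split; first by move=> t _; have [] := D t.
  - exact/cvg_at_right_filter/dF.
  - exact/cvg_at_left_filter/dF.
move=> /(_ dd) H.
have {}H := H (fun t _ => etrans (derive1E _ _) (@derive_val _ _ _ _ _ _ _ (D t))).
have -> : \int[leb]_(t in `]a, b[) (t - a) = fine (\int[leb]_(t in `[a, b]) (t - a)%:E)%E.
  rewrite /Rintegral; congr fine.
  rewrite integral_itv_bndo_bndc ?integral_itv_obnd_cbnd//;
    apply/measurable_EFinP; apply: measurable_funTS; exact: continuous_measurable_fun.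
by rewrite H/= subrr expr0n mul0r subr0.
Qed.

Lemma Rintegral_linear_right a b : a <= b ->
  \int[leb]_(t in `]a, b[) (b - t) = (b - a) ^+ 2 / 2.
Proof.
move=> ab; have i g : continuous g -> (forall t, a < t < b -> `|g t| <= b - a) ->
    leb.-integrable `]a, b[ (EFin \o g).
  move=> cg; apply: integrable_bounded_oo; apply: measurable_funTS.
  exact: continuous_measurable_fun.
have i1 : leb.-integrable `]a, b[ (EFin \o (fun t : R => t - a)).
  apply: i; first by move=> t; apply: cvgB; [exact: cvg_id|exact: cvg_cst].
  by move=> t /andP[ha hb]; rewrite ger0_norm ?subr_ge0 ?(ltW ha)// lerB// ltW.
have i2 : leb.-integrable `]a, b[ (EFin \o (fun t : R => b - t)).
  apply: i; first by move=> t; apply: cvgB; [exact: cvg_cst|exact: cvg_id].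
  by move=> t /andP[ha hb]; rewrite ger0_norm ?subr_ge0 ?(ltW hb)// lerB// ltW.
have mab : measurable (`]a, b[%classic : set (measurableTypeR R)) by [].
have E : \int[leb]_(t in `]a, b[) (t - a + (b - t)) = (b - a) * (b - a).
  by apply: Rintegral_eq_cst => // t _; rewrite addrC subrKA.
have := RintegralD mab i1 i2; rewrite E (Rintegral_linear_left ab).
move: (\int[leb]_(x in `]a, b[) (b - x)) => X; lra.
Qed.

End interval_integrals.

Section time_increments.
Context (R : realType).
Local Notation leb := (@lebesgue_measure R).
Local Notation RR := (measurableTypeR R * measurableTypeR R)%type.
Variables (b h : R).
Hypotheses (b0 : 0 <= b) (h0 : 0 < h).

Let W : set (measurableTypeR R) := `]- h, (b + h)[%classic.
Let mW : measurable W. Proof. exact: measurable_itv. Qed.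
Let fW : (leb W < +oo)%E. Proof. exact: itv_oo_lty. Qed.
Let II : set (measurableTypeR R) := `]0, (b + h)[%classic.
Let mI : measurable II. Proof. exact: measurable_itv. Qed.

(** The integral telescopes: the increments of a function that is constant outside [0, b]
    only leave the two end values. *)
Lemma Rintegral_increment (Phi : R -> R) (p0 pb : R) :
  leb.-integrable `]- h, (b + h)[ (EFin \o Phi) ->
  (forall t, t <= 0 -> Phi t = p0) -> (forall t, b <= t -> Phi t = pb) ->
  leb.-integrable `]0, (b + h)[ (fun t => (Phi t - Phi (t - h))%:E) /\
  \int[leb]_(t in `]0, (b + h)[) (Phi t - Phi (t - h)) = h * (pb - p0).
Proof.
move=> iP P0 Pb.
have iP1 : leb.-integrable `]0, (b + h)[ (EFin \o Phi).
  by apply: (integrable_sub_itv _ _ iP) => //; rewrite oppr_le0 ltW.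
have iP2 : leb.-integrable `](- h), b[ (EFin \o Phi).
  by apply: (integrable_sub_itv _ _ iP) => //; rewrite lerDl ltW.
have [iP3 E3] := @Rintegral_shift R (- h) b h Phi iP2.
rewrite addNr in iP3 E3.
split; first by have := integrableB mI iP1 iP3; apply: eq_integrable.
rewrite (RintegralB mI iP1 iP3) E3.
have a1 : - h <= 0 by rewrite oppr_le0 ltW.
have a2 : 0 <= b + h by rewrite addr_ge0// ltW.
have a3 : - h <= b by exact: le_trans b0.
have a4 : b <= b + h by rewrite lerDl ltW.
have s1 := Rintegral_split a1 a2 iP; have s2 := Rintegral_split a3 a4 iP.
have e1 : \int[leb]_(t in `](- h), 0[) Phi t = p0 * h.
  rewrite (@Rintegral_eq_cst R _ _ _ p0) ?sub0r ?opprK ?oppr_le0 ?(ltW h0)//.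
  by move=> t /andP[_ /ltW]; exact: P0.
have e2 : \int[leb]_(t in `]b, (b + h)[) Phi t = pb * h.
  rewrite (@Rintegral_eq_cst R _ _ _ pb) ?lerDl ?(ltW h0)//; first by rewrite addrC addKr.
  by move=> t /andP[/ltW + _]; exact: Pb.
rewrite e1 in s1; rewrite e2 in s2.
have := etrans (esym s1) s2; clear.
move: (\int[leb]_(t in `]0, (b + h)[) Phi t) (\int[leb]_(t in `](- h), b[) Phi t) => X Y.
by move=> E; lra.
Qed.

Section strip.
Variables (K : R -> R -> R) (M A0 Ab : R).
Hypotheses (mK : measurable_fun (setT : set RR) (fun z => K z.1 z.2))
  (KC : forall s t, K s t = K t s) (KM : forall s t, `|K s t| <= M)
  (K0 : forall s t, s <= 0 -> t <= 0 -> K s t = A0)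
  (Kb : forall s t, b <= s -> b <= t -> K s t = Ab).

(* k1 and k2 cut K to the parts t - h < tau < t and t < tau < t + h of the strip, in the
   order that makes their first marginals I1 and I2 the two halves of cross_increment. *)
Let k1 (z : RR) : R := if z.1 - h < z.2 then if z.2 < z.1 then
  if 0 < z.1 then K z.2 z.1 else 0 else 0 else 0.
Let k2 (z : RR) : R := if z.1 < z.2 then if z.2 < z.1 + h then
  if z.1 < b then K z.2 z.1 else 0 else 0 else 0.

Let mK' : measurable_fun (setT : set RR) (fun z => K z.2 z.1).
Proof.
by under eq_fun do rewrite KC; exact: mK.
Qed.

Let mk1 : measurable_fun setT k1.
Proof.
do 3! (apply: measurable_fun_ifT => //; first by
  apply: measurable_fun_ltr => //; apply: measurable_funB).
Qed.

Let mk2 : measurable_fun setT k2.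
Proof.
do 3! (apply: measurable_fun_ifT => //; first by
  apply: measurable_fun_ltr => //; apply: measurable_funD).
Qed.

Let M0 : 0 <= M. Proof. exact: le_trans (KM 0 0). Qed.

Let k1M z : `|k1 z| <= M.
Proof. by rewrite /k1; do 3! (case: ifP => _; rewrite ?normr0//). Qed.

Let k2M z : `|k2 z| <= M.
Proof. by rewrite /k2; do 3! (case: ifP => _; rewrite ?normr0//). Qed.

Let ik1 : (leb \x leb)%E.-integrable (W `*` W) (EFin \o k1).
Proof. by apply: (@fubini_bounded _ _ _ _ R leb leb W W k1 M) => //; exact: measurable_funTS. Qed.

Let ik2 : (leb \x leb)%E.-integrable (W `*` W) (EFin \o k2).
Proof. by apply: (@fubini_bounded _ _ _ _ R leb leb W W k2 M) => //; exact: measurable_funTS. Qed.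

Let I1 t := \int[leb]_(tau in W) k1 (t, tau).
Let I2 t := \int[leb]_(tau in W) k2 (t, tau).

Let iI1 : leb.-integrable W (EFin \o I1).
Proof. by have [] := fubini_real mW mW ik1. Qed.

Let iI2 : leb.-integrable W (EFin \o I2).
Proof. by have [] := fubini_real mW mW ik2. Qed.

Let I1E t : 0 < t -> t < b + h -> I1 t = \int[leb]_(tau in `](t - h), t[) K tau t.
Proof.
move=> t0 tb; rewrite /I1 [LHS]Rintegral_mkcond [RHS]Rintegral_mkcond.
apply: eq_Rintegral => s _; rewrite !patchE !mem_setE !in_itv/= /k1/= t0.
case: (ltP (t - h) s) => hs /=; last by rewrite if_same.
case: (ltP s t) => st /=; last by rewrite if_same.
by rewrite (lt_trans st tb) andbT ifT//; move: hs t0; lra.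
Qed.

Let I1_0 t : t <= 0 -> I1 t = 0.
Proof.
move=> t0; rewrite /I1; transitivity (\int[leb]_(tau in W) (0 : R)).
  by apply: eq_Rintegral => s _; rewrite /k1/= (ltNge 0 t) t0/= !if_same.
by rewrite (Rintegral_cst _ mW) mul0r.
Qed.

Let I2E t : - h < t -> t < b -> I2 t = \int[leb]_(tau in `]t, (t + h)[) K tau t.
Proof.
move=> t0 tb; rewrite /I2 [LHS]Rintegral_mkcond [RHS]Rintegral_mkcond.
apply: eq_Rintegral => s _; rewrite !patchE !mem_setE !in_itv/= /k2/= tb.
case: (ltP t s) => hs /=; last by rewrite if_same.
case: (ltP s (t + h)) => st /=; last by rewrite if_same.
by rewrite (lt_trans t0 hs)/= ifT//; move: st tb; lra.
Qed.

Let I2_b t : b <= t -> I2 t = 0.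
Proof.
move=> t0; rewrite /I2; transitivity (\int[leb]_(tau in W) (0 : R)).
  by apply: eq_Rintegral => s _; rewrite /k2/= (ltNge t b) t0/= !if_same.
by rewrite (Rintegral_cst _ mW) mul0r.
Qed.

Let Wsplit f : leb.-integrable W (EFin \o f) ->
  \int[leb]_(t in W) f t = \int[leb]_(t in `](- h), 0[) f t +
    (\int[leb]_(t in `]0, b[) f t + \int[leb]_(t in `]b, (b + h)[) f t).
Proof.
move=> iF; have a1 : - h <= 0 by rewrite oppr_le0 ltW.
have a2 : 0 <= b + h by rewrite addr_ge0// ltW.
rewrite /W (Rintegral_split a1 a2 iF); congr (_ + _); apply: Rintegral_split => //.
  by rewrite lerDl ltW.
exact: (integrable_sub_itv _ _ iF).
Qed.

Definition cross_increment t :=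
  \int[leb]_(tau in `](t - h), t[) (K tau t - K tau (t - h)).

Let secK (t a c : R) : leb.-integrable `]a, c[ (EFin \o (fun tau => K tau t)).
Proof.
apply: (integrable_bounded_oo (C := M)) => //; apply: measurable_funTS.
exact: (measurableT_comp mK (measurable_pair2 t)).
Qed.

Let crossE t : 0 < t -> t < b + h -> cross_increment t = I1 t - I2 (t - h).
Proof.
move=> t0 tb; have mt : measurable (`](t - h), t[%classic : set (measurableTypeR R)) by [].
rewrite /cross_increment (RintegralB mt (secK _ _ _) (secK _ _ _)).
rewrite I1E// I2E ?subrK//; first by rewrite ltrBrDr addNr.
by rewrite ltrBlDr.
Qed.

Let shI2 : leb.-integrable `]0, (b + h)[ (fun t => (I2 (t - h))%:E) /\
  \int[leb]_(t in `]0, (b + h)[) I2 (t - h) = \int[leb]_(t in `](- h), b[) I2 t.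
Proof.
have i2 : leb.-integrable `](- h), b[ (EFin \o I2).
  by apply: (integrable_sub_itv _ _ iI2) => //; rewrite lerDl ltW.
by have := @Rintegral_shift R (- h) b h I2 i2; rewrite addNr.
Qed.

Let iI1' : leb.-integrable `]0, (b + h)[ (EFin \o I1).
Proof. by apply: (integrable_sub_itv _ _ iI1) => //; rewrite oppr_le0 ltW. Qed.

Lemma cross_increment_integrable :
  leb.-integrable `]0, (b + h)[ (EFin \o cross_increment).
Proof.
have [i2 _] := shI2; have := integrableB mI iI1' i2.
apply: eq_integrable => // t; rewrite inE /II /= in_itv/= => /andP[t0 tb].
by rewrite crossE.
Qed.

Let W0 : \int[leb]_(t in W) I1 t = \int[leb]_(t in `]0, (b + h)[) I1 t.
Proof.
have a1 : - h <= 0 by rewrite oppr_le0 ltW.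
have a2 : 0 <= b + h by rewrite addr_ge0// ltW.
rewrite /W (Rintegral_split a1 a2 iI1) (@Rintegral_eq_cst R _ _ _ 0)// ?mul0r ?add0r//.
by move=> t /andP[_ /ltW]; exact: I1_0.
Qed.

Let Wb : \int[leb]_(t in W) I2 t = \int[leb]_(t in `](- h), b[) I2 t.
Proof.
have a1 : - h <= b by move: b0 h0; lra.
have a2 : b <= b + h by rewrite lerDl ltW.
have e : \int[leb]_(t in `]b, (b + h)[) I2 t = 0 * (b + h - b).
  by apply: Rintegral_eq_cst a2 _ => t /andP[/ltW + _]; exact: I2_b.
by have := Rintegral_split a1 a2 iI2; rewrite e mul0r addr0.
Qed.

Let J1 s := \int[leb]_(tau in W) k1 (tau, s).

Let iJ1 : leb.-integrable W (EFin \o J1).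
Proof. by have [] := fubini_real mW mW ik1. Qed.

Let sec1 s : leb.-integrable W (EFin \o (fun tau => k1 (tau, s))).
Proof.
apply: (integrable_bounded_oo (C := M)); first apply: measurable_funTS.
  exact: (measurableT_comp mk1 (measurable_pair2 s)).
by move=> t _; exact: k1M.
Qed.

Let sec2 s : leb.-integrable W (EFin \o (fun tau => k2 (s, tau))).
Proof.
apply: (integrable_bounded_oo (C := M)); first apply: measurable_funTS.
  exact: (measurableT_comp mk2 (measurable_pair1 s)).
by move=> t _; exact: k2M.
Qed.

Let Dlow s : - h < s < 0 -> J1 s - I2 s = A0 * s.
Proof.
move=> /andP[hs s0]; rewrite /J1 /I2 -(RintegralB mW (sec1 s) (sec2 s)).
have sb : s < b by exact: lt_le_trans s0 b0.
pose g tau := k1 (tau, s) - k2 (s, tau).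
have ig : leb.-integrable W (EFin \o g).
  by have := integrableB mW (sec1 s) (sec2 s); apply: eq_integrable.
have gE t : g t = if s < t then (if t < s + h then (if 0 < t then K s t else 0) - K t s else 0)
    else 0.
  rewrite /g /k1 /k2/= sb ltrBlDr; case: (ltP s t) => st; last by rewrite if_same subrr.
  by case: ifP; rewrite ?subrr.
have g0 t : 0 < t -> g t = 0.
  by move=> t0; rewrite gE t0 KC subrr !if_same.
have gs t : t < s -> g t = 0 by move=> ts; rewrite gE ltNge (ltW ts).
have gst t : s < t < 0 -> g t = - A0.
  move=> /andP[st t0]; rewrite gE st (ltNge 0 t) (ltW t0)/= sub0r K0 ?(ltW s0) ?(ltW t0)//.
  by rewrite ifT// (lt_trans t0)//; move: hs; lra.
rewrite -[LHS]/(\int[leb]_(t in W) g t) (Wsplit ig).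
have i0 : leb.-integrable `](- h), 0[ (EFin \o g).
  by apply: (integrable_sub_itv _ _ ig) => //; rewrite addr_ge0// ltW.
rewrite (Rintegral_split (ltW hs) (ltW s0) i0).
have -> : \int[leb]_(t in `](- h), s[) g t = 0.
  by rewrite (@Rintegral_eq_cst R _ _ _ 0) ?mul0r ?(ltW hs)// => t /andP[_ /gs].
have -> : \int[leb]_(t in `]s, 0[) g t = - A0 * (0 - s).
  by rewrite (@Rintegral_eq_cst R _ _ _ (- A0)) ?(ltW s0).
have -> : \int[leb]_(t in `]0, b[) g t = 0.
  by rewrite (@Rintegral_eq_cst R _ _ _ 0) ?mul0r// => t /andP[/g0].
have -> : \int[leb]_(t in `]b, (b + h)[) g t = 0.
  rewrite (@Rintegral_eq_cst R _ _ _ 0) ?mul0r ?lerDl ?(ltW h0)// => t /andP[bt _].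
  by apply: g0; exact: le_lt_trans bt.
by rewrite sub0r mulrNN !addr0 add0r.
Qed.

Let Dmid s : 0 < s < b -> J1 s - I2 s = 0.
Proof.
move=> /andP[s0 sb]; rewrite /J1 /I2 -(RintegralB mW (sec1 s) (sec2 s)).
transitivity (\int[leb]_(tau in W) (0 : R)); last by rewrite (Rintegral_cst _ mW) mul0r.
apply: eq_Rintegral => t _; rewrite /k1 /k2/= sb ltrBlDr.
case: (ltP s t) => st; last by rewrite if_same subrr.
by rewrite (lt_trans s0 st) KC subrr.
Qed.

Let Dhigh s : b < s < b + h -> J1 s - I2 s = Ab * (b + h - s).
Proof.
move=> /andP[bs sbh]; rewrite I2_b ?(ltW bs)// subr0.
transitivity (\int[leb]_(tau in `]s, (b + h)[) Ab); last first.
  by rewrite (@Rintegral_eq_cst R _ _ _ Ab) ?(ltW sbh).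
rewrite /J1 [LHS]Rintegral_mkcond [RHS]Rintegral_mkcond; apply: eq_Rintegral => t _.
rewrite !patchE !mem_setE !in_itv/= /k1/= ltrBlDr.
case: (ltP s t) => st /=; last by rewrite !if_same.
have t0 : 0 < t by apply: lt_trans st; exact: le_lt_trans b0 bs.
rewrite t0 (_ : - h < t) /=; last by move: t0 h0; lra.
case: (ltP t (b + h)) => // tbh; rewrite ifT; last by move: bs tbh; lra.
by rewrite Kb// ltW// (lt_trans bs).
Qed.

Let Ilow : \int[leb]_(t in `](- h), 0[) (J1 t - I2 t) = - A0 * (h ^+ 2 / 2).
Proof.
transitivity (\int[leb]_(t in `](- h), 0[) (- A0 * (0 - t))).
  apply: eq_Rintegral => t; rewrite inE/= in_itv/= => /Dlow ->.
  by rewrite sub0r mulrNN.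
have mh : measurable (`](- h), 0[%classic : set (measurableTypeR R)) by [].
rewrite (RintegralZl _ mh).
  by rewrite Rintegral_linear_right ?oppr_le0 ?(ltW h0)// sub0r opprK.
apply: (integrable_bounded_oo (C := h)); first exact: measurable_funB.
by move=> t /andP[ht t0]; rewrite sub0r normrN ltr0_norm// lerNl ltW.
Qed.

Let Ihigh : \int[leb]_(t in `]b, (b + h)[) (J1 t - I2 t) = Ab * (h ^+ 2 / 2).
Proof.
transitivity (\int[leb]_(t in `]b, (b + h)[) (Ab * (b + h - t))).
  by apply: eq_Rintegral => t; rewrite inE/= in_itv/= => /Dhigh ->.
have mh : measurable (`]b, (b + h)[%classic : set (measurableTypeR R)) by [].
rewrite (RintegralZl _ mh).
  by rewrite Rintegral_linear_right ?lerDl ?(ltW h0)// addrAC subrr add0r.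
apply: (integrable_bounded_oo (C := h)); first exact: measurable_funB.
move=> t /andP[bt tb]; rewrite ger0_norm ?subr_ge0 ?(ltW tb)//.
by rewrite lerBlDr addrC lerD2l ltW.
Qed.

Let Imid : \int[leb]_(t in `]0, b[) (J1 t - I2 t) = 0.
Proof. by rewrite (@Rintegral_eq_cst R _ _ _ 0 b0) ?mul0r// => t; exact: Dmid. Qed.

Let I1J1 : \int[leb]_(t in W) I1 t = \int[leb]_(t in W) J1 t.
Proof. by have [_ _ _] := fubini_real mW mW ik1. Qed.

(** By Fubini the integral of I1 is that of J1, the marginal of k1 in the other variable.
    By symmetry of K, J1 and I2 agree on [0, b]; on the end intervals [-h, 0] and
    [b, b + h], where K is constant, they differ by a linear function, whence the two
    triangles of area h ^ 2 / 2. *)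
Lemma Rintegral_cross_increment :
  \int[leb]_(t in `]0, (b + h)[) cross_increment t = h ^+ 2 / 2 * (Ab - A0).
Proof.
transitivity (\int[leb]_(t in `]0, (b + h)[) (I1 t - I2 (t - h))).
  by apply: eq_Rintegral => t; rewrite inE/= in_itv/= => /andP[t0 tb]; exact: crossE.
have [i2 E2] := shI2.
rewrite (RintegralB mI iI1' i2) E2 -W0 -Wb I1J1; clear E2 i2.
rewrite -(RintegralB mW iJ1 iI2).
have iD : leb.-integrable W (EFin \o (fun t => J1 t - I2 t)).
  by have := integrableB mW iJ1 iI2; apply: eq_integrable.
rewrite (Wsplit iD) Ilow Imid Ihigh; clear.
by move: (h ^+ 2) => H; rewrite add0r mulNr mulrBr addrC (mulrC A0) (mulrC Ab).
Qed.

End strip.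
End time_increments.

(** * Pairings with powers of functions in X *)
Section power_pairings.
Context (R : realType) (n : nat) (Omega : set 'rV[R]_n.+3).
Hypotheses (oO : open Omega) (bO : bounded_set Omega).
Local Notation N := n.+3.
Local Notation mu := (lebesgue_rV R N).
Local Notation q := (N%:R / (N%:R - 2) : R).
Local Notation y v := (abspow v q).
Local Notation P v := (abspow v (2 * q - 1)).
Implicit Types (v w m : 'rV[R]_N -> R).

Let mO : measurable Omega. Proof. exact: open_measurable_rV. Qed.
Let fO : (mu Omega < +oo)%E. Proof. exact: bounded_lty. Qed.

Let q1 : 1 < q.
Proof.
have N3 : 3 <= N%:R :> R by rewrite ler_nat.
rewrite ltr_pdivlMr; move: N3; move: (N%:R : R) => t t3; lra.
Qed.

Lemma H10_sqint_abspow v : H10 Omega v -> sqint mu Omega (y v).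
Proof. by move=> Hv; have [] := sobolev oO bO Hv. Qed.

Let mH v : H10 Omega v -> measurable_fun Omega v.
Proof. by move=> Hv; have [] := H1_sq oO (H10_H1 Hv). Qed.

Let mpow v r : H10 Omega v -> measurable_fun Omega (abspow v r).
Proof. by move=> /mH mv; apply: measurable_fun_powR; exact: measurableT_comp. Qed.

Lemma abspow_sqr v x : y v x ^+ 2 = `|v x| `^ (2 * q).
Proof. by rewrite /abspow -powR_mulrn ?powR_ge0// -powRrM [q * 2]mulrC. Qed.

Lemma power_pairing_integrable v w : H10 Omega v -> H10 Omega w ->
  mu.-integrable Omega (EFin \o (fun x => P v x * w x)).
Proof.
move=> Hv Hw; have iv := sqint_integrable_sqr (H10_sqint_abspow Hv).
have iw := sqint_integrable_sqr (H10_sqint_abspow Hw).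
apply: (le_integrable mO _ _ (integrableD mO iv iw)).
  by apply/measurable_EFinP; apply: measurable_funM; [exact: mpow|exact: mH].
move=> x _ /=; rewrite !abspow_sqr lee_fin [leRHS]ger0_norm ?addr_ge0 ?powR_ge0//.
rewrite normrM (ger0_norm (powR_ge0 _ _)) /abspow.
have q20 : 0 < 2 * q by move: q1; lra.
have q21 : 0 <= 2 * q - 1 by move: q1; lra.
have a0 := normr_ge0 (v x); have c0 := normr_ge0 (w x).
move: (`|v x|) (`|w x|) a0 c0 => a c a0 c0.
have [ca|/ltW ac] := leP c a.
  apply: (@le_trans _ _ (a `^ (2 * q))); last by rewrite lerDl powR_ge0.
  by rewrite (powRS a0 q20) ler_wpM2l ?powR_ge0.
apply: (@le_trans _ _ (c `^ (2 * q))); last by rewrite lerDr powR_ge0.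
by rewrite (powRS c0 q20) ler_wpM2r// powR_ge0_le.
Qed.

Definition nonneg_on v := \forall x \ae mu, Omega x -> 0 <= v x.

(** (|w| ^ p - |v| ^ p) (w - v) >= 0 pointwise, integrated. *)
Lemma power_pairing_monotone v w : H10 Omega v -> H10 Omega w -> nonneg_on v -> nonneg_on w ->
  ip mu Omega (P w) v - ip mu Omega (P v) v <= ip mu Omega (P w) w - ip mu Omega (P v) w.
Proof.
move=> Hv Hw v0 w0.
have i1 := power_pairing_integrable Hw Hv; have i2 := power_pairing_integrable Hv Hv.
have i3 := power_pairing_integrable Hw Hw; have i4 := power_pairing_integrable Hv Hw.
rewrite /ip -(RintegralB mO i1 i2) -(RintegralB mO i3 i4).
apply: ae_le_Rintegral => //.
- by have := integrableB mO i1 i2; apply: eq_integrable.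
- by have := integrableB mO i3 i4; apply: eq_integrable.
apply: filterS2 v0 w0 => x vx wx Ox; have {}vx := vx Ox; have {}wx := wx Ox.
rewrite /abspow !ger0_norm//; have q21 : 0 <= 2 * q - 1 by move: q1; lra.
move: (v x) (w x) vx wx => a c a0 c0; rewrite -subr_ge0.
have [ac|/ltW ca] := leP a c.
  have := powR_ge0_le q21 a0 ac; move: (a `^ _) (c `^ _) => X Y XY; nra.
have := powR_ge0_le q21 c0 ca; move: (a `^ _) (c `^ _) => X Y XY; nra.
Qed.

Local Notation dy v w := (fun x => y w x - y v x).

Let sdy v w : H10 Omega v -> H10 Omega w -> sqint mu Omega (dy v w).
Proof. by move=> Hv Hw; apply: sqintB => //; exact: H10_sqint_abspow. Qed.

Lemma power_pairing_increment v w m : H10 Omega v -> H10 Omega w -> H10 Omega m ->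
  nonneg_on v -> nonneg_on w -> nonneg_on m ->
  ip mu Omega (P m) w - ip mu Omega (P m) v <=
  (ip mu Omega (y w) (y w) - ip mu Omega (y v) (y v)) / (2 * q) +
  (3 * ip mu Omega (dy v m) (dy v m) + ip mu Omega (dy v w) (dy v w)).
Proof.
move=> Hv Hw Hm v0 w0 m0.
have i1 := power_pairing_integrable Hm Hw; have i2 := power_pairing_integrable Hm Hv.
have sq v' (s : sqint mu Omega v') : mu.-integrable Omega (EFin \o (fun x => v' x * v' x)).
  exact: sqint_integrable.
have j1 := sq _ (H10_sqint_abspow Hw); have j2 := sq _ (H10_sqint_abspow Hv).
have j3 := sq _ (sdy Hv Hm); have j4 := sq _ (sdy Hv Hw).
have j12 : mu.-integrable Omega (EFin \o (fun x => y w x * y w x - y v x * y v x)).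
  by have := integrableB mO j1 j2; apply: eq_integrable.
have j12' : mu.-integrable Omega (EFin \o (fun x => (2 * q)^-1 * (y w x * y w x - y v x * y v x))).
  by have := integrableZl mO (2 * q)^-1 j12; apply: eq_integrable.
have j3' : mu.-integrable Omega (EFin \o (fun x => 3 * (dy v m x * dy v m x))).
  by have := integrableZl mO 3 j3; apply: eq_integrable.
have j34 : mu.-integrable Omega (EFin \o (fun x => 3 * (dy v m x * dy v m x) + dy v w x * dy v w x)).
  by have := integrableD mO j3' j4; apply: eq_integrable.
rewrite /ip -(RintegralB mO i1 i2) -(RintegralB mO j1 j2) [X in _ <= X + _]mulrC.
rewrite -(RintegralZl _ mO j12) -(RintegralZl _ mO j3) -(RintegralD mO j3' j4).
rewrite -(RintegralD mO j12' j34).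
apply: ae_le_Rintegral => //.
- by have := integrableB mO i1 i2; apply: eq_integrable.
- by have := integrableD mO j12' j34; apply: eq_integrable.
apply: filterS3 v0 w0 m0 => x vx wx mx Ox.
have {}vx := vx Ox; have {}wx := wx Ox; have {}mx := mx Ox.
rewrite -!expr2 !abspow_sqr /abspow !(ger0_norm vx) !(ger0_norm wx) !(ger0_norm mx).
have := conj_increment_le q1 vx wx mx; rewrite mulrBr [leRHS]addrC mulrC.
by rewrite [leRHS]addrC [X in _ <= X + _]mulrC.
Qed.

(** Where |w - v| ^ 2 exceeds e it is at most e ^ (1 - q) |w - v| ^ (2 q), and
    |w - v| ^ q is at most the increment of the q-th powers. *)
Lemma sqr_dist_le v w (e : R) : H10 Omega v -> H10 Omega w -> nonneg_on v -> nonneg_on w ->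
  0 < e -> ip mu Omega (fun x => w x - v x) (fun x => w x - v x) <=
  e * fine (mu Omega) + e `^ (1 - q) * ip mu Omega (dy v w) (dy v w).
Proof.
move=> Hv Hw v0 w0 e0.
have sd : sqint mu Omega (fun x => w x - v x).
  by apply: sqintB => //; apply: (H1_sq oO); exact: H10_H1.
have i1 := sqint_integrable mO sd sd.
have i2 := sqint_integrable mO (sdy Hv Hw) (sdy Hv Hw).
have ic : mu.-integrable Omega (EFin \o (fun=> e)).
  apply: measurable_bounded_integrable => //.
  by exists `|e|; split; [exact: num_real|move=> r er x _; exact: ltW].
have i2' : mu.-integrable Omega (EFin \o (fun x => e `^ (1 - q) * (dy v w x * dy v w x))).
  by have := integrableZl mO (e `^ (1 - q)) i2; apply: eq_integrable.
rewrite /ip -(Rintegral_cst mu mO) -(RintegralZl _ mO i2) -(RintegralD mO ic i2').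
apply: ae_le_Rintegral => //.
  by have := integrableD mO ic i2'; apply: eq_integrable.
apply: filterS2 v0 w0 => x vx wx Ox; have {}vx := vx Ox; have {}wx := wx Ox.
have Y := powR_young q1 ler01 (normr_ge0 (w x - v x)) e0.
rewrite !powR1 mul1r mulr1 real_normK ?num_real// in Y.
rewrite -!expr2 (le_trans Y)// lerD2l ler_wpM2l ?powR_ge0//.
have L := norm_powR_le_sub q1 vx wx.
rewrite /abspow (ger0_norm vx) (ger0_norm wx) [2 * q]mulrC powRrM powR_mulrn ?powR_ge0//.
by rewrite -[leRHS](real_normK (num_real _)) lerXn2r ?nnegrE ?powR_ge0.
Qed.

Lemma power_norm_sub v w : H10 Omega v -> H10 Omega w ->
  ip mu Omega (y v) (y v) - ip mu Omega (y w) (y w) <=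
  2 * (Num.sqrt (ip mu Omega (y v) (y v)) * Num.sqrt (ip mu Omega (dy v w) (dy v w))).
Proof.
move=> Hv Hw; have sv := H10_sqint_abspow Hv; have sw := H10_sqint_abspow Hw.
have sd := sdy Hv Hw.
have -> : ip mu Omega (y w) (y w) = ip mu Omega (y v) (y v) + 2 * ip mu Omega (y v) (dy v w) +
    ip mu Omega (dy v w) (dy v w).
  rewrite (ipBl mO sw sv sd) (ipBr mO sw sv sw) (ipBr mO sw sv sv) (ipC _ _ (y w) (y v)).
  move: (ip mu Omega (y v) (y v)) (ip mu Omega (y v) (y w)) (ip mu Omega (y w) (y w)).
  by move=> a1 a2 a3; ring.
have := cauchy_schwarz mO sv sd; have := ip_ge0 mu Omega (dy v w).
move: (ip _ _ (y v) (dy v w)) (ip _ _ (dy v w) (dy v w)) => X Y Y0.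
move: (Num.sqrt _ * Num.sqrt Y) => Z; rewrite ler_norml => /andP[h _]; lra.
Qed.

Lemma sqrt_norm_triangle v w : H10 Omega v -> H10 Omega w ->
  Num.sqrt (ip mu Omega (y w) (y w)) <=
  Num.sqrt (ip mu Omega (y v) (y v)) + Num.sqrt (ip mu Omega (dy v w) (dy v w)).
Proof.
move=> Hv Hw; have sv := H10_sqint_abspow Hv; have sd := sdy Hv Hw.
have B0 := ip_ge0 mu Omega (y v); have D0 := ip_ge0 mu Omega (dy v w).
have cs := cauchy_schwarz mO sv sd.
rewrite -[leRHS]sqrtr_sqr_nneg ?addr_ge0 ?sqrtr_ge0// ler_wsqrtr//.
have -> : ip mu Omega (y w) (y w) = ip mu Omega (y v) (y v) + 2 * ip mu Omega (y v) (dy v w) +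
    ip mu Omega (dy v w) (dy v w).
  have sw := H10_sqint_abspow Hw.
  rewrite (ipBl mO sw sv sd) (ipBr mO sw sv sw) (ipBr mO sw sv sv) (ipC _ _ (y w) (y v)).
  move: (ip mu Omega (y v) (y v)) (ip mu Omega (y v) (y w)) (ip mu Omega (y w) (y w)).
  by move=> a1 a2 a3; ring.
rewrite sqrrD !sqr_sqrtr// lerD2r lerD2l [leRHS]mulr2n.
by rewrite mulr_natl mulr2n lerD// (le_trans (ler_norm _) cs).
Qed.

End power_pairings.

(** * The energy inequality *)
Lemma energy_conclusion (R : realFieldType) (Ab A0 Bb B0 d hG e : R) : hG <= e / 2 ->
  (Ab - A0) / 2 <= (Bb - B0) / d + hG + 4 * (e / 8) ->
  2^-1 * Ab - d^-1 * Bb <= 2^-1 * A0 - d^-1 * B0 + e.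
Proof.
rewrite ![d^-1 * _]mulrC ![2^-1 * _]mulrC (mulrBl _ Bb); move: (Bb / d) (B0 / d) => x y; lra.
Qed.

(** Continuity of the squared norm, with an explicit modulus. *)
Lemma sqr_norm_close (R : rcfType) (a b D dl : R) : 0 <= a -> 0 <= b -> 0 <= D -> 0 < dl ->
  D <= (dl / (2 * (Num.sqrt a + 1))) ^+ 2 -> D <= 1 ->
  a - b <= 2 * (Num.sqrt a * Num.sqrt D) -> b - a <= 2 * (Num.sqrt b * Num.sqrt D) ->
  Num.sqrt b <= Num.sqrt a + Num.sqrt D -> `|b - a| <= dl.
Proof.
move=> a0 b0 D0 dl0; have := sqrtr_ge0 a; have := sqrtr_ge0 b; have := sqrtr_ge0 D.
set m := 2 * (Num.sqrt a + 1) => d0 y0 x0 Dm D1.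
have m0 : 0 < m by rewrite /m; lra.
have dm : Num.sqrt D <= dl / m.
  rewrite -[leRHS]sqrtr_sqr_nneg ?divr_ge0 ?(ltW dl0) ?(ltW m0)//.
  by rewrite ler_wsqrtr.
have d1 : Num.sqrt D <= 1 by rewrite -sqrtr1 ler_wsqrtr.
have {}dm : Num.sqrt D * m <= dl by rewrite -ler_pdivlMr.
move: dm; rewrite /m ler_norml => {Dm D1 m m0}.
by move: (Num.sqrt a) (Num.sqrt b) (Num.sqrt D) d0 y0 x0 d1 => x y d *; apply/andP; split; nra.
Qed.

Lemma half_sum_le (R : realFieldType) (w m c D : R) : 0 <= m -> 0 <= c -> 0 < w -> 0 <= D ->
  D <= w / (2 * (c + 1)) -> w / (2 * (m + 1)) * m + c * D <= w.
Proof.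
move=> m0 c0 w0 D0 Dw.
have h1 : w / (2 * (m + 1)) * m <= w / 2.
  rewrite mulrAC ler_pdivrMr; last by lra.
  rewrite (_ : w / 2 * (2 * (m + 1)) = w * (m + 1)); last by field.
  by rewrite ler_wpM2l; lra.
have h2 : c * D <= w / 2.
  apply: (@le_trans _ _ ((c + 1) * (w / (2 * (c + 1))))).
    by apply: ler_pM => //; lra.
  by rewrite le_eqVlt; apply/orP; left; apply/eqP; field; lra.
lra.
Qed.

Lemma linear_difference_le (R : realFieldType) (a1 a2 a3 a4 k1 k2 j1 j2 Z : R) :
  a1 - a2 = j1 - k1 -> a3 - a4 = j2 - k2 ->
  a3 - a4 <= a1 - a2 -> j1 - j2 <= Z -> k1 - k2 <= Z.
Proof. lra. Qed.

Section energy_inequality.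
Context (R : realType) (n : nat) (Omega : set 'rV[R]_n.+3).
Hypotheses (oO : open Omega) (bO : bounded_set Omega).
Local Notation N := n.+3.
Local Notation mu := (lebesgue_rV R N).
Local Notation leb := (@lebesgue_measure R).
Local Notation q := (N%:R / (N%:R - 2) : R).
Local Notation y v := (abspow v q).
Local Notation P v := (abspow v (2 * q - 1)).
Local Notation gp := (grad_pair Omega).

Let fO : (mu Omega < +oo)%E. Proof. by apply: bounded_lty => //; exact: open_measurable_rV. Qed.

Variables (v : R -> 'rV[R]_N -> R) (G : set (measurableTypeR R)) (T M : R) (gam : R -> R).
Let B t := ip mu Omega (y (v t)) (y (v t)).
Let dist s t := ip mu Omega (fun x => y (v t) x - y (v s) x) (fun x => y (v t) x - y (v s) x).
Let G0 t := t = 0 \/ G t.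

(* G is a conull set of times at which the integrated equation holds; gam is the modulus of
   the q-th power of the curve v in L^2. *)
Hypotheses (GW : G `<=` `]0, T[%classic)
  (aeG : \forall t \ae leb, 0 < t < T -> G t)
  (Hv : forall t, H10 Omega (v t)) (HM : forall t, A_fun Omega (v t) <= M)
  (vnn : forall t, nonneg_on Omega (v t)) (smv : strongly_measurable Omega v)
  (ndg : forall s t, s <= t -> gam s <= gam t)
  (hold : forall s t, G0 s -> G0 t -> s <= t -> dist s t <= (t - s) * (gam t - gam s))
  (eqn : forall w s t, H10 Omega w -> G0 s -> G0 t -> s <= t ->
     ip mu Omega (P (v t)) w - ip mu Omega (P (v s)) w =
     \int[leb]_(tau in `]s, t[) (ip mu Omega (P (v tau)) w - gp (v tau) w))
  (intP : forall w, H10 Omega w ->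
     leb.-integrable `]0, T[ (fun t => (ip mu Omega (P (v t)) w)%:E))
  (mB : measurable_fun (`]0, T[%classic : set (measurableTypeR R)) B).

Let K s t := gp (v s) (v t).

Let mK : measurable_fun (setT : set (measurableTypeR R * measurableTypeR R))
  (fun z => K z.1 z.2).
Proof. by apply: grad_pair_measurable => // t; exact: H10_H1. Qed.

Let G0T t : G0 t -> 0 <= t <= Num.max T 0.
Proof.
case=> [->|/GW]; first by rewrite lexx le_max lexx orbT.
by rewrite /= in_itv/= => /andP[/ltW -> /ltW tT]; rewrite le_max tT.
Qed.

Let KM s t : `|K s t| <= `|M|.
Proof.
apply: le_trans (grad_pair_le oO fO (H10_H1 (Hv s)) (H10_H1 (Hv t))) _.
have b r : norm_X Omega (v r) <= Num.sqrt `|M|.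
  by rewrite ler_wsqrtr// (le_trans (HM r))// ler_norm.
apply: (@le_trans _ _ (Num.sqrt `|M| * Num.sqrt `|M|)).
  by apply: ler_pM; rewrite ?sqrtr_ge0.
by rewrite -expr2 sqr_sqrtr.
Qed.

Let iK s t w : leb.-integrable `]s, t[ (EFin \o (fun tau => K tau w)).
Proof.
apply: (integrable_bounded_oo (C := `|M|)) => //; apply: measurable_funTS.
exact: (measurableT_comp mK (measurable_pair2 w)).
Qed.

(** The equation from s to t tested with v t - v s.  The left side is nonnegative by
    monotonicity of the power, and leaves an upper bound for the gradient term; the other
    term is bounded pointwise in tau. *)
Let increment s t : G0 s -> G0 t -> s <= t ->
  \int[leb]_(tau in `]s, t[) (K tau t - K tau s) <=
  (t - s) * ((B t - B s) / (2 * q) + 4 * ((t - s) * (gam t - gam s))).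
Proof.
move=> Gs Gt st; have mst : measurable (`]s, t[%classic : set (measurableTypeR R)) by [].
have /andP[s0 _] := G0T Gs.
have tT : t <= Num.max T 0 by case/andP : (G0T Gt).
have iP w : H10 Omega w -> leb.-integrable `]s, t[ (fun r => (ip mu Omega (P (v r)) w)%:E).
  move=> Hw; have [tT'|Tt] := leP t T; first exact: (integrable_sub_itv _ _ (intP Hw)).
  suff -> : `]s, t[%classic = set0 :> set R by apply: integrable_set0.
  apply/seteqP; split => // r /=; rewrite in_itv/= => /andP[sr rt].
  case: Gt => [t0|/GW]; first by move: (lt_trans sr rt); rewrite t0 ltNge s0.
  by rewrite /= in_itv/= (ltNge t T) (ltW Tt) andbF.
have i1 := iP _ (Hv t); have i2 := iP _ (Hv s).
rewrite (RintegralB mst (iK _ _ _) (iK _ _ _)).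
have le1 : \int[leb]_(r in `]s, t[) (ip mu Omega (P (v r)) (v t) - ip mu Omega (P (v r)) (v s)) <=
    (t - s) * ((B t - B s) / (2 * q) + 4 * ((t - s) * (gam t - gam s))).
  set c := (_ + 4 * _); rewrite [leRHS]mulrC -Rintegral_cst_itv//.
  apply: ae_le_Rintegral => //.
  - by have := integrableB mst i1 i2; apply: eq_integrable.
  - apply: (integrable_bounded_oo (C := `|c|)) => //; exact: measurable_cst.
  apply: (@filterS _ _ (ae_filter_ringOfSetsType leb) _ _ _ aeG) => r Gr; rewrite /= in_itv/= => /andP[sr rt].
  have {Gr} Gr : G0 r.
    right; apply: Gr; rewrite (le_lt_trans s0 sr)/=.
    case: Gt => [t0|/GW]; first by move: (lt_trans sr rt); rewrite t0 ltNge s0.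
    by rewrite /= in_itv/= => /andP[_]; exact: lt_trans.
  apply: le_trans (power_pairing_increment oO bO (Hv s) (Hv t) (Hv r) (vnn s) (vnn t) (vnn r)) _.
  rewrite -/(B t) -/(B s) -/(dist s r) -/(dist s t) /c lerD2l.
  have h1 := hold Gs Gr (ltW sr); have h2 := hold Gs Gt st.
  have h3 : (r - s) * (gam r - gam s) <= (t - s) * (gam t - gam s).
    apply: ler_pM; rewrite ?subr_ge0 ?(ltW sr) ?ndg ?(ltW sr)//.
      by rewrite lerB// ltW.
    by rewrite lerB// ndg// ltW.
  move: h1 h2 h3; move: (dist s r) (dist s t) (_ * _) ((t - s) * _) => X Y Z U; lra.
rewrite (RintegralB mst i1 i2) in le1.
have e1 := eqn (Hv t) Gs Gt st; have e2 := eqn (Hv s) Gs Gt st.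
have mono := power_pairing_monotone oO bO (Hv s) (Hv t) (vnn s) (vnn t).
rewrite (RintegralB mst i1 (iK _ _ _)) in e1.
rewrite (RintegralB mst i2 (iK _ _ _)) in e2.
exact: (@linear_difference_le _ _ _ _ _ _ _ _ _ _ e1 e2 mono le1).
Qed.

Let gamT t : G0 t -> gam 0 <= gam t <= gam (Num.max T 0).
Proof. by move=> /G0T/andP[t0 tT]; rewrite !ndg. Qed.

(** Along good times v is continuous in L^2, being Hoelder continuous after the q-th power;
    boundedness in X makes this weak continuity in X. *)
Let close s (dl : R) : G0 s -> 0 < dl -> exists2 r : R, 0 < r &
  forall t, G0 t -> `|t - s| < r -> `|K t s - K s s| <= dl /\ `|B t - B s| <= dl.
Proof.
move=> Gs dl0; pose Gam := gam (Num.max T 0) - gam 0 + 1.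
have T00 : 0 <= Num.max T 0 by rewrite le_max lexx orbT.
have Gam0 : 0 < Gam by rewrite ltr_wpDl// subr_ge0 ndg.
have hd t : G0 t -> dist s t <= `|t - s| * Gam.
  move=> Gt; have /andP[g1 g2] := gamT Gs; have /andP[g3 g4] := gamT Gt.
  have [st|/ltW ts] := leP s t.
    apply: le_trans (hold Gs Gt st) _; rewrite ger0_norm ?subr_ge0//.
    by rewrite ler_wpM2l ?subr_ge0// /Gam; move: g1 g4; lra.
  have -> : dist s t = dist t s by apply: eq_Rintegral => x _; ring.
  apply: le_trans (hold Gt Gs ts) _; rewrite distrC ger0_norm ?subr_ge0//.
  by rewrite ler_wpM2l ?subr_ge0// /Gam; move: g2 g3; lra.
have B0 t : 0 <= B t by exact: ip_ge0.
have [w w0 Hw] := weak_continuity oO fO M (Hv s) dl0.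
pose e := w / (2 * (fine (mu Omega) + 1)).
have mu0 : 0 <= fine (mu Omega) by exact: fine_ge0.
have e0 : 0 < e by rewrite divr_gt0// mulr_gt0// ltr_wpDl.
pose c := e `^ (1 - q).
have c0 : 0 <= c by exact: powR_ge0.
pose m := 2 * (Num.sqrt (B s) + 1).
have m0 : 0 < m by rewrite mulr_gt0// ltr_wpDl// sqrtr_ge0.
pose d := Num.min (w / (2 * (c + 1))) (Num.min ((dl / m) ^+ 2) 1).
have d0 : 0 < d.
  rewrite lt_min divr_gt0 ?mulr_gt0 ?ltr_wpDl//= lt_min ltr01 andbT.
  by rewrite exprn_gt0// divr_gt0.
have d1 : d <= w / (2 * (c + 1)) by rewrite /d ge_min lexx.
have d2 : d <= (dl / m) ^+ 2 by rewrite /d !ge_min lexx orbT.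
have d3 : d <= 1 by rewrite /d !ge_min lexx !orbT.
clearbody d.
exists (d / Gam); first by rewrite divr_gt0.
move=> t Gt ts.
have Dd : dist s t <= d.
  apply: le_trans (hd _ Gt) _; rewrite -ler_pdivlMr//; exact: ltW.
have D0 : 0 <= dist s t by exact: ip_ge0.
split.
  have H1s := H10_H1 (Hv s); have H1t := H10_H1 (Hv t).
  apply: (Hw _ _ H1t H1s (HM t) (HM s)).
  have := sqr_dist_le oO bO (Hv s) (Hv t) (vnn s) (vnn t) e0.
  rewrite -/(dist s t) -/c => /le_trans; apply.
  exact: (half_sum_le mu0 c0 w0 D0 (le_trans Dd d1)).
have h1 := power_norm_sub oO bO (Hv s) (Hv t).
have h2 := power_norm_sub oO bO (Hv t) (Hv s).
have dE : dist t s = dist s t by apply: eq_Rintegral => x _; ring.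
have h3 := sqrt_norm_triangle oO bO (Hv s) (Hv t).
rewrite -/(B t) -/(B s) -/(dist s t) in h1; rewrite -/(B t) -/(B s) -/(dist t s) dE in h2.
exact: (sqr_norm_close (B0 s) (B0 t) D0 dl0 (le_trans Dd d2) (le_trans Dd d3) h1 h2 h3).
Qed.

Let gpC s t : K s t = K t s. Proof. exact: grad_pairC. Qed.

Let B_bounded : exists C : R, forall t, `|B t| <= C.
Proof.
eexists => t; have [_] := sobolev oO bO (Hv t).
rewrite ger0_norm ?ip_ge0// => /le_trans; apply; apply: powR_ge0_le; last first.
- by apply: ler_wpM2l (HM t); rewrite mulr_ge0// sqr_ge0.
- by rewrite !mulr_ge0 ?sqr_ge0// A_fun_ge0.
- by rewrite divr_ge0// subr_ge0 ler_nat.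
Qed.

Section terminal_time.
Variable (b : R).
Hypothesis Gb : G b.

Let b0 : 0 < b. Proof. by have := GW Gb; rewrite /= in_itv/= => /andP[]. Qed.
Let bT : b < T. Proof. by have := GW Gb; rewrite /= in_itv/= => /andP[]. Qed.

(** Clamping time to [0, b] extends K by the constants A (v 0) and A (v b). *)
Let cl t := if t <= 0 then 0 else if b <= t then b else t.

Let cl0 t : t <= 0 -> cl t = 0. Proof. by rewrite /cl => ->. Qed.

Let clb t : b <= t -> cl t = b.
Proof. by move=> bt; rewrite /cl bt leNgt (lt_le_trans b0 bt). Qed.

Let clid t : 0 < t -> t <= b -> cl t = t.
Proof.
move=> t0; rewrite le_eqVlt => /predU1P[->|tb]; first exact: clb.
by rewrite /cl leNgt t0 leNgt tb.
Qed.

Let mcl : measurable_fun (setT : set (measurableTypeR R)) cl.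
Proof.
apply: measurable_fun_ifT => //; first exact: measurable_fun_ler.
by apply: measurable_fun_ifT => //; exact: measurable_fun_ler.
Qed.

Let K' s t := K (cl s) (cl t).

Let mK' : measurable_fun (setT : set (measurableTypeR R * measurableTypeR R))
  (fun z => K' z.1 z.2).
Proof.
have m2 : measurable_fun (setT : set (measurableTypeR R * measurableTypeR R))
    (fun z => (cl z.1, cl z.2)).
  by apply/measurable_fun_pair; apply: (measurableT_comp mcl).
exact: (measurableT_comp mK m2).
Qed.

Let iK' s t w : leb.-integrable `]s, t[ (EFin \o (fun tau => K' tau w)).
Proof.
apply: (integrable_bounded_oo (C := `|M|)); last by move=> ? _; exact: KM.
by apply: measurable_funTS; exact: (measurableT_comp mK' (measurable_pair2 w)).
Qed.

(** The function that telescopes; its second term absorbs the quadratic errors of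
    increment. *)
Let Phi h t := B (cl t) / (2 * q) + 4 * (h * gam (cl t)).

Let iPhi h r : leb.-integrable `](- r), (b + r)[ (EFin \o Phi h).
Proof.
have [C BC] := B_bounded.
have gC t : `|gam (cl t)| <= `|gam 0| + `|gam b|.
  have : gam 0 <= gam (cl t) <= gam b.
    by rewrite /cl; case: (leP t 0) => t0; [|case: (leP b t) => bt];
      rewrite !ndg// ?(ltW b0) ?(ltW t0) ?(ltW bt).
  move=> /andP[h1 h2]; rewrite ler_norml; apply/andP; split.
    by apply: le_trans h1; rewrite lerNl; apply: le_trans (ler_norm _) _; rewrite normrN lerDl.
  by apply: (le_trans h2); apply: le_trans (ler_norm _) _; rewrite lerDr.
have mg : measurable_fun (setT : set (measurableTypeR R)) (gam \o cl).
  apply: nondecreasing_measurable => // s t st /=; apply: ndg; rewrite /cl.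
  case: (leP s 0) => s0; case: (leP t 0) => t0 //.
  - by case: ifP => _; rewrite ltW.
  - by move: (lt_le_trans s0 (le_trans st t0)); rewrite ltxx.
  - by case: (leP b s) => bs; case: (leP b t) => bt //; [rewrite (le_trans bs)//|exact: ltW].
have mBc : measurable_fun (setT : set (measurableTypeR R)) (B \o cl).
  have mT : measurable (`]0, T[%classic : set (measurableTypeR R)) by [].
  rewrite (_ : B \o cl = fun t => if t <= 0 then B 0 else if b <= t then B b else
      (B \_ `]0, T[) t).
    apply: measurable_fun_ifT; [exact: measurable_fun_ler|exact: measurable_cst|].
    apply: measurable_fun_ifT; [exact: measurable_fun_ler|exact: measurable_cst|].
    by apply/(measurable_restrictT _ mT).
  apply/funext => t; rewrite /= /cl; case: (leP t 0) => // t0.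
  by case: (leP b t) => // tb; rewrite patchE mem_set//= in_itv/= t0 (lt_trans tb).
apply: (integrable_bounded_oo (C := C * `|(2 * q)^-1| + 4 * (`|h| * (`|gam 0| + `|gam b|)))).
  apply: measurable_funTS; apply: measurable_funD; first exact: measurable_funM.
  by apply: measurable_funM => //; exact: measurable_funM.
move=> t _; rewrite /Phi; apply: le_trans (ler_normD _ _) _; rewrite !normrM.
by rewrite (ger0_norm (ler0n _ 4)) lerD// ?ler_wpM2r// !ler_wpM2l.
Qed.

Let phi_sub (a c d e h k : R) : a / d + 4 * (h * e) - (c / d + 4 * (h * k)) =
  (a - c) / d + 4 * (h * (e - k)).
Proof. by rewrite opprD addrACA -mulrBl -!mulrBr. Qed.

Let S h := cross_increment h K'.

Let cross_inner s t : G0 s -> G0 t -> 0 <= s -> s <= t -> t <= b ->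
  \int[leb]_(tau in `]s, t[) (K' tau t - K' tau s) <=
  (t - s) * ((B t - B s) / (2 * q) + 4 * ((t - s) * (gam t - gam s))).
Proof.
move=> Gs Gt s0 st tb; apply: le_trans (increment Gs Gt st).
have ct : cl t = t.
  by move: (le_trans s0 st); rewrite le_eqVlt => /predU1P[<-|t0]; [exact: cl0|exact: clid].
have cs : cl s = s.
  move: s0; rewrite le_eqVlt => /predU1P[<-|t0]; first exact: cl0.
  by apply: clid => //; exact: le_trans tb.
rewrite le_eqVlt; apply/orP; left; apply/eqP; apply: eq_Rintegral => r.
rewrite inE/= in_itv/= => /andP[sr rt]; rewrite /K' ct cs clid//.
  exact: le_lt_trans sr.
by rewrite ltW// (lt_le_trans rt).
Qed.

Let q21 : 1 <= 2 * q.
Proof.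
have N3 : 3 <= N%:R :> R by rewrite ler_nat.
rewrite mulrA ler_pdivlMr; move: N3; move: (N%:R : R) => t t3; lra.
Qed.

Let layer_arith (h t k be g dl : R) : 0 <= t -> t <= h -> 0 <= g -> k <= dl / 2 ->
  - be <= dl -> 0 <= dl ->
  (h - t) * k + t * (be / (2 * q) + 4 * (t * g)) <=
  h * (be / (2 * q) + 4 * (h * g)) + h * (2 * dl).
Proof.
move=> t0 th g0 kd bd dl0.
have bq : - (be / (2 * q)) <= dl.
  rewrite -mulNr; apply: (@le_trans _ _ (dl / (2 * q))).
    by rewrite ler_wpM2r// invr_ge0 (le_trans _ q21).
  by rewrite ler_pdivrMr ?(lt_le_trans _ q21)// ler_peMr.
move: bq; move: (be / (2 * q)) => x bq.
have h1 : (h - t) * k <= (h - t) * dl by rewrite ler_wpM2l ?subr_ge0//; lra.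
have h2 : (h - t) * (- x) <= (h - t) * dl by rewrite ler_wpM2l ?subr_ge0.
have h3 : t * (t * g) <= h * (h * g).
  by apply: ler_pM; rewrite ?mulr_ge0//; apply: ler_wpM2r.
have h4 : 0 <= t * dl by rewrite mulr_ge0.
by move: h1 h2 h3 h4; rewrite !mulrDr !mulrBl !mulrN; lra.
Qed.

(** In the interior this is increment.  In the layers t < h and b < t of width h a part of
    the interval of integration lies outside [0, b], where the clamped kernel is an end
    value: there increment covers the rest, and continuity at 0 or at b the difference, at
    the price of dl. *)
Let cross_le (h dl : R) : 0 < h -> h < b -> 0 < dl ->
  (forall t, G0 t -> `|t - 0| < h -> `|K t 0 - K 0 0| <= dl / 2 /\ `|B t - B 0| <= dl / 2) ->
  (forall t, G0 t -> `|t - b| < h -> `|K t b - K b b| <= dl / 2 /\ `|B t - B b| <= dl / 2) ->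
  forall t, (0 < t < T -> G t) -> (0 < t - h < T -> G (t - h)) -> 0 < t < b + h ->
  S h t <= h * (Phi h t - Phi h (t - h)) +
    h * (if (t < h) || (b < t) then 2 * dl else 0).
Proof.
move=> h0 hb dl0 cl_0 cl_b t Gt Gth /andP[t0 tbh].
have PhiE s r : cl s = s -> cl r = r ->
    Phi h s - Phi h r = (B s - B r) / (2 * q) + 4 * (h * (gam s - gam r)).
  by move=> es er; rewrite /Phi es er phi_sub.
have [th|ht] /= := ltP t h.
  have tb : t < b by exact: lt_trans hb.
  have {}Gt : G0 t by right; apply: Gt; rewrite t0 (lt_trans tb).
  have G00 : G0 0 by left.
  have ct : cl t = t by apply: clid => //; exact: ltW.
  have cth : cl (t - h) = 0 by apply: cl0; rewrite subr_le0 ltW.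
  have iS : leb.-integrable `](t - h), t[ (EFin \o (fun tau => K' tau t - K' tau (t - h))).
    have mt : measurable (`](t - h), t[%classic : set (measurableTypeR R)) by [].
    by have := integrableB mt (iK' _ _ t) (iK' _ _ (t - h)); apply: eq_integrable.
  have th0 : t - h <= 0 by rewrite subr_le0 ltW.
  have e0 : \int[leb]_(r in `](t - h), 0[) (K' r t - K' r (t - h)) =
      (K 0 t - K 0 0) * (0 - (t - h)).
    by apply: Rintegral_eq_cst th0 _ => r /andP[_ r0]; rewrite /K' ct cth (cl0 (ltW r0)).
  rewrite /S /cross_increment (Rintegral_split th0 (ltW t0) iS) e0.
  have -> : \int[leb]_(r in `]0, t[) (K' r t - K' r (t - h)) =
      \int[leb]_(r in `]0, t[) (K' r t - K' r 0).
    by apply: eq_Rintegral => r _; rewrite /K' cth (cl0 (lexx 0)).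
  have C := cross_inner G00 Gt (lexx 0) (ltW t0) (ltW tb); rewrite subr0 in C.
  have -> : Phi h t - Phi h (t - h) = (B t - B 0) / (2 * q) + 4 * (h * (gam t - gam 0)).
    by rewrite /Phi ct cth phi_sub.
  have [|k1 k2] := cl_0 _ Gt; first by rewrite subr0 gtr0_norm.
  apply: (@le_trans _ _ ((h - t) * (K t 0 - K 0 0) +
      t * ((B t - B 0) / (2 * q) + 4 * (t * (gam t - gam 0))))).
    by rewrite lerD// gpC mulrC sub0r opprB.
  apply: layer_arith; rewrite ?(ltW t0) ?(ltW th) ?(ltW dl0)//.
  - by rewrite subr_ge0 ndg// ltW.
  - exact: le_trans (ler_norm _) k1.
  - rewrite -normrN in k2; apply: (le_trans (ler_norm _)); apply: (le_trans k2).
    by rewrite ler_pdivrMr// ler_peMr// ?ler1n// ltW.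
have [bt|tb] := ltP b t.
  set s := t - h; have s0 : 0 < s by rewrite /s subr_gt0 (lt_trans hb).
  have sb : s < b by rewrite /s ltrBlDr.
  have bsh : b - s < h by rewrite /s opprB addrA ltrBlDr addrC ltrD2l.
  have {}Gs : G0 s by right; apply: Gth; rewrite s0 (lt_trans sb).
  have {}Gt : G0 b by right.
  have ct : cl t = b by apply: clb; exact: ltW.
  have cs : cl s = s by apply: clid => //; exact: ltW.
  have st : s <= t by rewrite /s lerBlDr lerDl ltW.
  have iS : leb.-integrable `]s, t[ (EFin \o (fun tau => K' tau t - K' tau s)).
    have mt : measurable (`]s, t[%classic : set (measurableTypeR R)) by [].
    by have := integrableB mt (iK' _ _ t) (iK' _ _ s); apply: eq_integrable.
  have e0 : \int[leb]_(r in `]b, t[) (K' r t - K' r s) = (K b b - K b s) * (t - b).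
    by apply: Rintegral_eq_cst (ltW bt) _ => r /andP[br _]; rewrite /K' ct cs (clb (ltW br)).
  rewrite /S /cross_increment -/s (Rintegral_split (ltW sb) (ltW bt) iS) e0.
  have -> : \int[leb]_(r in `]s, b[) (K' r t - K' r s) =
      \int[leb]_(r in `]s, b[) (K' r b - K' r s).
    by apply: eq_Rintegral => r _; rewrite /K' ct (clb (lexx b)).
  have C := cross_inner Gs Gt (ltW s0) (ltW sb) (lexx b).
  have -> : Phi h t - Phi h s = (B b - B s) / (2 * q) + 4 * (h * (gam b - gam s)).
    by rewrite /Phi ct cs phi_sub.
  have [|k1 k2] := cl_b _ Gs.
    by rewrite (ltr0_norm (eqbRL (subr_lt0 _ _) sb)) opprB.
  apply: (@le_trans _ _ ((h - (b - s)) * (K b b - K s b) +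
      (b - s) * ((B b - B s) / (2 * q) + 4 * ((b - s) * (gam b - gam s))))).
    rewrite addrC; apply: lerD => //.
    have -> : h - (b - s) = t - b by rewrite /s; ring.
    by rewrite (gpC b s) mulrC.
  apply: layer_arith; rewrite ?subr_ge0 ?(ltW sb) ?(ltW dl0) ?ndg//.
  - exact: ltW.
  - exact: ltW.
  - by rewrite -normrN opprB in k1; exact: le_trans (ler_norm _) k1.
  - rewrite opprB; apply: (le_trans (ler_norm _)); apply: (le_trans k2).
    by rewrite ler_pdivrMr// ler_peMr// ?ler1n// ltW.
rewrite mulr0 addr0.
have Gt' : G0 t by right; apply: Gt; rewrite t0 (le_lt_trans tb).
have th0 : 0 <= t - h by rewrite subr_ge0.
have thb : t - h <= t by rewrite lerBlDr lerDl ltW.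
have Gs : G0 (t - h).
  move: th0; rewrite le_eqVlt => /predU1P[<-|th0]; first by left.
  by right; apply: Gth; rewrite th0 (le_lt_trans thb)// (le_lt_trans tb).
have ct : cl t = t by exact: clid.
have cs : cl (t - h) = t - h.
  move: th0; rewrite le_eqVlt => /predU1P[<-|th0]; first exact: cl0.
  by apply: clid => //; exact: le_trans tb.
rewrite (PhiE _ _ ct cs); have := cross_inner Gs Gt' th0 thb tb.
by rewrite (_ : t - (t - h) = h)//; ring.
Qed.

Let layer_integral (h dl : R) : 0 < h -> h < b ->
  leb.-integrable `]0, (b + h)[ (EFin \o (fun t => if (t < h) || (b < t) then dl else 0)) /\
  \int[leb]_(t in `]0, (b + h)[) (if (t < h) || (b < t) then dl else 0) = 2 * (h * dl).
Proof.
move=> h0 hb; pose L t := if (t < h) || (b < t) then dl else 0.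
have hbh : h <= b + h by rewrite lerDr ltW.
have iL : leb.-integrable `]0, (b + h)[ (EFin \o L).
  apply: (integrable_bounded_oo (C := `|dl|)); last first.
    by move=> t _; rewrite /L; case: ifP => _; rewrite ?normr0.
  apply: measurable_funTS; apply: measurable_fun_ifT; [|exact: measurable_cst|exact: measurable_cst].
  by apply: measurable_or; exact: measurable_fun_ltr.
split; first exact: iL.
rewrite -[LHS]/(\int[leb]_(t in `]0, (b + h)[) L t) (Rintegral_split (ltW h0) hbh iL).
have iL2 : leb.-integrable `]h, (b + h)[ (EFin \o L).
  exact: (integrable_sub_itv (ltW h0) (lexx _) iL).
have bbh : b <= b + h by rewrite lerDl ltW.
rewrite (Rintegral_split (ltW hb) bbh iL2).
have -> : \int[leb]_(t in `]0, h[) L t = dl * (h - 0).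
  by apply: Rintegral_eq_cst (ltW h0) _ => t /andP[_ th]; rewrite /L th.
have -> : \int[leb]_(t in `]h, b[) L t = 0 * (b - h).
  apply: Rintegral_eq_cst (ltW hb) _ => t /andP[ht tb].
  by rewrite /L ltNge (ltW ht) ltNge (ltW tb).
have -> : \int[leb]_(t in `]b, (b + h)[) L t = dl * (b + h - b).
  by apply: Rintegral_eq_cst bbh _ => t /andP[bt _]; rewrite /L bt orbT.
ring.
Qed.

Let energy_arith (h Ab A0 be Ga dl : R) : 0 < h ->
  h ^+ 2 / 2 * (Ab - A0) <= h * (h * (be + 4 * (h * Ga))) + h * (2 * (h * (2 * dl))) ->
  (Ab - A0) / 2 <= be + 4 * (h * Ga) + 4 * dl.
Proof.
move=> h0 H; rewrite -(ler_pM2l (exprn_gt0 2 h0)).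
have -> : h ^+ 2 * ((Ab - A0) / 2) = h ^+ 2 / 2 * (Ab - A0) by ring.
by apply: (le_trans H); rewrite le_eqVlt; apply/orP; left; apply/eqP; ring.
Qed.

(** Integrating cross_le over 0 < t < b + h and dividing by h ^ 2 bounds
    (A (v b) - A (v 0)) / 2 by (B b - B 0) / (2 q) + 4 h (gam b - gam 0) + 4 dl: the layers
    have total width 2 h, the same order as the main term.  Then h and dl tend to 0. *)
Lemma energy_decrease : 2^-1 * A_fun Omega (v b) - (2 * q)^-1 * B b <=
  2^-1 * A_fun Omega (v 0) - (2 * q)^-1 * B 0.
Proof.
apply/ler_addgt0Pr => e e0.
have G00 : G0 0 by left.
have Gb0 : G0 b by right.
have dl0 : 0 < e / 8 / 2 by rewrite !divr_gt0.
have [r1 r10 H1] := close G00 dl0; have [r2 r20 H2] := close Gb0 dl0.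
pose Ga := gam b - gam 0.
have Ga0 : 0 <= Ga by rewrite subr_ge0 ndg// ltW.
have Ga1 : 0 < 8 * (Ga + 1) by rewrite mulr_gt0// ltr_wpDl.
pose h := Num.min (Num.min r1 r2) (Num.min (b / 2) (e / (8 * (Ga + 1)))).
have h0 : 0 < h by rewrite !lt_min r10 r20 !divr_gt0.
have hr1 : h <= r1 by rewrite /h !ge_min lexx.
have hr2 : h <= r2 by rewrite /h !ge_min lexx !orbT.
have hb : h < b.
  apply: (@le_lt_trans _ _ (b / 2)); first by rewrite /h !ge_min lexx !orbT.
  by rewrite ltr_pdivrMr// ltr_pMr// ltr1n.
have hG : h <= e / (8 * (Ga + 1)) by rewrite /h !ge_min lexx !orbT.
clearbody h.
have mI : measurable (`]0, (b + h)[%classic : set (measurableTypeR R)) by [].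
have b0' := ltW b0.
have K'M s t : `|K' s t| <= `|M| by exact: KM.
have K'C s t : K' s t = K' t s by exact: gpC.
have K'0 s t : s <= 0 -> t <= 0 -> K' s t = A_fun Omega (v 0).
  by move=> s0 t0; rewrite /K' (cl0 s0) (cl0 t0) A_funE.
have K'b s t : b <= s -> b <= t -> K' s t = A_fun Omega (v b).
  by move=> s0 t0; rewrite /K' (clb s0) (clb t0) A_funE.
have iS : leb.-integrable `]0, (b + h)[ (EFin \o S h).
  exact: (cross_increment_integrable b h0 mK' K'C K'M).
have ES := Rintegral_cross_increment b0' h0 mK' K'C K'M K'0 K'b.
have Phi0 t : t <= 0 -> Phi h t = Phi h 0 by move=> t0; rewrite /Phi (cl0 t0) (cl0 (lexx 0)).
have Phib t : b <= t -> Phi h t = Phi h b by move=> t0; rewrite /Phi (clb t0) (clb (lexx b)).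
have [iF EF] := Rintegral_increment b0' h0 (iPhi h h) Phi0 Phib.
have [iL EL] := layer_integral (2 * (e / 8)) h0 hb.
have iF' : leb.-integrable `]0, (b + h)[ (EFin \o (fun t => h * (Phi h t - Phi h (t - h)))).
  by have := integrableZl mI h iF; apply: eq_integrable.
have iL' : leb.-integrable `]0, (b + h)[
    (EFin \o (fun t => h * (if (t < h) || (b < t) then 2 * (e / 8) else 0))).
  by have := integrableZl mI h iL; apply: eq_integrable.
have le1 : \int[leb]_(t in `]0, (b + h)[) S h t <=
    h * \int[leb]_(t in `]0, (b + h)[) (Phi h t - Phi h (t - h)) +
    h * \int[leb]_(t in `]0, (b + h)[) (if (t < h) || (b < t) then 2 * (e / 8) else 0).
  rewrite -(RintegralZl _ mI iF) -(RintegralZl _ mI iL) -(RintegralD mI iF' iL').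
  apply: (ae_le_Rintegral mI iS).
    by have := integrableD mI iF' iL'; apply: eq_integrable.
  have aeh := ae_shift h aeG.
  apply: (@filterS2 _ _ (ae_filter_ringOfSetsType leb) _ _ _ _ aeG aeh) => t Gt Gth.
  rewrite /= in_itv/=; apply: (cross_le h0 hb _ _ _ Gt Gth).
  - by rewrite divr_gt0.
  - by move=> s Gs sh; apply: H1 Gs (lt_le_trans sh hr1).
  - by move=> s Gs sh; apply: H2 Gs (lt_le_trans sh hr2).
rewrite EF EL [X in X <= _]ES in le1.
have PE : Phi h b - Phi h 0 = (B b - B 0) / (2 * q) + 4 * (h * Ga).
  by rewrite /Phi (clb (lexx b)) (cl0 (lexx 0)) phi_sub.
rewrite PE in le1.
have := energy_arith h0 le1.
have hGa : 4 * (h * Ga) <= e / 2.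
  apply: (@le_trans _ _ (4 * (e / (8 * (Ga + 1)) * (Ga + 1)))).
    by rewrite ler_pM2l// ler_pM// ?(ltW h0)// lerDl.
  rewrite le_eqVlt; apply/orP; left; apply/eqP; field.
  by rewrite gt_eqF// ltr_wpDl.
exact: energy_conclusion.
Qed.

End terminal_time.
End energy_inequality.

(** * Null sets, sections and dense sets of times *)
Section null_sets.
Context d (T : measurableType d) (R : realType) (mu : {measure set T -> \bar R}).
Import HBNNSimple.

Let nnintegral_le_off_null (A : set T) (f g : T -> \bar R) : measurable A -> mu A = 0%E ->
  (forall x, 0 <= f x)%E -> (forall x, 0 <= g x)%E -> (forall x, ~ A x -> f x = g x) ->
  (\int[mu]_x f x <= \int[mu]_x g x)%E.
Proof.
move=> mA A0 f0 g0 fg; rewrite !ge0_integralTE//.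
apply: ge_ereal_sup => _ [h hf <-].
have mAC : measurable (~` A) by exact: measurableC.
pose h' := proj_nnsfun h mAC.
have -> : sintegral mu h = sintegral mu h'.
  have E (k : {nnsfun T >-> R}) : sintegral mu k = (\int[mu]_x (k x)%:E)%E.
    by rewrite integral_nnsfun// patch_setT.
  rewrite !E; apply: ge0_ae_eq_integral => //.
  - by apply/measurable_EFinP.
  - by apply/measurable_EFinP.
  - by move=> x _; rewrite lee_fin.
  - by move=> x _; rewrite lee_fin.
  exists A; split => // x /= /not_implyP[_ hh]; apply: contrapT => nA; apply: hh.
  by congr EFin; rewrite /h' /= mindicE mem_set// mulr1.
apply: ereal_sup_ubound; exists h' => // x; rewrite /h' /= mindicE.
have [xA|xA] := pselect (A x).
  by rewrite memNset ?mulr0//=; apply/not_notP.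
by rewrite mem_set// mulr1 -fg.
Qed.

(** Neither function has to be measurable: a quantity derived from a weak solution is only
    defined along a conull set of times.  The integral of a nonnegative function is a
    supremum over simple functions, which may be cut to the complement of A. *)
Lemma integral_eq_off_null (D A : set T) (f g : T -> \bar R) : measurable A ->
  mu A = 0%E -> (forall x, D x -> ~ A x -> f x = g x) ->
  (\int[mu]_(x in D) f x = \int[mu]_(x in D) g x)%E.
Proof.
move=> mA A0 fg; rewrite [LHS]integral_mkcond [RHS]integral_mkcond.
have {}fg x : ~ A x -> (f \_ D) x = (g \_ D) x.
  by move=> nA; rewrite !patchE; case: ifPn => // /set_mem Dx; exact: fg.
rewrite integralE [RHS]integralE; congr (_ - _)%E; apply/eqP; rewrite eq_le;
  apply/andP; split; apply: (nnintegral_le_off_null mA A0) => // x nA;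
  by rewrite ?funeposE ?funenegE fg.
Qed.

End null_sets.

Section product_bounds.
Context d1 d2 (T1 : measurableType d1) (T2 : measurableType d2) (R : realType).
Variables (m1 : {sigma_finite_measure set T1 -> \bar R})
  (m2 : {sigma_finite_measure set T2 -> \bar R}).

Lemma integrable_prod_bound (D1 : set T1) (D2 : set T2) (f : T1 * T2 -> R) (C : R) :
  measurable D1 -> measurable D2 -> (m1 D1 < +oo)%E -> measurable_fun (D1 `*` D2) f ->
  (\forall x \ae m1, D1 x -> \int[m2]_(y in D2) `|f (x, y)|%:E <= C%:E)%E ->
  (m1 \x m2)%E.-integrable (D1 `*` D2) (EFin \o f).
Proof.
move=> mD1 mD2 f1 mf fC; apply: integrable_prod => //.
have mD : measurable (D1 `*` D2) by exact: measurableX.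
pose F z := (`|(f \_ (D1 `*` D2)) z|%:E : \bar R).
have mF : measurable_fun setT F.
  apply/measurable_EFinP; apply: measurableT_comp => //.
  by apply/(measurable_restrictT _ mD).
have FE x : D1 x -> (\int[m2]_y F (x, y) = \int[m2]_(y in D2) `|f (x, y)|%:E)%E.
  move=> D1x; rewrite [RHS]integral_mkcond; apply: eq_integral => y _.
  by rewrite /F !patchE in_setX mem_set//=; case: ifP => //; rewrite normr0.
rewrite (eq_integral (fun x => \int[m2]_y F (x, y))%E); last first.
  by move=> x; rewrite inE => D1x; rewrite FE.
apply: (@le_lt_trans _ _ (\int[m1]_(x in D1) (`|C|)%:E)%E).
  apply: ae_ge0_le_integral => //.
  - by move=> x _; apply: integral_ge0 => y _; rewrite lee_fin.
  - apply: measurable_funTS.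
    by apply: (@measurable_fun_fubini_tonelli_F _ _ _ _ R m2 F) => // z; rewrite lee_fin.
  - apply: filterS fC => x h D1x; rewrite FE//; apply: (le_trans (h D1x)).
    by rewrite lee_fin ler_norm.
have -> : (\int[m1]_(x in D1) (`|C|)%:E = (`|C|)%:E * m1 D1)%E by exact: integral_cst.
by rewrite lte_mul_pinfty.
Qed.

Lemma integrable_prod_swap_ae (D1 : set T1) (D2 : set T2) (f : T1 * T2 -> R) :
  measurable D1 -> measurable D2 -> (m1 \x m2)%E.-integrable (D1 `*` D2) (EFin \o f) ->
  \forall y \ae m2, D2 y -> m1.-integrable D1 (fun x => (f (x, y))%:E).
Proof.
move=> mD1 mD2 intf; have mD : measurable (D1 `*` D2) by exact: measurableX.
move/(integrable_mkcond _ mD) : intf => iF.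
apply: filterS (ae_integrable2 iF) => y h D2y.
apply/(integrable_mkcond _ mD1); move: h; congr (_.-integrable _ _).
by apply/funext => x; rewrite !patchE in_setX (mem_set D2y) andbT.
Qed.

Lemma measurable_fun_section2 (D1 : set T1) (D2 : set T2) (f : T1 * T2 -> R) y :
  measurable D1 -> measurable D2 -> measurable_fun (D1 `*` D2) f -> D2 y ->
  measurable_fun D1 (fun x => f (x, y)).
Proof.
move=> mD1 mD2 mf D2y; have mD : measurable (D1 `*` D2) by exact: measurableX.
apply/(measurable_restrictT _ mD1).
rewrite (_ : _ \_ _ = (f \_ (D1 `*` D2)) \o (fun x => (x, y))).
  apply: measurableT_comp; last exact: measurable_pair2.
  by apply/(measurable_restrictT _ mD).
by apply/funext => x /=; rewrite !patchE in_setX (mem_set D2y) andbT.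
Qed.

End product_bounds.

Section dense_times.
Context (R : realType).
Local Notation leb := (@lebesgue_measure R).

Lemma ae_exists (P : R -> Prop) (a b : R) : a < b -> (\forall t \ae leb, P t) ->
  exists t, a < t < b /\ P t.
Proof.
move=> ab [A [mA A0 PA]]; apply: contrapT => H.
have sub : `]a, b[%classic `<=` A.
  by move=> t /=; rewrite in_itv/= => tab; apply: PA => /= Pt; apply: H; exists t.
have := le_measure leb (mem_set (measurable_itv `]a, b[)) (mem_set mA) sub.
move=> h; suff : ((b - a)%:E <= (0 : \bar R))%E by rewrite lee_fin leNgt subr_gt0 ab.
rewrite -[X in (X <= _)%E](lebesgue_itv_oo (ltW ab)) -[X in (_ <= X)%E]A0.
exact: h.
Qed.

(** A relation f = c + primitive of k, valid for almost all times, extends to every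
    time at which f is continuous along a conull set. *)
Lemma primitive_dense (T c C : R) (G : set R) (f k : R -> R) : 0 < T ->
  leb.-integrable `]0, T[ (EFin \o k) -> (forall t, `|k t| <= C) ->
  (\forall t \ae leb, 0 < t < T -> G t) ->
  (\forall t \ae leb, 0 < t < T -> f t = c + \int[leb]_(s in `]0, t[) k s) ->
  forall t, 0 <= t < T ->
  (forall e, 0 < e -> exists2 r, 0 < r & forall s, G s -> `|s - t| < r -> `|f s - f t| <= e) ->
  f t = c + \int[leb]_(s in `]0, t[) k s.
Proof.
move=> T0 ik kC aeG aef t /andP[t0 tT] ct.
have C0 : 0 <= C by exact: le_trans (kC 0).
apply/eqP; rewrite -subr_eq0 -normr_le0; apply/ler_addgt0Pr => e e0; rewrite add0r.
have [r r0 H] := ct _ (divr_gt0 e0 (ltr0Sn R 1)).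
pose r' := Num.min (Num.min r (T - t)) (e / 2 / (C + 1)).
have C1 : 0 < C + 1 by rewrite ltr_wpDl.
have r'0 : 0 < r' by rewrite !lt_min r0 subr_gt0 tT !divr_gt0.
have [s [/andP[ts sr] [Gs fs]]] : exists s, t < s < t + r' /\
    ((0 < s < T -> G s) /\ (0 < s < T -> f s = c + \int[leb]_(s in `]0, s[) k s)).
  apply: ae_exists; first by rewrite ltrDl.
  exact: (@filterS2 _ _ (ae_filter_ringOfSetsType leb) _ _ _ _ aeG aef).
have s0 : 0 < s by exact: le_lt_trans ts.
have sT : s < T.
  by apply: (lt_le_trans sr); rewrite -lerBrDl /r' !ge_min lexx !orbT.
have {}Gs : G s by apply: Gs; rewrite s0.
have {}fs : f s = c + \int[leb]_(s in `]0, s[) k s by apply: fs; rewrite s0.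
have d1 : `|f s - f t| <= e / 2.
  apply: H Gs _; rewrite gtr0_norm ?subr_gt0// ltrBlDl; apply: (lt_le_trans sr).
  by rewrite lerD2l /r' !ge_min lexx.
have iks : leb.-integrable `]0, s[ (EFin \o k) by apply: (integrable_sub_itv _ _ ik) => //; exact: ltW.
have ikts : leb.-integrable `]t, s[ (EFin \o k) by apply: (integrable_sub_itv _ _ iks).
have mts : measurable (`]t, s[%classic : set (measurableTypeR R)) by [].
have d2 : `|\int[leb]_(x in `]t, s[) k x| <= e / 2.
  apply: le_trans (le_normr_Rintegral mts ikts) _.
  apply: (@le_trans _ _ (\int[leb]_(x in `]t, s[) C)).
    apply: (le_Rintegral mts) => //; first exact: integrable_norm.
    by apply: (integrable_bounded_oo (C := `|C|)) => //; exact: measurable_cst.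
  rewrite Rintegral_cst_itv ?(ltW ts)//.
  apply: (@le_trans _ _ ((C + 1) * (e / 2 / (C + 1)))); last by rewrite mulrC divfK ?gt_eqF.
  apply: ler_pM => //; rewrite ?subr_ge0 ?(ltW ts) ?lerDl//.
  by rewrite lerBlDl ltW// (lt_le_trans sr)// lerD2l /r' !ge_min lexx !orbT.
rewrite (Rintegral_split t0 (ltW ts) iks) in fs.
rewrite (_ : f t - _ = \int[leb]_(x in `]t, s[) k x - (f s - f t)); last by rewrite fs; ring.
by apply: le_trans (ler_normB _ _) _; rewrite [leRHS](splitr e) lerD.
Qed.

End dense_times.

Lemma ip_triangle d (T : measurableType d) (R : realType) (mu : {measure set T -> \bar R})
  (D : set T) (f g : T -> R) : measurable D -> sqint mu D f -> sqint mu D g ->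
  Num.sqrt (ip mu D (fun x => f x + g x) (fun x => f x + g x)) <=
  Num.sqrt (ip mu D f f) + Num.sqrt (ip mu D g g).
Proof.
move=> mD sf sg; have cs := le_trans (ler_norm _) (cauchy_schwarz mD sf sg).
rewrite -[leRHS]sqrtr_sqr_nneg ?addr_ge0 ?sqrtr_ge0// ler_wsqrtr//.
have sfg := sqintD mD sf sg.
rewrite (ipDl mD sf sg sfg) (ipDr mD sf sg sf) (ipDr mD sf sg sg) (ipC _ _ g f).
rewrite sqrrD !sqr_sqrtr ?ip_ge0// mulr2n -!addrA lerD2l !addrA lerD2r.
exact: lerD.
Qed.

(** * Continuity of the power pairings *)
Section power_pairing_bounds.
Context (R : realType) (n : nat) (Omega : set 'rV[R]_n.+3).
Hypotheses (oO : open Omega) (bO : bounded_set Omega).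
Local Notation N := n.+3.
Local Notation mu := (lebesgue_rV R N).
Local Notation q := (N%:R / (N%:R - 2) : R).
Local Notation y v := (abspow v q).
Local Notation P v := (abspow v (2 * q - 1)).
Implicit Types (v w z : 'rV[R]_N -> R).

Let mO : measurable Omega. Proof. exact: open_measurable_rV. Qed.
Let fO : (mu Omega < +oo)%E. Proof. exact: bounded_lty. Qed.

Lemma sobolev_exponent_gt1 : 1 < q.
Proof.
have N3 : 3 <= N%:R :> R by rewrite ler_nat.
rewrite ltr_pdivlMr; move: N3; move: (N%:R : R) => t t3; lra.
Qed.

Let q1 := sobolev_exponent_gt1.

Lemma p_critE : p_crit R N = 2 * q - 1.
Proof.
have N3 : 3 <= N%:R :> R by rewrite ler_nat.
rewrite /p_crit; move: N3; move: (N%:R : R) => t t3; field; lra.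
Qed.

Lemma p_crit_half : (p_crit R N + 1) / 2 = q.
Proof. by rewrite p_critE; move: q => t; field. Qed.

Lemma p_crit1 : p_crit R N + 1 = 2 * q.
Proof. by rewrite p_critE subrK. Qed.

Lemma power_pairing_le v w x : `|P v x * w x| <= y v x ^+ 2 + y w x ^+ 2.
Proof.
rewrite !abspow_sqr normrM (ger0_norm (powR_ge0 _ _)) /abspow.
have q20 : 0 < 2 * q by move: q1; lra.
have q21 : 0 <= 2 * q - 1 by move: q1; lra.
have a0 := normr_ge0 (v x); have c0 := normr_ge0 (w x).
move: (`|v x|) (`|w x|) a0 c0 => a c a0 c0.
have [ca|/ltW ac] := leP c a.
  apply: (@le_trans _ _ (a `^ (2 * q))); last by rewrite lerDl powR_ge0.
  by rewrite (powRS a0 q20) ler_wpM2l ?powR_ge0.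
apply: (@le_trans _ _ (c `^ (2 * q))); last by rewrite lerDr powR_ge0.
by rewrite (powRS c0 q20) ler_wpM2r// powR_ge0_le.
Qed.

Lemma integral_power_pairing_le v w : H10 Omega v -> H10 Omega w ->
  (\int[mu]_(x in Omega) `|P v x * w x|%:E <=
   (ip mu Omega (y v) (y v) + ip mu Omega (y w) (y w))%:E)%E.
Proof.
move=> Hv Hw; have sv := H10_sqint_abspow oO bO Hv; have sw := H10_sqint_abspow oO bO Hw.
rewrite EFinD (ipE mO sv) (ipE mO sw).
rewrite -(integralD mO (sqint_integrable_sqr sv) (sqint_integrable_sqr sw)).
have i1 := power_pairing_integrable oO bO Hv Hw.
have mPw : measurable_fun Omega (fun x => P v x * w x).
  by apply/measurable_EFinP; case/integrableP : i1.
apply: ge0_le_integral => //.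
- by apply/measurable_EFinP; exact: measurableT_comp.
- by apply: emeasurable_funD; apply/measurable_EFinP; apply: measurable_funX;
    [case: sv|case: sw].
- by move=> x _; rewrite -EFinD lee_fin; exact: power_pairing_le.
Qed.

Lemma power_pairing_bound v w : H10 Omega v -> H10 Omega w ->
  `|ip mu Omega (P v) w| <= ip mu Omega (y v) (y v) + ip mu Omega (y w) (y w).
Proof.
move=> Hv Hw; have i1 := power_pairing_integrable oO bO Hv Hw.
apply: le_trans (le_normr_Rintegral mO i1) _.
rewrite -lee_fin; apply: le_trans (integral_power_pairing_le Hv Hw).
rewrite /Rintegral fineK//; apply: integrable_fin_num => //.
exact: (integrable_norm i1).
Qed.

(** Cauchy-Schwarz after powR_sub_le_conj: the pairing with a fixed z is Lipschitz in the
    q-th power, locally in the critical norm. *)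
Lemma power_pairing_dist v w z : H10 Omega v -> H10 Omega w -> H10 Omega z ->
  `|ip mu Omega (P w) z - ip mu Omega (P v) z| <= 2 *
    (Num.sqrt (ip mu Omega (y v) (y v) + ip mu Omega (y w) (y w) + ip mu Omega (y z) (y z)) *
     Num.sqrt (ip mu Omega (fun x => y w x - y v x) (fun x => y w x - y v x))).
Proof.
move=> Hv Hw Hz.
have sv := H10_sqint_abspow oO bO Hv; have sw := H10_sqint_abspow oO bO Hw.
have sz := H10_sqint_abspow oO bO Hz; have sd := sqintB mO sw sv.
have i1 := power_pairing_integrable oO bO Hw Hz; have i2 := power_pairing_integrable oO bO Hv Hz.
have mH f : H10 Omega f -> measurable_fun Omega (fun x => `|f x|).
  by move=> /H10_H1/(H1_sq oO)[mf _]; exact: measurableT_comp.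
pose h x := Num.max `|v x| `|w x| `^ (q - 1) * `|z x|.
have mh : measurable_fun Omega h.
  apply: measurable_funM; last exact: mH.
  by apply: measurable_fun_powR; apply: measurable_maxr; exact: mH.
have hle x : h x ^+ 2 <= y v x ^+ 2 + y w x ^+ 2 + y z x ^+ 2.
  rewrite !abspow_sqr /h exprMn -powR_mulrn ?powR_ge0// -powRrM [(q - 1) * 2]mulrC.
  have m0 : 0 <= Num.max `|v x| `|w x| by rewrite le_max normr_ge0.
  have := powR_young q1 m0 (normr_ge0 (z x)) ltr01.
  rewrite powR1 !mul1r => /le_trans; apply; rewrite lerD2r.
  case: (leP `|v x| `|w x|) => _; first by rewrite lerDr powR_ge0.
  by rewrite lerDl powR_ge0.
have sq2 f : sqint mu Omega f -> mu.-integrable Omega (fun x => (f x ^+ 2)%:E).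
  exact: sqint_integrable_sqr.
have isum : mu.-integrable Omega (fun x => ((y v x ^+ 2)%:E + (y w x ^+ 2)%:E + (y z x ^+ 2)%:E)%E).
  by apply: integrableD => //; [apply: integrableD => //|]; exact: sq2.
have hint : (\int[mu]_(x in Omega) (h x ^+ 2)%:E <=
    (ip mu Omega (y v) (y v) + ip mu Omega (y w) (y w) + ip mu Omega (y z) (y z))%:E)%E.
  rewrite !EFinD (ipE mO sv) (ipE mO sw) (ipE mO sz) -(integralD mO (sq2 _ sv) (sq2 _ sw)).
  rewrite -(integralD mO (integrableD mO (sq2 _ sv) (sq2 _ sw)) (sq2 _ sz)).
  apply: ge0_le_integral => //.
  - by move=> x _; rewrite lee_fin sqr_ge0.
  - by apply/measurable_EFinP; exact: measurable_funX.
  - by case/integrableP : isum.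
  - by move=> x _; rewrite -!EFinD lee_fin; exact: hle.
have sh : sqint mu Omega h by split => //; apply: le_lt_trans hint _; rewrite ltry.
pose d x := `|y w x - y v x|.
have sdn : sqint mu Omega d.
  apply: (@integrable_le_sqint _ _ _ mu _ mO _ (fun x => y w x - y v x)) => //.
    by apply: measurableT_comp => //; case: sd.
  by move=> x _; rewrite real_normK ?num_real.
have ihd := sqint_integrable mO sh sdn.
have ihd2 : mu.-integrable Omega (EFin \o (fun x => 2 * (h x * d x))).
  by have := integrableZl mO 2 ihd; apply: eq_integrable.
have i12 : mu.-integrable Omega (EFin \o (fun x => P w x * z x - P v x * z x)).
  by have := integrableB mO i1 i2; apply: eq_integrable.
rewrite /ip -(RintegralB mO i1 i2).
apply: le_trans (le_normr_Rintegral mO i12) _.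
apply: (@le_trans _ _ (\int[mu]_(x in Omega) (2 * (h x * d x)))).
  apply: (le_Rintegral mO) => //; first exact: (integrable_norm i12).
  move=> x _; rewrite -mulrBl normrM.
  have -> : 2 * (h x * d x) =
      2 * Num.max `|v x| `|w x| `^ (q - 1) * `|y w x - y v x| * `|z x|.
    rewrite /h /d; move: (Num.max `|v x| `|w x| `^ (q - 1)) `|y w x - y v x| `|z x|.
    by move=> a1 a2 a3; ring.
  apply: ler_wpM2r => //.
  exact: (powR_sub_le_conj q1 (normr_ge0 (v x)) (normr_ge0 (w x))).
rewrite (RintegralZl _ mO ihd) ler_wpM2l//.
apply: (le_trans (ler_norm _)); apply: (le_trans (cauchy_schwarz mO sh sdn)).
apply: ler_pM; rewrite ?sqrtr_ge0//.
  by rewrite ler_wsqrtr// -lee_fin ipE.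
rewrite le_eqVlt; apply/orP; left; apply/eqP; congr Num.sqrt.
by apply: eq_Rintegral => x _; rewrite /d -!expr2 real_normK ?num_real.
Qed.

End power_pairing_bounds.

(** * Weak solutions along a conull set of times *)
Lemma weak_identity_swap (R : zmodType) (a b c : R) : - a + b = c -> a = - (c - b).
Proof. by move=> <-; rewrite addrK opprK. Qed.

Lemma Rintegral_eq_off_null d (T : measurableType d) (R : realType)
  (mu : {measure set T -> \bar R}) (D A : set T) (f g : T -> R) : measurable A ->
  mu A = 0%E -> (forall x, D x -> ~ A x -> f x = g x) ->
  \int[mu]_(x in D) f x = \int[mu]_(x in D) g x.
Proof.
move=> mA A0 fg; rewrite /Rintegral; congr fine.
by apply: (integral_eq_off_null mA A0) => x Dx Ax; rewrite fg.
Qed.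

Lemma norm_mul_le_sqr (R : realDomainType) (a b : R) : `|a * b| <= a ^+ 2 + b ^+ 2.
Proof.
rewrite normrM -(real_normK (num_real a)) -(real_normK (num_real b)).
have := normr_ge0 a; have := normr_ge0 b.
by move: `|a| `|b| => x z z0 x0; have [xz|/ltW zx] := leP x z; nra.
Qed.

Section good_times.
Context (R : realType) (n : nat) (Omega : set 'rV[R]_n.+3).
Hypotheses (oO : open Omega) (bO : bounded_set Omega).
Local Notation N := n.+3.
Local Notation mu := (lebesgue_rV R N).
Local Notation leb := (@lebesgue_measure R).
Local Notation q := (N%:R / (N%:R - 2) : R).
Local Notation y v := (abspow v q).
Local Notation P v := (abspow v (2 * q - 1)).
Local Notation gp := (grad_pair Omega).
Local Notation ipO := (ip mu Omega).

Let mO : measurable Omega. Proof. exact: open_measurable_rV. Qed.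
Let fO : (mu Omega < +oo)%E. Proof. exact: bounded_lty. Qed.

Variables (T : R) (u0 : 'rV[R]_N -> R) (u : R -> 'rV[R]_N -> R).
Hypotheses (T0 : 0 < T) (Hu0 : H10 Omega u0) (hu : weak_solution Omega u0 T u).

Local Notation W := (`]0, T[%classic : set (measurableTypeR R)).

Let mW : measurable W. Proof. exact: measurable_itv. Qed.
Let fW : (leb W < +oo)%E. Proof. exact: itv_oo_lty. Qed.

Variables (M : R) (s : nat -> R -> 'rV[R]_N -> R) (A : set (measurableTypeR R)).
Hypotheses (mA : measurable A) (A0 : leb A = 0%E)
  (ss : forall k, simple_in_X Omega (s k))
  (uH : forall t, W t -> ~ A t -> H10 Omega (u t))
  (uM : forall t, W t -> ~ A t -> norm_X Omega (u t) <= M)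
  (uge0 : forall t, W t -> ~ A t -> nonneg_on Omega (u t))
  (us : forall t, W t -> ~ A t -> norm_X Omega (s k t \- u t) @[k --> \oo] --> 0).

Definition regular_times : set (measurableTypeR R) := W `\` A.
Local Notation G1 := regular_times.

(** The solution with the exceptional times replaced by the initial value, so that all
    bounds hold at every time and the curve starts at u0. *)
Definition regularized t := if t \in G1 then u t else u0.
Local Notation v := regularized.

Let mG1 : measurable G1. Proof. exact: measurableD. Qed.

Lemma regularizedE t : W t -> ~ A t -> v t = u t.
Proof. by move=> Wt At; rewrite /regularized mem_set. Qed.

Lemma regularized_out t : ~ W t -> v t = u0.
Proof. by move=> Wt; rewrite /regularized memNset// => -[]. Qed.

Lemma regularized0 : v 0 = u0.
Proof. by apply: regularized_out; rewrite /= in_itv/= ltxx. Qed.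

Let vcase (Q : ('rV[R]_N -> R) -> Prop) : Q u0 ->
  (forall t, W t -> ~ A t -> Q (u t)) -> forall t, Q (v t).
Proof.
move=> Q0 Qu t; rewrite /regularized; case: ifPn => // /set_mem[Wt At]; exact: Qu.
Qed.

Lemma regularized_H10 t : H10 Omega (v t).
Proof. by move: t; apply: vcase. Qed.

Lemma regularized_A_fun : exists C : R, forall t, A_fun Omega (v t) <= C.
Proof.
exists (Num.max (A_fun Omega u0) (M ^+ 2)); apply: (@vcase (fun w => A_fun Omega w <= _)) => [|t Wt At].
  by rewrite le_max lexx.
rewrite le_max; apply/orP; right; have := uM Wt At; rewrite /norm_X => h.
rewrite -(sqr_sqrtr (A_fun_ge0 Omega (u t))) lerXn2r// ?nnegrE ?sqrtr_ge0//.
by apply: le_trans h; exact: sqrtr_ge0.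
Qed.

Lemma regularized_strongly_measurable : strongly_measurable Omega v.
Proof.
have [r [rs rv]] := strongly_measurable_cst oO fO Hu0.
apply: (strongly_measurable_if mG1 ss rs) => [t [Wt At]|t _]; first exact: us.
exact: rv.
Qed.

Let B t := ipO (y (v t)) (y (v t)).

Lemma regularized_B_bounded : exists C : R, forall t, B t <= C.
Proof.
have [C AC] := regularized_A_fun.
eexists => t; have [_] := sobolev oO bO (regularized_H10 t).
move=> /le_trans; apply; apply: powR_ge0_le; last first.
- by apply: ler_wpM2l (AC t); rewrite mulr_ge0// sqr_ge0.
- by rewrite !mulr_ge0 ?sqr_ge0// A_fun_ge0.
- by rewrite divr_ge0// subr_ge0 ler_nat.
Qed.

Let mv : measurable_fun (W `*` Omega) (fun z : measurableTypeR R * 'rV[R]_N => v z.1 z.2).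
Proof.
rewrite (_ : (fun z => _) = fun z => if z.1 \in G1 then u z.1 z.2 else u0 z.2); last first.
  by apply/funext => z; rewrite /regularized; case: ifP.
have mWO : measurable (W `*` Omega) by exact: measurableX.
apply: measurable_fun_if => //.
- apply: (measurable_fun_bool true).
  rewrite (_ : _ @^-1` _ = G1 `*` setT); last first.
    apply/seteqP; split => [z /= /set_mem|z [h _]]; first by [].
    exact: mem_set.
  by apply: measurableI => //; exact: measurableX.
- by apply: measurable_funS (weak_measurable hu).
- apply: (@measurable_funS _ _ _ _ (setT `*` Omega)) => //.
  + exact: measurableX.
  + by move=> z [[_ ?] _].
  + have m0 : measurable_fun Omega u0 by have [] := H1_sq oO (H10_H1 Hu0).
    move=> mX Y mY; rewrite (_ : _ `&` _ = setT `*` (Omega `&` u0 @^-1` Y)).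
      by apply: measurableX => //; exact: m0.
    by apply/seteqP; split => [[a b] /= [[_ h1] h2]|[a b] /= [_ [h1 h2]]].
Qed.

Let mvpow r : measurable_fun (W `*` Omega)
  (fun z : measurableTypeR R * 'rV[R]_N => abspow (v z.1) r z.2).
Proof. by apply: measurable_fun_powR; exact: measurableT_comp. Qed.

Let msnd (f : 'rV[R]_N -> R) : measurable_fun Omega f ->
  measurable_fun (W `*` Omega) (fun z : measurableTypeR R * 'rV[R]_N => f z.2).
Proof.
move=> mf _ Y mY; rewrite (_ : _ `&` _ = W `*` (Omega `&` f @^-1` Y)).
  by apply: measurableX => //; exact: mf.
by apply/seteqP; split => [[a b] /= [[h0 h1] h2]|[a b] /= [h0 [h1 h2]]].
Qed.

Let sy t : sqint mu Omega (y (v t)).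
Proof. exact: H10_sqint_abspow (regularized_H10 t). Qed.

Let iY2 : (leb \x mu)%E.-integrable (W `*` Omega)
  (EFin \o (fun z : measurableTypeR R * 'rV[R]_N => y (v z.1) z.2 ^+ 2)).
Proof.
have [C BC] := regularized_B_bounded.
apply: (@integrable_prod_bound _ _ _ _ R leb mu W Omega _ C) => //.
  by apply: measurable_funX; exact: mvpow.
apply/aeW => t _ /=.
rewrite (eq_integral (fun x => (y (v t) x ^+ 2)%:E)); last first.
  by move=> x _; rewrite ger0_norm ?sqr_ge0.
by rewrite -(ipE mO (sy t)) lee_fin; exact: BC.
Qed.

Lemma regularized_B_measurable : measurable_fun W B.
Proof.
have [i1 _ _ _] := fubini_real mW mO iY2.
apply/measurable_EFinP; case/integrableP : i1 => m1 _; move: m1.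
by congr (measurable_fun _ _); apply/funext => t; congr EFin; apply: eq_Rintegral.
Qed.

Lemma regularized_power_pairing_integrable w : H10 Omega w ->
  leb.-integrable W (fun t => (ipO (P (v t)) w)%:E).
Proof.
move=> Hw; have [C BC] := regularized_B_bounded.
have mw : measurable_fun Omega w by have [] := H1_sq oO (H10_H1 Hw).
have ipr : (leb \x mu)%E.-integrable (W `*` Omega)
    (EFin \o (fun z : measurableTypeR R * 'rV[R]_N => P (v z.1) z.2 * w z.2)).
  apply: (@integrable_prod_bound _ _ _ _ R leb mu W Omega _ (C + ipO (y w) (y w))) => //.
  - by apply: measurable_funM; [exact: mvpow|exact: msnd].
  - apply/aeW => t _ /=.
    apply: le_trans (integral_power_pairing_le oO bO (regularized_H10 t) Hw) _.
    by rewrite lee_fin lerD2r; exact: BC.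
by have [] := fubini_real mW mO ipr.
Qed.

Let product_pairing (F : measurableTypeR R * 'rV[R]_N -> R) (psi : 'rV[R]_N -> R) :
  measurable_fun (W `*` Omega) F ->
  (leb \x mu)%E.-integrable (W `*` Omega) (EFin \o (fun z => F z ^+ 2)) ->
  sqint mu Omega psi ->
  (leb \x mu)%E.-integrable (W `*` Omega) (EFin \o (fun z => F z * psi z.2)).
Proof.
move=> mF iF2 spsi; have [mpsi _] := spsi.
have mWO : measurable (W `*` Omega) by exact: measurableX.
have ip2 : (leb \x mu)%E.-integrable (W `*` Omega)
    (EFin \o (fun z : measurableTypeR R * 'rV[R]_N => psi z.2 ^+ 2)).
  apply: (@integrable_prod_bound _ _ _ _ R leb mu W Omega _ (ipO psi psi)) => //.
    by apply: measurable_funX; exact: msnd.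
  apply/aeW => t _ /=; rewrite (ipE mO spsi).
  by rewrite le_eqVlt; apply/orP; left; apply/eqP/eq_integral => x _; rewrite ger0_norm ?sqr_ge0.
apply: (le_integrable mWO _ _ (integrableD mWO iF2 ip2)).
  by apply/measurable_EFinP; apply: measurable_funM => //; exact: msnd.
move=> z _ /=; rewrite lee_fin [leRHS]ger0_norm ?addr_ge0 ?sqr_ge0//.
exact: norm_mul_le_sqr.
Qed.

Variable (g : R -> 'rV[R]_N -> R).
Hypotheses (L2g : L2_L2 Omega T g)
  (dg : is_time_derivative Omega T (fun (t : R) x => u t x `^ ((p_crit R N + 1) / 2)) g).

Let mg : measurable_fun (W `*` Omega) (fun z : measurableTypeR R * 'rV[R]_N => g z.1 z.2).
Proof. by case: L2g. Qed.

Let ig2 : (leb \x mu)%E.-integrable (W `*` Omega)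
  (EFin \o (fun z : measurableTypeR R * 'rV[R]_N => g z.1 z.2 ^+ 2)).
Proof.
apply/integrableP; split; first by apply/measurable_EFinP; exact: measurable_funX.
case: L2g => _; congr (_ < _)%E; apply: eq_integral => z _ /=.
by rewrite ger0_norm ?sqr_ge0.
Qed.

(** The weak derivative of u ^ q is tested with products of a time test function and psi, so
    that du Bois-Reymond applies to each psi separately. *)
Lemma time_derivative_primitive psi : sqint mu Omega psi ->
  exists c : R, \forall t \ae leb, 0 < t < T ->
    ipO (y (v t)) psi = c + \int[leb]_(r in `]0, t[) ipO (g r) psi.
Proof.
move=> spsi.
have i1 : leb.-integrable W (EFin \o (fun t => ipO (y (v t)) psi)).
  by have [] := fubini_real mW mO (product_pairing (mvpow q) iY2 spsi).
have i2 : leb.-integrable W (EFin \o (fun t => ipO (g t) psi)).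
  by have [] := fubini_real mW mO (product_pairing mg ig2 spsi).
apply: (du_bois_reymond T0 i1 i2) => eta teta.
apply: etrans (dg teta ((in_Lq2P oO psi).2 spsi)).
clear i1 i2; apply: (Rintegral_eq_off_null mA A0) => t Wt At.
congr (_ * _); rewrite (regularizedE Wt At) (p_crit_half R n).
have Ht := uH Wt At; have [mt _] := H1_sq oO (H10_H1 Ht).
apply: (ip_ae mO) => //.
- by apply: measurable_fun_powR; exact: measurableT_comp.
- exact: measurable_fun_powR.
- by case: spsi.
- by apply: filterS (uge0 Wt At) => x h Ox; rewrite /abspow ger0_norm// h.
Qed.

(** Testing against the indicators of countably many boxes is enough to recover the
    function; the whole space stands for the constant test. *)
Let box (k : nat) : set 'rV[R]_N :=
  if k isn't k'.+1 then setT else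
  if (unpickle k' : option ('rV[rat]_N * 'rV[rat]_N)) is Some ab then qbox ab else setT.

Let mbox k : measurable (box k).
Proof. by case: k => //= k; case: unpickle => [ab|]; [exact: measurable_qbox|]. Qed.

Let psi k : 'rV[R]_N -> R := \1_(box k).

Let spsi k : sqint mu Omega (psi k).
Proof.
apply: (@integrable_le_sqint _ _ _ mu _ mO _ (fun=> 1)).
- by apply: measurable_funTS; exact: measurable_indic.
- by split; [exact: measurable_cst|rewrite integral_cst// expr1n mul1e].
- by move=> x _; rewrite /psi indicE; case: (_ \in _); rewrite ?expr1n ?expr0n.
Qed.

Let G2 r := \int[mu]_(x in Omega) (g r x ^+ 2).

Let iG2 : leb.-integrable W (EFin \o G2).
Proof. by have [] := fubini_real mW mO ig2. Qed.

Let dist (a b : R) := ipO (fun x => y (v b) x - y (v a) x) (fun x => y (v b) x - y (v a) x).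

(** The increment of u ^ q and the time integral of its derivative g have the same integrals
    over all rational boxes, hence agree almost everywhere; Cauchy-Schwarz in time, then
    integrate over Omega. *)
Let holder a b : 0 <= a -> a <= b -> b < T ->
  (forall k, ipO (y (v b)) (psi k) - ipO (y (v a)) (psi k) =
    \int[leb]_(r in `]a, b[) ipO (g r) (psi k)) ->
  dist a b <= (b - a) * \int[leb]_(r in `]a, b[) G2 r.
Proof.
move=> a0 ab bT H.
pose V : set (measurableTypeR R) := `]a, b[%classic.
have mV : measurable V by exact: measurable_itv.
have VW : V `<=` W.
  move=> r; rewrite /V /= !in_itv/= => /andP[ar rb].
  by rewrite (le_lt_trans a0 ar) (lt_trans rb bT).
have mWO : measurable (W `*` Omega) by exact: measurableX.
have mVO : measurable (V `*` Omega) by exact: measurableX.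
have VOWO : V `*` Omega `<=` W `*` Omega by move=> z [/VW].
have igk k : (leb \x mu)%E.-integrable (V `*` Omega)
    (EFin \o (fun z : measurableTypeR R * 'rV[R]_N => g z.1 z.2 * psi k z.2)).
  by apply: integrableS (product_pairing mg ig2 (spsi k)).
have ig2V : (leb \x mu)%E.-integrable (V `*` Omega)
    (EFin \o (fun z : measurableTypeR R * 'rV[R]_N => g z.1 z.2 ^+ 2)).
  by apply: integrableS ig2.
pose Z x := \int[leb]_(r in V) g r x.
have s1 : sqint mu Omega (fun=> 1).
  by split; [exact: measurable_cst|rewrite integral_cst// expr1n mul1e].
have iZ : mu.-integrable Omega (EFin \o Z).
  have i1 := integrableS mWO mVO VOWO (product_pairing mg ig2 s1).
  have [_ + _ _] := fubini_real mV mO i1; apply: eq_integrable => // x _.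
  by congr EFin; apply: eq_Rintegral => r _; rewrite /= mulr1.
have sd : sqint mu Omega (fun x => y (v b) x - y (v a) x) by exact: sqintB.
have id := sq_integrable oO fO sd.
have iD : mu.-integrable Omega (EFin \o (fun x => y (v b) x - y (v a) x - Z x)).
  by have := integrableB mO id iZ; apply: eq_integrable.
have zero k : \int[mu]_(x in Omega) ((y (v b) x - y (v a) x - Z x) * psi k x) = 0.
  have E : \int[mu]_(x in Omega) (Z x * psi k x) =
      \int[leb]_(r in V) ipO (g r) (psi k).
    have [_ _ _ ->] := fubini_real mV mO (igk k).
    apply: eq_Rintegral => x _; rewrite /Z /psi /= indicE.
    case: (x \in box k) => /=; last first.
      by rewrite mulr0; under eq_Rintegral do rewrite mulr0; rewrite Rintegral_cst// mul0r.
    by rewrite mulr1; apply: eq_Rintegral => r _; rewrite mulr1.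
  have i1 := sqint_integrable mO sd (spsi k).
  have i2 : mu.-integrable Omega (EFin \o (fun x => Z x * psi k x)).
    have mZ : measurable_fun Omega Z by apply/measurable_EFinP; case/integrableP : iZ.
    apply: (le_integrable mO _ _ iZ).
      apply/measurable_EFinP; apply: measurable_funM => //.
      by apply: measurable_funTS; exact: measurable_indic.
    move=> x _ /=; rewrite lee_fin normrM /psi indicE.
    by case: (_ \in _); rewrite ?normr1 ?mulr1 ?normr0 ?mulr0.
  have : \int[mu]_(x in Omega) ((y (v b) x - y (v a) x) * psi k x) -
      \int[mu]_(x in Omega) (Z x * psi k x) = 0.
    rewrite E -(H k) -(ipBl mO (sy b) (sy a) (spsi k)); exact: subrr.
  rewrite -(RintegralB mO i1 i2) => <-.
  by apply: eq_Rintegral => x _; rewrite mulrBl.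
have ZE : \forall x \ae mu, Omega x -> y (v b) x - y (v a) x - Z x = 0.
  apply: (@integral_pi_system_eq0 _ _ R mu (@qboxes R N) Omega
    (fun x => y (v b) x - y (v a) x - Z x)).
  - exact: setI_closed_qboxes.
  - by move=> E mE; exact: measurable_g_qboxes.
  - exact: mO.
  - exact: iD.
  - by rewrite -(zero 0%N); apply: eq_Rintegral => x _; rewrite /psi indicT mulr1.
  - move=> E mE [cd _ cdE].
    rewrite -(zero (pickle cd).+1) [LHS]Rintegral_mkcond [RHS]Rintegral_mkcond.
    apply: eq_Rintegral => x _; rewrite !patchE in_setI /psi /= pickleK cdE indicE.
    by case: (x \in E); case: (x \in Omega); rewrite /= ?mulr1 ?mulr0.
  - by move=> E [cd _ <-]; exact: measurable_qbox.
pose Hx x := \int[leb]_(r in V) (g r x ^+ 2).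
have [_ iH _ EH] := fubini_real mV mO ig2V.
have iH' : mu.-integrable Omega (EFin \o (fun x => (b - a) * Hx x)).
  by have := integrableZl mO (b - a) iH; apply: eq_integrable.
have -> : \int[leb]_(r in `]a, b[) G2 r = \int[mu]_(x in Omega) Hx x by exact: EH.
rewrite -(RintegralZl _ mO iH); apply: (ae_le_Rintegral mO) => //.
  exact: sqint_integrable.
have sec := integrable_prod_swap_ae mV mO ig2V.
apply: filterS2 ZE sec => x ZEx secx Ox.
have -> : y (v b) x - y (v a) x = Z x by apply/eqP; rewrite -subr_eq0 ZEx.
have mgx : measurable_fun V (fun r => g r x).
  have mgV : measurable_fun (V `*` Omega) (fun z : measurableTypeR R * 'rV[R]_N => g z.1 z.2).
    by apply: measurable_funS mg.
  exact: (measurable_fun_section2 mV mO mgV Ox).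
have sgx : sqint leb V (fun r => g r x).
  split => //; have /integrableP[_] := secx Ox; congr (_ < _)%E.
  by apply: eq_integral => r _; rewrite /= ger0_norm ?sqr_ge0.
have s1V : sqint leb V (fun=> 1).
  split; first exact: measurable_cst.
  rewrite expr1n; have -> := integral_cst leb mV 1%E.
  by rewrite mul1e; exact: itv_oo_lty.
have := cauchy_schwarz_sqr mV s1V sgx.
have -> : ip leb V (fun=> 1) (fun=> 1) = b - a.
  by rewrite /ip (@Rintegral_eq_cst R _ _ _ 1)// ?mul1r// => r _; rewrite mulr1.
have -> : ip leb V (fun=> 1) (fun r => g r x) = Z x.
  by apply: eq_Rintegral => r _; rewrite mul1r.
have -> : ip leb V (fun r => g r x) (fun r => g r x) = Hx x by [].
by rewrite expr2.
Qed.

Let q1 : 1 < q. Proof. exact: sobolev_exponent_gt1. Qed.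

(** Small times that satisfy the initial condition and any property valid at almost every
    time. *)
Let initial (Q : R -> Prop) (e r : R) : (\forall t \ae leb, 0 < t < T -> Q t) ->
  0 < e -> 0 < r -> exists t, [/\ Q t, W t, ~ A t, 0 < t < r &
    (\int[mu]_(x in Omega) (`|u t x - u0 x| `^ (2 * q))%:E <= e%:E)%E].
Proof.
move=> aeQ e0 r0; have q20 : 0 < 2 * q by move: q1; lra.
have e'0 : 0 < e `^ (2 * q)^-1 by exact: powR_gt0.
have [dl dl0 H] := weak_initial hu e'0.
have aeA : \forall t \ae leb, ~ A t.
  by exists A; split => // t /= /contrapT.
have m0 : 0 < Num.min (Num.min r dl) T by rewrite !lt_min r0 dl0 T0.
have HA := @filterI _ _ (ae_filter_ringOfSetsType leb) _ _ H aeA.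
have HQ := @filterI _ _ (ae_filter_ringOfSetsType leb) _ _ HA aeQ.
have [t [/andP[t0 tm] [[nt At] Qt]]] := ae_exists m0 HQ.
move: tm; rewrite !lt_min -andbA => /and3P[tr tdl tT].
exists t; split; rewrite ?t0 ?tr//.
- by apply: Qt; rewrite t0.
- by rewrite /= in_itv/= t0.
- have {nt} : (norm_Lq Omega (p_crit R N + 1)%R (u t \- u0)%R < (e `^ (2 * q)^-1)%:E)%E.
    by apply: nt; rewrite t0.
  rewrite p_crit1 norm_LqE ?gt_eqF// => nt; rewrite leNgt; apply/negP => ex.
  move: nt; apply/negP; rewrite -leNgt -poweR_EFin.
  apply: gt0_ler_poweR; first by rewrite invr_ge0 ltW.
  - by rewrite in_itv/= leey andbT lee_fin ltW.
  - by rewrite in_itv/= leey andbT; apply: integral_ge0 => x _; rewrite lee_fin powR_ge0.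
  - exact: ltW.
Qed.

Let sd0 t : W t -> ~ A t -> measurable_fun Omega (fun x => (`|u t x - u0 x| `^ (2 * q))).
Proof.
move=> Wt At; have [mt _] := H1_sq oO (H10_H1 (uH Wt At)).
have [m0 _] := H1_sq oO (H10_H1 Hu0).
by apply: measurable_fun_powR; apply: measurableT_comp => //; exact: measurable_funB.
Qed.

(** The negative part of u0 is at most |u t - u0| when u t is nonnegative. *)
Lemma initial_nonneg : nonneg_on Omega u0.
Proof.
have q0 : 0 < q by exact: lt_trans q1.
have q20 : 0 <= 2 * q by move: q1; lra.
pose f x := Num.max (- u0 x) 0 `^ q.
have [m0 _] := H1_sq oO (H10_H1 Hu0).
have mf : measurable_fun Omega f.
  apply: measurable_fun_powR; apply: measurable_maxr; last exact: measurable_cst.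
  exact: measurableT_comp.
have fle x : 0 <= Num.max (- u0 x) 0 by rewrite le_max lexx orbT.
have sf : sqint mu Omega f.
  apply: (@integrable_le_sqint _ _ _ mu _ mO _ (y u0)) => //.
    exact: H10_sqint_abspow.
  move=> x _; rewrite lerXn2r ?nnegrE ?powR_ge0//; apply: powR_ge0_le => //.
  by rewrite ge_max normr_ge0 andbT -normrN ler_norm.
have f0 : ip mu Omega f f = 0.
  apply/eqP; rewrite eq_le ip_ge0 andbT; apply/ler_addgt0Pr => e e0; rewrite add0r.
  have aeT : \forall t \ae leb, 0 < t < T -> True by apply/aeW.
  have [t [_ Wt At _ le]] := initial aeT e0 ltr01.
  rewrite -lee_fin; apply: le_trans le; rewrite (ipE mO sf).
  apply: ae_ge0_le_integral => //.
  - by move=> x _; rewrite lee_fin sqr_ge0.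
  - by apply/measurable_EFinP; exact: measurable_funX.
  - by apply/measurable_EFinP; exact: sd0.
  apply: filterS (uge0 Wt At) => x h Ox; have {}h := h Ox.
  rewrite lee_fin -powR_mulrn ?powR_ge0// -powRrM [q * 2]mulrC.
  apply: powR_ge0_le => //; rewrite ge_max normr_ge0 andbT.
  by apply: le_trans (ler_norm _); rewrite lerDr.
apply: filterS (ip_eq0_ae mO sf f0) => x h Ox; have {}h := h Ox.
move/eqP: h; rewrite powR_eq0 => /andP[/eqP h _].
rewrite -oppr_le0; apply: (@le_trans _ _ (Num.max (- u0 x) 0)); last by rewrite h.
by rewrite le_max lexx.
Qed.

Lemma regularized_nonneg t : nonneg_on Omega (v t).
Proof. by move: t; apply: vcase => //; exact: initial_nonneg. Qed.

Let initial_dist (Q : R -> Prop) (e r : R) : (\forall t \ae leb, 0 < t < T -> Q t) ->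
  0 < e -> 0 < r -> exists t, [/\ Q t, 0 < t < r & dist 0 t <= e].
Proof.
move=> aeQ e0 r0; have q0 : 0 < q by exact: lt_trans q1.
pose B0 := ipO (y u0) (y u0); have B00 : 0 <= B0 by exact: ip_ge0.
pose k := q ^+ 2 * (4 `^ q * B0) + 1.
have k0 : 0 < k by rewrite ltr_wpDl// !mulr_ge0 ?sqr_ge0 ?powR_ge0.
pose m := e / (2 * k); have m0 : 0 < m by rewrite divr_gt0// mulr_gt0.
pose l := q ^+ 2 * (m * 4 `^ q + m `^ (1 - q)) + 1.
have l0' : 0 <= q ^+ 2 * (m * 4 `^ q + m `^ (1 - q)).
  by rewrite mulr_ge0 ?sqr_ge0// addr_ge0 ?powR_ge0// mulr_ge0 ?powR_ge0// ltW.
have l0 : 0 < l by rewrite ltr_wpDl.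
have e'0 : 0 < e / (2 * l) by rewrite divr_gt0// mulr_gt0.
have [t [Qt Wt At tr le]] := initial aeQ e'0 r0; exists t; split => //.
have Ht := uH Wt At; have su0 := H10_sqint_abspow oO bO Hu0.
have sut := H10_sqint_abspow oO bO Ht; have sd := sqintB mO sut su0.
rewrite /dist regularized0 (regularizedE Wt At).
pose a1 := q ^+ 2 * (m * 4 `^ q); pose a2 := q ^+ 2 * (m * 4 `^ q + m `^ (1 - q)).
have pt x : (y (u t) x - y u0 x) ^+ 2 <= a1 * y u0 x ^+ 2 + a2 * `|u t x - u0 x| `^ (2 * q).
  have := sqr_powR_sub_le q1 (normr_ge0 (u t x)) (normr_ge0 (u0 x)) m0.
  move=> /le_trans; apply; rewrite abspow_sqr mulrDr [X in X + _]mulrA [X in _ + X]mulrA.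
  apply: lerD => //; apply: ler_wpM2l; first exact: l0'.
  by apply: powR_ge0_le => //; exact: ler_dist_dist.
have mD := sd0 Wt At.
have iu : mu.-integrable Omega (EFin \o (fun x => `|u t x - u0 x| `^ (2 * q))).
  apply/integrableP; split; first exact/measurable_EFinP.
  apply: le_lt_trans (ltry (e / (2 * l))); apply: le_trans le.
  by under eq_integral do rewrite /= ger0_norm ?powR_ge0//.
have i0 := sqint_integrable_sqr su0.
have i1 : mu.-integrable Omega (EFin \o (fun x => a1 * y u0 x ^+ 2)).
  by have := integrableZl mO a1 i0; apply: eq_integrable.
have i2 : mu.-integrable Omega (EFin \o (fun x => a2 * `|u t x - u0 x| `^ (2 * q))).
  by have := integrableZl mO a2 iu; apply: eq_integrable.
apply: (@le_trans _ _ (\int[mu]_(x in Omega) (a1 * y u0 x ^+ 2 + a2 * `|u t x - u0 x| `^ (2 * q)))).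
  apply: (le_Rintegral mO) => //; first exact: sqint_integrable.
    by have := integrableD mO i1 i2; apply: eq_integrable.
  by move=> x _; rewrite -expr2.
rewrite (RintegralD mO i1 i2) (RintegralZl _ mO i0) (RintegralZl _ mO iu).
have -> : \int[mu]_(x in Omega) (y u0 x ^+ 2) = B0 by apply: eq_Rintegral => x _; rewrite expr2.
have leu : \int[mu]_(x in Omega) (`|u t x - u0 x| `^ (2 * q)) <= e / (2 * l).
  by rewrite -lee_fin /Rintegral fineK//; exact: integrable_fin_num.
have h1 : a1 * B0 <= e / 2.
  have -> : a1 * B0 = m * (k - 1) by rewrite /a1 /k; ring.
  apply: (@le_trans _ _ (m * k)); first by rewrite ler_wpM2l ?(ltW m0)// gerBl.
  by rewrite le_eqVlt; apply/orP; left; apply/eqP; rewrite /m; field; rewrite gt_eqF.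
have h2 : a2 * \int[mu]_(x in Omega) (`|u t x - u0 x| `^ (2 * q)) <= e / 2.
  apply: (@le_trans _ _ (l * (e / (2 * l)))).
    apply: ler_pM => //; last by rewrite lerDl.
    by apply: Rintegral_ge0 => x _; exact: powR_ge0.
  by rewrite le_eqVlt; apply/orP; left; apply/eqP; field; rewrite gt_eqF.
by rewrite [leRHS](splitr e) lerD.
Qed.

(** One null set of times serves all the boxes, since these are countably many. *)
Lemma time_derivative_constants : exists c : nat -> R,
  \forall t \ae leb, forall k, 0 < t < T ->
    ipO (y (v t)) (psi k) = c k + \int[leb]_(r in `]0, t[) ipO (g r) (psi k).
Proof.
have [c Hc] := choice (fun k => time_derivative_primitive (spsi k)).
by exists c; apply: (ae_foralln Hc).
Qed.

Section continuity_times.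
Variable c : nat -> R.
Hypothesis Hc : \forall t \ae leb, forall k, 0 < t < T ->
  ipO (y (v t)) (psi k) = c k + \int[leb]_(r in `]0, t[) ipO (g r) (psi k).

Definition continuity_times : set (measurableTypeR R) := [set t | [/\ W t, ~ A t &
  forall k, ipO (y (v t)) (psi k) = c k + \int[leb]_(r in `]0, t[) ipO (g r) (psi k)]].
Local Notation G := continuity_times.
Let G0 t := t = 0 \/ G t.

Lemma continuity_timesW : G `<=` `]0, T[%classic. Proof. by move=> t []. Qed.

Lemma continuity_times_ae : \forall t \ae leb, 0 < t < T -> G t.
Proof.
have aeA : \forall t \ae leb, ~ A t by exists A; split => // t /= /contrapT.
apply: (@filterS2 _ _ (ae_filter_ringOfSetsType leb) _ _ _ _ Hc aeA) => t h At t0.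
by split; [rewrite /= in_itv|exact: At|move=> k; exact: h].
Qed.

(** Time is capped at T, up to which G2 is integrable: this makes the function monotone on
    the whole line. *)
Definition energy_dissipation t := \int[leb]_(r in `]0, (Num.min t T)[) G2 r.
Local Notation gam := energy_dissipation.

Let G20 r : 0 <= G2 r. Proof. by apply: Rintegral_ge0 => x _; exact: sqr_ge0. Qed.

Let iG2' a b : 0 <= a -> b <= T -> leb.-integrable `]a, b[ (EFin \o G2).
Proof. by move=> a0 bT; exact: (integrable_sub_itv a0 bT iG2). Qed.

Lemma energy_dissipation_ge0 a b : a <= b -> gam a <= gam b.
Proof.
move=> ab; rewrite /energy_dissipation.
have mab : Num.min a T <= Num.min b T by rewrite le_min !ge_min ab lexx orbT.
have [a0|a0] := leP (Num.min a T) 0.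
  by rewrite [leLHS]Rintegral_itv_empty//; exact: Rintegral_ge0.
have bT : Num.min b T <= T by rewrite ge_min lexx orbT.
rewrite (Rintegral_split (ltW a0) mab (iG2' (lexx 0) bT)) lerDl.
exact: Rintegral_ge0.
Qed.

Let gam_sub a b : 0 <= a -> a <= b -> b < T -> gam b - gam a = \int[leb]_(r in `]a, b[) G2 r.
Proof.
move=> a0 ab bT; rewrite /energy_dissipation !min_l ?(ltW bT) ?(ltW (le_lt_trans ab bT))//.
by rewrite (Rintegral_split a0 ab (iG2' (lexx 0) (ltW bT))) addrAC subrr add0r.
Qed.

Let holdG a b : G a -> G b -> a <= b -> dist a b <= (b - a) * (gam b - gam a).
Proof.
move=> [Wa _ Ha] [Wb _ Hb] ab.
move: Wa Wb; rewrite /= !in_itv/= => /andP[a0 aT] /andP[b0 bT].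
rewrite (gam_sub (ltW a0) ab bT); apply: (holder (ltW a0) ab bT) => k.
have i2 : leb.-integrable W (EFin \o (fun t => ipO (g t) (psi k))).
  by have [] := fubini_real mW mO (product_pairing mg ig2 (spsi k)).
have i2b := integrable_sub_itv (lexx 0) (ltW bT) i2.
rewrite Ha Hb (Rintegral_split (ltW a0) ab i2b).
by rewrite opprD addrACA subrr add0r addrAC subrr add0r.
Qed.

(** Time 0 is reached through good times s0 that are small and at which the solution is
    close to u0. *)
Lemma continuity_times_holder a b : G0 a -> G0 b -> a <= b ->
  dist a b <= (b - a) * (gam b - gam a).
Proof.
have dd a' : dist a' a' = 0.
  transitivity (\int[mu]_(x in Omega) (0 : R)); last by rewrite Rintegral_cst// mul0r.
  by apply: eq_Rintegral => x _; rewrite subrr mul0r.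
case=> [->|Ga]; case=> [->|Gb] ab.
- by rewrite dd !subrr mul0r.
- set X := _ * _.
  have b0 : 0 < b by case: Gb => + _ _; rewrite /= in_itv/= => /andP[].
  have X0 : 0 <= X by rewrite mulr_ge0 ?subr_ge0 ?energy_dissipation_ge0.
  have D0 a' b' : 0 <= dist a' b' by exact: ip_ge0.
  suff : Num.sqrt (dist 0 b) <= Num.sqrt X by rewrite ler_sqrt.
  apply/ler_addgt0Pr => e e0.
  have [s0 [Gs /andP[s00 s0b] de]] := initial_dist continuity_times_ae (exprn_gt0 2 e0) b0.
  have sd1 : sqint mu Omega (fun x => y (v s0) x - y (v 0) x) by exact: sqintB.
  have sd2 : sqint mu Omega (fun x => y (v b) x - y (v s0) x) by exact: sqintB.
  have := ip_triangle mO sd1 sd2.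
  have -> : (fun x => y (v s0) x - y (v 0) x + (y (v b) x - y (v s0) x)) =
      (fun x => y (v b) x - y (v 0) x).
    by apply/funext => x; rewrite addrC subrKA.
  move=> /le_trans; apply; rewrite addrC; apply: lerD.
    rewrite ler_wsqrtr//; apply: (le_trans (holdG Gs Gb (ltW s0b))).
    apply: ler_pM; rewrite ?subr_ge0 ?energy_dissipation_ge0 ?(ltW s0b)//.
      by rewrite lerB// ltW.
    by rewrite lerB// energy_dissipation_ge0// ltW.
  by rewrite -[leRHS]sqrtr_sqr_nneg ?(ltW e0)// ler_wsqrtr.
- by case: Ga => + _ _; rewrite /= in_itv/= => /andP[a0 _]; rewrite leNgt a0 in ab.
- exact: holdG.
Qed.

Let time_test_bounded eta : time_test_function T eta ->
  measurable_fun W eta /\ exists C : R, forall x, `|eta x| <= C.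
Proof.
move=> [sm cpt _]; have ceta : continuous eta by exact: smooth1_continuous.
split; first by apply: measurable_funTS; exact: continuous_measurable_fun.
have := @compact_bounded R _ _ (continuous_compact _ cpt).
move=> /(_ _ eta)/(_ (continuous_subspaceT ceta)).
move=> [C [Cr HC]]; exists (`|C| + 1) => x.
have [ex|ex] := eqVneq (eta x) 0; first by rewrite ex normr0 addr_ge0.
apply: (HC (`|C| + 1)); first by apply: (le_lt_trans (ler_norm _)); rewrite ltrDl.
by exists x => //; apply: subset_closure; apply/eqP.
Qed.

(** Du Bois-Reymond gives the integrated equation for almost all times, with an exceptional
    set that depends on w.  The pairing with u ^ p is continuous along good times, and
    primitive_dense removes this dependence. *)
Lemma continuity_times_equation w a b : H10 Omega w -> G0 a -> G0 b -> a <= b ->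
  ipO (P (v b)) w - ipO (P (v a)) w =
  \int[leb]_(r in `]a, b[) (ipO (P (v r)) w - gp (v r) w).
Proof.
move=> Hw Ga Gb ab.
pose f t := ipO (P (v t)) w; pose k t := f t - gp (v t) w.
have i1 : leb.-integrable W (EFin \o f) by exact: regularized_power_pairing_integrable.
have [CB HCB] := regularized_B_bounded; have [CA HCA] := regularized_A_fun.
have B0 t : 0 <= B t by exact: ip_ge0.
have CB0 : 0 <= CB by apply: le_trans (HCB 0).
have gpM t : `|gp (v t) w| <= Num.sqrt CA * norm_X Omega w.
  apply: le_trans (grad_pair_le oO fO (H10_H1 (regularized_H10 t)) (H10_H1 Hw)) _.
  by rewrite ler_wpM2r ?sqrtr_ge0// ler_wsqrtr.
have mgp : measurable_fun W (fun t => gp (v t) w).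
  have mK := grad_pair_measurable oO fO regularized_strongly_measurable
    (strongly_measurable_cst oO fO Hw) (fun t => H10_H1 (regularized_H10 t))
    (fun=> H10_H1 Hw).
  by apply: measurable_funTS; exact: (measurableT_comp mK (measurable_pair2 (0 : R))).
have i2 : leb.-integrable W (EFin \o (fun t => gp (v t) w)) by exact: (integrable_bounded_itv mgp gpM).
have ik : leb.-integrable W (EFin \o k).
  by have := integrableB mW i1 i2; apply: eq_integrable.
pose Bw := ipO (y w) (y w).
have kC t : `|k t| <= CB + Bw + Num.sqrt CA * norm_X Omega w.
  apply: le_trans (ler_normB _ _) _; apply: lerD => //.
  apply: le_trans (power_pairing_bound oO bO (regularized_H10 t) Hw) _.
  by rewrite lerD2r; exact: HCB.
have weak : forall eta, time_test_function T eta ->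
    \int[leb]_(t in W) (eta^`()%classic t * f t) = - \int[leb]_(t in W) (eta t * k t).
  move=> eta teta; have := weak_equation hu teta Hw.
  have [meta [C etaC]] := time_test_bounded teta.
  have same t : W t -> ~ A t ->
      L2pair Omega (fun x => u t x `^ p_crit R N) w = f t /\
      L2pair Omega (fun x => `|u t x| `^ p_crit R N) w = f t.
    move=> Wt At; rewrite (p_critE R n) /f (regularizedE Wt At); split; last exact: erefl.
    have [mt _] := H1_sq oO (H10_H1 (uH Wt At)); have [mw _] := H1_sq oO (H10_H1 Hw).
    apply: (ip_ae mO) => //.
    - exact: measurable_fun_powR.
    - by apply: measurable_fun_powR; exact: measurableT_comp.
    - by apply: filterS (uge0 Wt At) => x h Ox; rewrite /abspow ger0_norm// h.
  have -> : \int[leb]_(t in W) (eta^`()%classic t * L2pair Omega (fun x => u t x `^ p_crit R N) w) =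
      \int[leb]_(t in W) (eta^`()%classic t * f t).
    by apply: (Rintegral_eq_off_null mA A0) => t Wt At; have [-> _] := same t Wt At.
  have -> : \int[leb]_(t in W) (eta t * L2pair Omega (fun x => `|u t x| `^ p_crit R N) w) =
      \int[leb]_(t in W) (eta t * f t).
    by apply: (Rintegral_eq_off_null mA A0) => t Wt At; have [_ ->] := same t Wt At.
  have -> : \int[leb]_(t in W) (eta t * gp (u t) w) = \int[leb]_(t in W) (eta t * gp (v t) w).
    by apply: (Rintegral_eq_off_null mA A0) => t Wt At; rewrite (regularizedE Wt At).
  have -> : \int[leb]_(t in W) (eta t * k t) =
      \int[leb]_(t in W) (eta t * f t) - \int[leb]_(t in W) (eta t * gp (v t) w).
    rewrite -(RintegralB mW (integrable_bounded_mul meta etaC i1)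
      (integrable_bounded_mul meta etaC i2)).
    by apply: eq_Rintegral => t _; rewrite /k mulrBr.
  exact: weak_identity_swap.
have [c0 Hc0] := du_bois_reymond T0 i1 ik weak.
pose Gam := \int[leb]_(r in W) G2 r + 1.
have Gam0 : 0 < Gam by rewrite ltr_wpDl//; exact: Rintegral_ge0.
have gG a' b' : 0 <= a' -> a' <= b' -> b' < T -> gam b' - gam a' <= Gam.
  move=> a0 ab' bT; apply: (@le_trans _ _ (gam T - gam 0)).
    by rewrite lerB// energy_dissipation_ge0// ltW.
  rewrite /energy_dissipation min_r// [X in _ - X]Rintegral_itv_empty ?subr0.
    by rewrite lerDl.
  by rewrite ge_min lexx.
have G0W t : G0 t -> 0 <= t < T.
  case=> [->|[+ _ _]]; first by rewrite lexx T0.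
  by rewrite /= in_itv/= => /andP[/ltW -> ->].
have hd t t' : G0 t -> G0 t' -> dist t t' <= `|t' - t| * Gam.
  wlog tt : t t' / t <= t' => [H|] Gt Gt'.
    have [tt|/ltW tt] := leP t t'; first exact: H.
    have -> : dist t t' = dist t' t by apply: eq_Rintegral => x _; ring.
    by rewrite distrC; exact: H.
  have /andP[t0 tT] := G0W _ Gt; have /andP[t'0 t'T] := G0W _ Gt'.
  apply: le_trans (continuity_times_holder Gt Gt' tt) _.
  by rewrite ger0_norm ?subr_ge0// ler_wpM2l ?subr_ge0// gG.
pose K2 := 2 * Num.sqrt (CB + CB + Bw) + 1.
have K20 : 0 < K2 by rewrite ltr_wpDl// mulr_ge0// sqrtr_ge0.
have cont t : G0 t -> forall e, 0 < e ->
    exists2 r, 0 < r & forall s', G s' -> `|s' - t| < r -> `|f s' - f t| <= e.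
  move=> Gt e e0; exists ((e / K2) ^+ 2 / Gam); first by rewrite divr_gt0// exprn_gt0// divr_gt0.
  move=> s' Gs' st; have Gs0 : G0 s' by right.
  apply: le_trans (power_pairing_dist oO bO (regularized_H10 t) (regularized_H10 s') Hw) _.
  rewrite mulrA; apply: (@le_trans _ _ (K2 * (e / K2))); last by rewrite mulrC divfK// gt_eqF.
  apply: ler_pM; rewrite ?mulr_ge0 ?sqrtr_ge0//.
    apply: (@le_trans _ _ (2 * Num.sqrt (CB + CB + Bw))); last by rewrite lerDl.
    by rewrite ler_wpM2l// ler_wsqrtr// lerD2r lerD//; exact: HCB.
  rewrite -[leRHS]sqrtr_sqr_nneg ?divr_ge0 ?(ltW e0) ?(ltW K20)//.
  rewrite ler_wsqrtr//; apply: (le_trans (hd _ _ Gt Gs0)).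
  by rewrite -ler_pdivlMr// ltW.
have prim t : G0 t -> f t = c0 + \int[leb]_(r in `]0, t[) k r.
  by move=> Gt; apply: (primitive_dense T0 ik kC continuity_times_ae Hc0 (G0W _ Gt) (cont _ Gt)).
have /andP[a0 aT] := G0W _ Ga; have /andP[b0 bT] := G0W _ Gb.
have ikb := integrable_sub_itv (lexx 0) (ltW bT) ik.
rewrite -/(f b) -/(f a) (prim _ Ga) (prim _ Gb) (Rintegral_split a0 ab ikb).
by rewrite opprD addrACA subrr add0r addrAC subrr add0r.
Qed.

Lemma continuity_times_energy b : G b -> E_fun Omega (v b) <= E_fun Omega u0.
Proof.
move=> Gb; have [CA HCA] := regularized_A_fun.
have := energy_decrease oO bO continuity_timesW continuity_times_ae regularized_H10 HCA
  regularized_nonneg regularized_strongly_measurable energy_dissipation_ge0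
  continuity_times_holder continuity_times_equation regularized_power_pairing_integrable
  regularized_B_measurable Gb.
have BE w : B_fun Omega w = ipO (y w) (y w).
  rewrite /B_fun p_crit1; apply: eq_Rintegral => x _; rewrite -expr2 abspow_sqr//.
by rewrite regularized0 /E_fun !BE p_crit1.
Qed.

End continuity_times.
End good_times.

(** * The potential well *)
Section potential_well.
Context (R : realType) (n : nat) (Omega : set 'rV[R]_n.+3).
Hypotheses (oO : open Omega) (bO : bounded_set Omega).
Local Notation N := n.+3.
Local Notation mu := (lebesgue_rV R N).
Local Notation q := (N%:R / (N%:R - 2) : R).
Implicit Types w : 'rV[R]_N -> R.

Let mO : measurable Omega. Proof. exact: open_measurable_rV. Qed.
Let fO : (mu Omega < +oo)%E. Proof. exact: bounded_lty. Qed.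

Let q1 : 1 < q. Proof. exact: sobolev_exponent_gt1. Qed.

Let half_gap : 2^-1 - (2 * q)^-1 = N%:R^-1.
Proof.
have N3 : 3 <= N%:R :> R by rewrite ler_nat.
move: N3; move: (N%:R : R) => t t3; field.
by apply/andP; split; rewrite gt_eqF//; lra.
Qed.

Lemma B_funE w : B_fun Omega w = ip mu Omega (abspow w q) (abspow w q).
Proof. by rewrite /B_fun p_crit1; apply: eq_Rintegral => x _; rewrite -expr2 abspow_sqr. Qed.

Lemma E_funE w : E_fun Omega w = 2^-1 * A_fun Omega w - (2 * q)^-1 * B_fun Omega w.
Proof. by rewrite /E_fun p_crit1. Qed.

Lemma B_fun_ge0 w : 0 <= B_fun Omega w.
Proof. by rewrite B_funE ip_ge0. Qed.

Lemma B_fun_scale l w : 0 <= l -> H10 Omega w ->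
  B_fun Omega (fun x => l * w x) = l `^ (2 * q) * B_fun Omega w.
Proof.
move=> l0 Hw; rewrite /B_fun p_crit1 -(RintegralZl _ mO).
  by apply: eq_Rintegral => x _; rewrite normrM (ger0_norm l0) powRM.
have := sqint_integrable_sqr (H10_sqint_abspow oO bO Hw).
by apply: eq_integrable => // x _; rewrite /= abspow_sqr.
Qed.

(** D >= 0 means B <= A, and 1 / 2 - 1 / (2 q) = 1 / N. *)
Lemma B_fun_le_energy w : 0 <= D_fun Omega w -> B_fun Omega w <= N%:R * E_fun Omega w.
Proof.
rewrite /D_fun subr_ge0 => BA; rewrite mulrC -ler_pdivrMr ?ltr0n// E_funE mulrC -half_gap.
by rewrite mulrBl lerD2r ler_wpM2l.
Qed.

Lemma nehari_energy w : D_fun Omega w = 0 -> E_fun Omega w = N%:R^-1 * B_fun Omega w.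
Proof. by move=> /subr0_eq AB; rewrite E_funE AB -mulrBl half_gap. Qed.

Lemma D_fun_lt0_A_gt0 w : H10 Omega w -> D_fun Omega w < 0 ->
  0 < A_fun Omega w /\ 0 < B_fun Omega w.
Proof.
move=> Hw; rewrite /D_fun subr_lt0 => AB; have A0 := A_fun_ge0 Omega w.
have B0 : 0 < B_fun Omega w by exact: le_lt_trans AB.
split => //; rewrite lt_def A0 andbT; apply/eqP => Az.
have [_] := sobolev oO bO Hw; rewrite Az mulr0 powR0 -?B_funE; first by rewrite leNgt B0.
by rewrite gt_eqF// (lt_trans _ q1).
Qed.

(** On the ray through w the Nehari manifold is met at the scale l with
    l ^ (2 q - 2) = A / B, which is below 1 when D < 0; there the energy is
    l ^ (2 q) B / N. *)
Lemma d_level_le w : H10 Omega w -> D_fun Omega w < 0 ->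
  N%:R * d_level Omega <= B_fun Omega w.
Proof.
move=> Hw Dw; have [A0 B0] := D_fun_lt0_A_gt0 Hw Dw.
have AB : A_fun Omega w < B_fun Omega w by move: Dw; rewrite /D_fun subr_lt0.
rewrite mulrC -ler_pdivlMr ?ltr0n//.
have q20 : 0 < 2 * q - 2 by move: q1; lra.
pose l := (A_fun Omega w / B_fun Omega w) `^ (2 * q - 2)^-1.
have AB0 : 0 < A_fun Omega w / B_fun Omega w by rewrite divr_gt0.
have l0 : 0 < l by exact: powR_gt0.
have lq : l `^ (2 * q - 2) = A_fun Omega w / B_fun Omega w.
  by rewrite -powRrM mulVf ?gt_eqF// powRr1// ltW.
have l2q : l `^ (2 * q) = l ^+ 2 * (A_fun Omega w / B_fun Omega w).
  by rewrite -lq -powR_mulrn ?(ltW l0)// -powRD ?subrKC// (gt_eqF l0) implybT.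
have p1 r : (1 : R) `^ r = 1 by rewrite powR1.
have l1 : l `^ (2 * q) <= 1.
  rewrite -[leRHS](p1 (2 * q)); apply: powR_ge0_le; rewrite ?(ltW l0)//.
  rewrite -[leRHS](p1 (2 * q - 2)^-1); apply: powR_ge0_le; rewrite ?(ltW AB0)//.
    by rewrite invr_ge0 ltW.
  by rewrite ler_pdivrMr// mul1r ltW.
have H1w := H10_H1 Hw.
have Dl : D_fun Omega (fun x => l * w x) = 0.
  rewrite /D_fun (A_fun_scale oO fO)// (B_fun_scale (ltW l0) Hw) l2q.
  by rewrite -mulrA divfK ?gt_eqF// subrr.
have nl : nehari Omega (fun x => l * w x).
  split; [exact: (H10_scale oO fO)|exact: Dl|move=> lw0].
  have : B_fun Omega (fun x => l * w x) = 0.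
    rewrite B_funE; have slw := H10_sqint_abspow oO bO (H10_scale oO fO l Hw).
    have [mlw _] := slw.
    rewrite (ip_ae mO mlw (measurable_cst (0 : R)) mlw).
      transitivity (\int[mu]_(x in Omega) (0 : R)); last by rewrite Rintegral_cst// mul0r.
      by apply: eq_Rintegral => x _; rewrite mul0r.
    by apply: filterS lw0 => x h Ox; rewrite /abspow h// normr0 powR0// gt_eqF.
  by rewrite (B_fun_scale (ltW l0) Hw) => /eqP; rewrite gt_eqF// mulr_gt0// powR_gt0.
have lb : has_lbound [set E_fun Omega w | w in nehari Omega].
  exists 0 => _ [z [_ Dz _] <-]; rewrite (nehari_energy Dz).
  by apply: mulr_ge0; [rewrite invr_ge0 ler0n|exact: B_fun_ge0].
apply: (@le_trans _ _ (E_fun Omega (fun x => l * w x))).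
  by apply: (ge_inf lb); exists (fun x => l * w x).
rewrite nehari_energy// (B_fun_scale (ltW l0) Hw) mulrC ler_wpM2r ?invr_ge0//.
by rewrite ler_piMl// ltW.
Qed.

End potential_well.

(** A quantity that never takes values in a gap ]a, b[ and is uniformly continuous
    along a conull set of times keeps the side of the gap on which it starts. *)
Lemma gap_preserved (R : realType) (T a b Gam : R) (G : set R) (B : R -> R) :
  0 < T -> 0 <= a -> a < b -> 0 < Gam ->
  (\forall t \ae (@lebesgue_measure R), 0 < t < T -> G t) -> (forall t, G t -> 0 < t < T) ->
  (forall s t, (s = 0 \/ G s) -> (t = 0 \/ G t) -> s <= t ->
    Num.sqrt (B s) <= Num.sqrt (B t) + Num.sqrt ((t - s) * Gam)) ->
  (forall t, G t -> B t <= a \/ b <= B t) -> b <= B 0 -> forall t, G t -> b <= B t.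
Proof.
move=> T0 a0 ab Gam0 aeG GT cB alt B0.
pose d := Num.sqrt b - Num.sqrt a.
have d0 : 0 < d by rewrite subr_gt0 ltr_sqrt// (le_lt_trans a0 ab).
(* Within time r the square root of B moves by at most half the gap. *)
pose r := (d / 2) ^+ 2 / Gam.
have r0 : 0 < r by rewrite divr_gt0// exprn_gt0// divr_gt0.
have step s t : (s = 0 \/ G s) -> G t -> s <= t -> t - s <= r -> b <= B s -> b <= B t.
  move=> Gs Gt st ts Bs; case: (alt _ Gt) => // Bt.
  have := cB _ _ Gs (or_intror Gt) st.
  have h1 : Num.sqrt b <= Num.sqrt (B s) by exact: ler_wsqrtr.
  have h2 : Num.sqrt (B t) <= Num.sqrt a by exact: ler_wsqrtr.
  have h3 : Num.sqrt ((t - s) * Gam) <= d / 2.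
    rewrite -[leRHS]sqrtr_sqr_nneg ?divr_ge0 ?(ltW d0)//.
    by rewrite ler_wsqrtr// -ler_pdivlMr.
  by move: h1 h2 h3 d0; rewrite /d; lra.
have H k : forall t, G t -> t <= k%:R * (r / 2) -> b <= B t.
  elim: k => [|k IH] t Gt tk.
    by have /andP[t0 _] := GT _ Gt; move: tk; rewrite mul0r leNgt t0.
  have /andP[t0 tT] := GT _ Gt.
  have [tr|rt] := leP t r; first by apply: (step 0 t) => //; [left|exact: ltW|rewrite subr0].
  have [s [/andP[s1 s2] Gs]] : exists s, t - r < s < t - r / 2 /\ (0 < s < T -> G s).
    by apply: ae_exists => //; rewrite ltrD2l ltrN2 ltr_pdivrMr// ltr_pMr// ltr1n.
  have {}Gs : G s.
    apply: Gs; rewrite (lt_trans _ s1) ?subr_gt0//= (lt_trans s2)//.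
    by rewrite ltrBlDr ltr_wpDr// divr_ge0// ltW.
  apply: (step s t) => //; first by right.
  - by rewrite ltW// (lt_le_trans s2)// gerBl divr_ge0// ltW.
  - by rewrite lerBlDr -lerBlDl ltW.
  - apply: IH => //; rewrite ltW// (lt_le_trans s2)// lerBlDr (le_trans tk)//.
    by rewrite -[k.+1%:R]natr1 mulrDl mul1r.
(* Each step advances by r / 2 only, since the intermediate time must be a good one. *)
move=> t Gt; apply: (H (Num.truncn (t / (r / 2))).+1 t Gt).
have r2 : 0 < r / 2 by rewrite divr_gt0.
by rewrite -(ler_pdivrMr _ _ r2); exact: (ltW (truncnS_gt _)).
Qed.

(** * Growth of the integral *)
Section blow_up.
Context (R : realType) (n : nat) (Omega : set 'rV[R]_n.+3).
Hypotheses (oO : open Omega) (bO : bounded_set Omega).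
Local Notation N := n.+3.
Local Notation mu := (lebesgue_rV R N).
Local Notation leb := (@lebesgue_measure R).
Local Notation q := (N%:R / (N%:R - 2) : R).

Let mO : measurable Omega. Proof. exact: open_measurable_rV. Qed.
Let fO : (mu Omega < +oo)%E. Proof. exact: bounded_lty. Qed.

Lemma norm_Lq_B_fun w : H10 Omega w ->
  fine (norm_Lq Omega (p_crit R N + 1)%R w) `^ (p_crit R N + 1) = B_fun Omega w.
Proof.
move=> Hw; have q20 : 0 < 2 * q by have := sobolev_exponent_gt1 R n; lra.
have sw := H10_sqint_abspow oO bO Hw; rewrite B_funE p_crit1 norm_LqE ?gt_eqF//.
have -> : (\int[mu]_(x in Omega) (`|w x| `^ (2 * q))%:E =
    (ip mu Omega (abspow w q) (abspow w q))%:E)%E.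
  by rewrite (ipE mO sw); apply: eq_integral => x _; rewrite abspow_sqr.
rewrite poweR_EFin/= -powRrM mulVf ?gt_eqF// powRr1//; exact: ip_ge0.
Qed.

Variables (u0 : 'rV[R]_N -> R) (u : R -> 'rV[R]_N -> R).
Hypotheses (Hu0 : H10 Omega u0) (hE : E_fun Omega u0 < d_level Omega)
  (hD : D_fun Omega u0 < 0).

(** When the energy is negative, A >= 0 alone bounds B below through E <= E u0; the gap
    argument asks for a nonnegative lower end. *)
Let c := if E_fun Omega u0 < 0 then 2 * q * - E_fun Omega u0 else N%:R * d_level Omega.

Let q0 : 0 < q. Proof. exact: lt_trans (sobolev_exponent_gt1 R n). Qed.

Let c0 : 0 < c.
Proof.
rewrite /c; have [E0|E0] := ltP (E_fun Omega u0) 0; first by rewrite !mulr_gt0// oppr_gt0.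
by rewrite mulr_gt0 ?ltr0n// (le_lt_trans E0).
Qed.

Lemma regular_times_exist T : 0 < T -> weak_solution Omega u0 T u ->
  exists M (s : nat -> R -> 'rV[R]_N -> R) (A : set (measurableTypeR R)),
  [/\ measurable A, leb A = 0%E, forall k, simple_in_X Omega (s k) &
    forall t, `]0, T[%classic t -> ~ A t -> [/\ H10 Omega (u t), norm_X Omega (u t) <= M,
      nonneg_on Omega (u t) & norm_X Omega (s k t \- u t) @[k --> \oo] --> 0]].
Proof.
move=> T0 hu; have [[M aeM] [s [ss aes]]] := weak_Linfty hu; have ae0 := weak_ge0 hu.
have H := @filterI _ _ (ae_filter_ringOfSetsType leb) _ _ aeM
  (@filterI _ _ (ae_filter_ringOfSetsType leb) _ _ aes ae0).
have [A [mA A0 HA]] := H; exists M, s, A; split => // t; rewrite /= in_itv/= => t0 At.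
have [h1 [h2 h3]] : (0 < t < T -> H10 Omega (u t) /\ norm_X Omega (u t) <= M) /\
   (0 < t < T -> norm_X Omega (s k t \- u t) @[k --> \oo] --> 0) /\
   (0 < t < T -> \forall x \ae mu, Omega x -> 0 <= u t x).
  by apply: contrapT => h; apply: At; apply: HA.
by have [? ?] := h1 t0; split; [| |exact: h3|exact: h2].
Qed.

(** The solution is considered on (0, t + 1) because the good times lie in an open
    interval that has to contain almost all of [0, t]. *)
Lemma power_integral_lower_bound t : 0 < t -> weak_solution Omega u0 (t + 1) u ->
  c * t <= \int[leb]_(tau in `[0, t])
    (fine (norm_Lq Omega (p_crit R N + 1)%R (u tau)) `^ (p_crit R N + 1)).
Proof.
move=> t0 hu; have T0 : 0 < t + 1 by rewrite addr_gt0.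
have [M [s [A [mA A0 ss HA]]]] := regular_times_exist T0 hu.
have uH r (Wr : `]0, t + 1[%classic r) (Ar : ~ A r) : H10 Omega (u r) by have [] := HA r Wr Ar.
have uM r (Wr : `]0, t + 1[%classic r) (Ar : ~ A r) : norm_X Omega (u r) <= M.
  by have [] := HA r Wr Ar.
have u0' r (Wr : `]0, t + 1[%classic r) (Ar : ~ A r) : nonneg_on Omega (u r).
  by have [] := HA r Wr Ar.
have us r (Wr : `]0, t + 1[%classic r) (Ar : ~ A r) :
  norm_X Omega (s k r \- u r) @[k --> \oo] --> 0 by have [] := HA r Wr Ar.
pose v := regularized (t + 1) u0 u A.
have [g [L2g dg]] := weak_time_derivative hu.
have [cs Hcs] := time_derivative_constants oO bO T0 Hu0 hu mA A0 uH uM u0' L2g dg.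
pose G := continuity_times Omega (t + 1) u0 u A g cs.
have aeG := continuity_times_ae mA A0 Hcs.
rewrite -/G in aeG.
pose B r := ip mu Omega (abspow (v r) q) (abspow (v r) q).
have BE r : B r = B_fun Omega (v r) by rewrite B_funE.
have v0 : v 0 = u0 by exact: regularized0.
have HvH r : H10 Omega (v r) by exact: (regularized_H10 Hu0 uH).
have en r : G r -> E_fun Omega (v r) <= E_fun Omega u0.
  by move=> Gr; exact: (continuity_times_energy oO bO T0 Hu0 hu mA A0 ss uH uM u0' us L2g Hcs Gr).
have GT r : G r -> 0 < r < t + 1 by move=> [Wr _ _]; move: Wr; rewrite /= in_itv.
pose gam := energy_dissipation Omega (t + 1) g.
have holder := continuity_times_holder oO bO T0 Hu0 hu mA A0 uH L2g Hcs.
have lowB r : G r -> c <= B r.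
  move=> Gr; rewrite /c; have [E0|E0] := ltP (E_fun Omega u0) 0.
    have := en r Gr; rewrite E_funE -BE; have := A_fun_ge0 Omega (v r).
    move: (A_fun _ _) (B r) (E_fun _ _) => a b e a0 h.
    have {}h : - e <= (2 * q)^-1 * b by move: h a0; move: (_^-1 * b) => z; lra.
    have q20 : 0 < 2 * q by rewrite mulr_gt0.
    by apply: (le_trans (ler_wpM2l (ltW q20) h)); rewrite mulrA divff ?mul1r ?gt_eqF.
  move: r Gr; apply: (gap_preserved (a := N%:R * E_fun Omega u0)
    (Gam := gam (t + 1) - gam 0 + 1) T0 _ _ _ aeG GT).
  - by rewrite mulr_ge0.
  - by rewrite ltr_pM2l// ltr0n.
  - by rewrite ltr_wpDl// subr_ge0; apply: (energy_dissipation_ge0 oO L2g); rewrite ltW.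
  - move=> a b Ga Gb ab; have h := holder _ _ Ga Gb ab.
    have := sqrt_norm_triangle oO bO (HvH b) (HvH a).
    rewrite -/(B a) -/(B b) => /le_trans; apply; rewrite lerD2l ler_wsqrtr//.
    have -> : ip mu Omega (fun x => abspow (v a) q x - abspow (v b) q x)
        (fun x => abspow (v a) q x - abspow (v b) q x) =
      ip mu Omega (fun x => abspow (v b) q x - abspow (v a) q x)
        (fun x => abspow (v b) q x - abspow (v a) q x).
      by apply: eq_Rintegral => x _; rewrite -!expr2 -sqrrN opprB.
    apply: (le_trans h); apply: ler_wpM2l; first by rewrite subr_ge0.
    have mono := energy_dissipation_ge0 oO L2g.
    have b1 : b <= t + 1 by case: Gb => [->|/GT/andP[_ /ltW//]]; exact: ltW.
    have a1 : 0 <= a by case: Ga => [->//|/GT/andP[/ltW//]].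
    by apply: (le_trans (lerB (mono _ _ b1) (mono _ _ a1))); rewrite lerDl.
  - move=> r Gr; rewrite BE; have [D0|D0] := leP 0 (D_fun Omega (v r)).
      left; apply: (le_trans (B_fun_le_energy D0)).
      by rewrite ler_wpM2l// en.
    by right; exact: (d_level_le oO bO (HvH r) D0).
  - by rewrite BE v0; exact: (d_level_le oO bO Hu0 hD).
have [CB HCB] := regularized_B_bounded oO bO Hu0 uH uM.
have mB := regularized_B_measurable oO bO Hu0 hu mA uH uM.
have iB1 : leb.-integrable `]0, (t + 1)[ (EFin \o B).
  apply: (integrable_bounded_oo (C := CB)); first exact: mB.
  by move=> r _; rewrite ger0_norm ?ip_ge0//; exact: HCB.
have iB : leb.-integrable `]0, t[ (EFin \o B).
  by apply: (integrable_sub_itv (lexx 0) _ iB1); rewrite lerDl.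
have mt : measurable (`]0, t[%classic : set (measurableTypeR R)) by [].
have -> : \int[leb]_(tau in `[0, t])
    (fine (norm_Lq Omega (p_crit R N + 1)%R (u tau)) `^ (p_crit R N + 1)) =
    \int[leb]_(tau in `]0, t[) B tau.
  pose A' : set (measurableTypeR R) := A `|` ([set 0] `|` [set t]).
  have mA' : measurable A' by apply: measurableU => //; apply: measurableU.
  have A'0 : leb A' = 0%E.
    apply: null_set_setU => //; first exact: measurableU.
    by apply: null_set_setU => //; exact: lebesgue_measure_set1.
  rewrite [LHS]Rintegral_mkcond [RHS]Rintegral_mkcond.
  apply: (Rintegral_eq_off_null mA' A'0) => r _ A'r.
  have Ar : ~ A r by move=> ?; apply: A'r; left.
  have r0 : r != 0 by apply/eqP => ?; apply: A'r; right; left.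
  have rt : r != t by apply/eqP => ?; apply: A'r; right; right.
  rewrite !patchE !mem_setE !in_itv/= !lt_def r0 eq_sym rt/=.
  case: ifP => // /andP[hr0 hrt].
  have Wr : `]0, t + 1[%classic r.
    by rewrite /= in_itv/= lt_def r0 hr0/= (le_lt_trans hrt)// ltrDl.
  by rewrite (norm_Lq_B_fun (uH _ Wr Ar)) BE /v (regularizedE u0 u Wr Ar).
have -> : c * t = \int[leb]_(tau in `]0, t[) c.
  by rewrite Rintegral_cst_itv ?(ltW t0)// subr0.
apply: (ae_le_Rintegral mt) => //.
  by apply: (integrable_bounded_oo (C := `|c|)) => //; exact: measurable_cst.
apply: (@filterS _ _ (ae_filter_ringOfSetsType leb) _ _ _ aeG) => r Gr.
rewrite /= in_itv/= => /andP[r0 rt]; apply: lowB; apply: Gr.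
by rewrite r0 (lt_trans rt)// ltrDl.
Qed.

Lemma power_integral_cvg_pinfty : (forall T : R, 0 < T -> weak_solution Omega u0 T u) ->
  (\int[leb]_(tau in `[0, t])
    (fine (norm_Lq Omega (p_crit R N + 1)%R (u tau)) `^ (p_crit R N + 1)))
  @[t --> +oo] --> +oo.
Proof.
move=> hu; apply/cvgryPge => M; near=> t.
have t0 : 0 < t by near: t; exact: nbhs_pinfty_gt.
apply: le_trans (power_integral_lower_bound t0 (hu _ (addr_gt0 t0 ltr01))).
by rewrite mulrC -ler_pdivrMr//; near: t; exact: nbhs_pinfty_ge.
Unshelve. all: by end_near. Qed.

End blow_up.

Theorem theorem4p3 (R : realType) (N : nat) (hN : (3 <= N)%N)
  (Omega : set 'rV[R]_N) (hOmega : smooth_bounded_domain Omega)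
  (u0 : 'rV[R]_N -> R) (hu0 : H10 Omega u0)
  (hE : E_fun Omega u0 < d_level Omega) (hD : D_fun Omega u0 < 0)
  (u : R -> 'rV[R]_N -> R)
  (hu : forall T : R, 0 < T -> weak_solution Omega u0 T u) :
  (\int[@lebesgue_measure R]_(tau in `[0, t])
     (fine (norm_Lq Omega (p_crit R N + 1) (u tau)) `^ (p_crit R N + 1)))
  @[t --> +oo] --> +oo.
Proof.
case: N hN Omega hOmega u0 hu0 hE hD u hu => [|[|[|n]]]// _ Omega [oO _ _ bO _] u0 hu0 hE hD u hu.
exact: (power_integral_cvg_pinfty oO bO hu0 hE hD hu).
Qed.
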